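(* Orthogonal families of Hermitian Gaussian random matrices are asymptotically free of second order. Precisely: let $\mathcal H_{\mathbb R}$ be a real Hilbert space and $\{X_N(f)\}_{f\in\mathcal H_{\mathbb R}}$ a family of Hermitian Gaussian $N\times N$ random matrices. Then the family has a second order limit distribution, given by $(\mathcal A(\mathcal H_{\mathbb R}),\varphi,\rho)$ and the elements $\omega(f)\in\mathcal A(\mathcal H_{\mathbb R})$ ($f\in\mathcal H_{\mathbb R}$), where $\varphi(a)=\langle a\Omega,\Omega\rangle$ and $\rho(a_1,a_2)=\langle\mathbf c\,a_1\Omega,\mathbf c\,a_2^*\Omega\rangle_{\mathrm{cyc}}$. Moreover, if $\mathcal K_1,\dots,\mathcal K_n\subset\mathcal H_{\mathbb R}$ are pairwise orthogonal subspaces and $\mathcal A_i$ is the unital algebra generated by $\{\omega(f): f\in\mathcal K_i\}$, then $\mathcal A_1,\dots,\mathcal A_n$ are free with respect to $(\varphi,\rho)$; that is, the families $\{X_N(f):f\in\mathcal K_1\},\dots,\{X_N(f):f\in\mathcal K_n\}$ are asymptotically free of second order.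
   Context: Random matrices: $X_N(f)=(x_{ij}(f))_{i,j=1}^N$ is Hermitian for each $f\in\mathcal H_{\mathbb R}$, and the entries form a centered Gaussian family with $E\{x_{ij}(f)x_{kl}(g)\}=0$ for $i<j$, $k<l$, and $E\{x_{ij}(f)\overline{x_{kl}(g)}\}=\delta_{ik}\delta_{jl}\frac1N\langle f,g\rangle$ for $i\le j$, $k\le l$. Second order probability spaces: $(\mathcal A,\varphi,\rho)$ with $\mathcal A$ a unital complex algebra, $\varphi:\mathcal A\to\mathbb C$ tracial linear with $\varphi(1)=1$, $\rho:\mathcal A\times\mathcal A\to\mathbb C$ bilinear, tracial in each argument, with $\rho(a,1)=0=\rho(1,b)$. Given unital subalgebras $\mathcal A_1,\dots,\mathcal A_r$, a tuple $(a_1,\dots,a_n)$, $n\ge1$, is cyclically alternating if for each $k$ there is $i(k)$ with $a_k\in\mathcal A_{i(k)}$ and, if $n\ge2$, $i(k)\ne i(k+1)$ for $k=1,\dots,n$ (indices mod $n$); centered if $\varphi(a_k)=0$ for all $k$. The subalgebras are free with respect to $(\varphi,\rho)$ if they are free with respect to $\varphi$ and for all centered, cyclically alternating $(a_1,\dots,a_n)$, $(b_1,\dots,b_m)$: (i) $\rho(a_1\cdots a_n,b_1\cdots b_m)=0$ for $n\ne m$; (ii) $\rho(a,b)=0$ for $a\in\mathcal A_i$, $b\in\mathcal A_j$, $i\ne j$; (iii) if $n=m\ge2$, $\rho(a_1\cdots a_n,b_1\cdots b_n)=\sum_{k=0}^{n-1}\varphi(a_1b_{n+k})\varphi(a_2b_{(n-1)+k})\cdots\varphi(a_nb_{1+k})$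 (indices of $b$ mod $n$). A family of $N\times N$ random matrices $\{A_i\}_{i\in I}$ (for each $N$) has second order limit distribution given by $(\mathcal A,\varphi,\rho)$ and $a_i\in\mathcal A$ ($i\in I$) if for all polynomials $p_1,p_2,\dots$ in finitely many of the non-commuting indeterminates: $\lim_Nk_1\{\mathrm{tr}[p_1(A)]\}=\varphi(p_1(a))$; $\lim_Nk_2\{\mathrm{Tr}[p_1(A)],\mathrm{Tr}[p_2(A)]\}=\rho(p_1(a),p_2(a))$; and for $r\ge3$, $\lim_Nk_r\{\mathrm{Tr}[p_1(A)],\dots,\mathrm{Tr}[p_r(A)]\}=0$. Here $\mathrm{Tr}$ is the un-normalized trace, $\mathrm{tr}=\frac1N\mathrm{Tr}$, and $k_r$ is the $r$-th classical (multilinear) cumulant. Several such families are asymptotically free of second order if their union has a second order limit distribution and the unital algebras generated by the respective limit elements are free with respect to $(\varphi,\rho)$. Fock space: $\mathcal H$ is the complexification of $\mathcal H_{\mathbb R}$ (inner product linear in the first argument) with involution $\overline{f_1+if_2}=f_1-if_2$. On $\mathcal F_{\mathrm{lin}}(\mathcal H)=\mathbb C\Omega\oplus\bigoplus_{n\ge1}\mathcal H^{\otimes n}$ (algebraic): $l(f)\Omega=f$, $l(f)f_1\otimes\cdots\otimes f_n=f\otimes f_1\otimes\cdots\otimes f_n$; $l^*(f)\Omega=0$, $l^*(f)f_1\otimes\cdots\otimes f_n=\langle f_1,f\rangle f_2\otimes\cdots\otimes f_n$. For $f\in\mathcal H_{\mathbb R}$, $\omega(f)=l(f)+l^*(f)$,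 and $\mathcal A(\mathcal H_{\mathbb R})$ is the complex unital $*$-algebra generated by all $\omega(f)$, $f\in\mathcal H_{\mathbb R}$ (with $\omega(f)^*=\omega(f)$). Cyclic Fock space: $\mathcal F_{\mathrm{cyc}}(\mathcal H)=\bigoplus_{n\ge0}\mathcal H^{\otimes n}_{\mathrm{cyc}}$ (algebraic), $\mathcal H^{\otimes n}_{\mathrm{cyc}}$ being spanned by circular tensors $[f_1\otimes\cdots\otimes f_n]$ (multilinear, invariant under cyclic rotation), with inner product determined by $\langle[f_1\otimes\cdots\otimes f_n],[g_1\otimes\cdots\otimes g_m]\rangle_{\mathrm{cyc}}=\delta_{nm}\sum_{k=0}^{n-1}\langle f_1,g_{1+k}\rangle\cdots\langle f_n,g_{n+k}\rangle$ (indices of $g$ mod $n$). The linear map $\mathbf c:\mathcal F_{\mathrm{lin}}(\mathcal H)\to\mathcal F_{\mathrm{cyc}}(\mathcal H)$ is given by $\mathbf c\,\Omega=0$, $\mathbf c(f)=[f]$, and for $n\ge2$, $\mathbf c(f_1\otimes\cdots\otimes f_n)=[f_1\otimes\cdots\otimes f_n]+\langle f_1,\overline{f_n}\rangle\,\mathbf c(f_2\otimes\cdots\otimes f_{n-1})$ (empty tensor $=\Omega$). *)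

(* Defs.v *)
From HB Require Import structures.
From mathcomp Require Import all_boot all_order all_algebra finmap.
From mathcomp Require Import all_classical all_reals all_analysis.
From mathcomp Require Import complex ring.
(* The notations of monalg clash with those of mathcomp-analysis. *)
From mathcomp Require monalg.
Export -(notations) monalg.

Set Implicit Arguments.
Unset Strict Implicit.
Unset Printing Implicit Defensive.

Import Order.TTheory GRing.Theory Num.Theory.
Export numFieldNormedType.Exports.

Local Open Scope classical_set_scope.
Local Open Scope ring_scope.

HB.mixin Record isRealHilbert (R : realType) V of CompleteNormedModule R V := {
  ip : V -> V -> R ;
  ipC : forall x y, ip x y = ip y x ;
  ip_linearl : forall y, scalar (ip^~ y) ;
  ip_norm : forall x, `|x| ^+ 2 = ip x x
}.

#[short(type="realHilbertType")]
HB.structure Definition RealHilbert (R : realType) :=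
  {V of isRealHilbert R V & CompleteNormedModule R V}.

(* The pair (f1, f2) stands for f1 + i f2. *)
Definition cplxn (R : realType) (H : realHilbertType R) : Type := (H * H)%type.

Section Complexification.
Context {R : realType} {H : realHilbertType R}.
Local Notation C := R[i].
Local Notation HC := (cplxn H).

HB.instance Definition _ := GRing.Zmodule.copy HC (H * H)%type.

Definition cplxn_scale (a : C) (x : HC) : HC :=
  (complex.Re a *: x.1 - complex.Im a *: x.2,
   complex.Re a *: x.2 + complex.Im a *: x.1).

Fact cplxn_scaleA a b x :
  cplxn_scale a (cplxn_scale b x) = cplxn_scale (a * b) x.
Proof.
case: a b x => [a1 a2] [b1 b2] [f1 f2]; congr pair => /=.
  rewrite scalerBr scalerDr !scalerA scalerBl scalerDl !opprD !addrA.
  by rewrite [in LHS]addrAC; congr (_ - _); rewrite addrAC.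
rewrite scalerBr scalerDr !scalerA scalerBl scalerDl.
by rewrite [X in _ + X = _]addrC addrACA.
Qed.

Fact cplxn_scale1 : left_id 1 cplxn_scale.
Proof.
by case=> f1 f2; rewrite /cplxn_scale /= !scale1r !scale0r subr0 addr0.
Qed.

Fact cplxn_scaleDr : right_distributive cplxn_scale +%R.
Proof.
move=> a [f1 f2] [g1 g2]; congr pair => /=.
  by rewrite !scalerDr opprD addrACA.
by rewrite !scalerDr addrACA.
Qed.

Fact cplxn_scaleDl x : {morph cplxn_scale^~ x : a b / a + b}.
Proof.
case: x => f1 f2 [a1 a2] [b1 b2]; congr pair => /=.
  by rewrite !scalerDl opprD addrACA.
by rewrite !scalerDl addrACA.
Qed.

HB.instance Definition _ := GRing.Zmodule_isLmodule.Build C HC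
  cplxn_scaleA cplxn_scale1 cplxn_scaleDr cplxn_scaleDl.

Definition ofreal (f : H) : HC := (f, 0).

Definition cplxn_conj (x : HC) : HC := (x.1, - x.2).

Definition cip (x y : HC) : C :=
  ((ip x.1 y.1 + ip x.2 y.2) +i* (ip x.2 y.1 - ip x.1 y.2))%C.

Lemma ipDl (x y z : H) : ip (x + y) z = ip x z + ip y z.
Proof. by have := ip_linearl z 1 x y; rewrite scale1r mul1r. Qed.

Lemma ip0l (z : H) : ip 0 z = 0.
Proof. by apply: (addrI (ip 0 z)); rewrite -ipDl !addr0. Qed.

Lemma ipZl a (x z : H) : ip (a *: x) z = a * ip x z.
Proof. by have := ip_linearl z a x 0; rewrite ip0l !addr0. Qed.

Lemma ipNl (x z : H) : ip (- x) z = - ip x z.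
Proof. by rewrite -scaleN1r ipZl mulN1r. Qed.

Lemma cip_linearl y : scalar (cip^~ y).
Proof.
move=> [a1 a2] [f1 f2] [g1 g2]; apply/eqP; rewrite eq_complex /=.
rewrite !ipDl !ipNl !ipZl; apply/andP; split; apply/eqP; ring.
Qed.

Lemma cipC x y : cip x y = (cip y x)^*.
Proof.
apply/eqP; rewrite eq_complex /= (ipC x.1) (ipC x.2 y.2) (ipC x.2 y.1).
by rewrite (ipC x.1 y.2) opprB !eqxx.
Qed.

Lemma cplxn_conj_is_conj a x y :
  cplxn_conj (a *: x + y) = a^* *: cplxn_conj x + cplxn_conj y.
Proof.
case: a x y => [a1 a2] [f1 f2] [g1 g2]; congr pair => /=.
  by rewrite scalerN scaleNr opprK.
by rewrite scalerN scaleNr !opprD.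
Qed.

End Complexification.

Section Span.
Context {K : nzRingType} {V : lmodType K}.

Definition lspan (S : set V) : {pred V} := [pred x |
  `[< forall B : {pred V}, submod_closed B -> (forall y, S y -> y \in B) ->
      x \in B >]].

Lemma lspan_submod_closed S : submod_closed (lspan S).
Proof.
split=> [|a x y /asboolP xS /asboolP yS]; apply/asboolP => B Bc SB.
  by case: Bc.
by case: (Bc) => _; apply; [exact: xS | exact: yS].
Qed.

HB.instance Definition _ S :=
  GRing.isSubmodClosed.Build K V (lspan S) (lspan_submod_closed S).

Lemma mem_lspan (S : set V) x : S x -> x \in lspan S.
Proof. by move=> Sx; apply/asboolP => B _; apply. Qed.

Lemma lspan_ker (W : lmodType K) (f : V -> W) (S : set V) : linear f ->
  (forall x, S x -> f x = 0) -> forall x, x \in lspan S -> f x = 0.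
Proof.
move=> lf fS x /asboolP /(_ [pred x | f x == 0]) h; apply/eqP/h; last first.
  by move=> y /fS fy; rewrite inE fy.
split=> [|a y z]; rewrite !inE.
  by have := lf (-1) 0 0; rewrite !scaleN1r oppr0 addr0 addNr => ->.
by rewrite lf => /eqP-> /eqP->; rewrite scaler0 addr0.
Qed.

End Span.

Definition presented (K : comNzRingType) (G : choiceType) (S : set (malg G K)) :
  Type := Quotient.quot (lspan S).

HB.instance Definition _ K G S := GRing.Zmodule.on (@presented K G S).

(* The locks below only keep unification from computing. *)
HB.lock Definition cls (K : comNzRingType) (G : choiceType)
  (S : set (malg G K)) (p : malg G K) : presented S :=
  \pi_(Quotient.quot (lspan S))%qT p.

HB.lock Definition rep (K : comNzRingType) (G : choiceType)
  (S : set (malg G K)) (x : presented S) : malg G K :=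
  repr (x : Quotient.quot (lspan S)).

HB.lock Definition lext (K : comNzRingType) (G : choiceType) (W : lmodType K)
    (F : G -> W) (p : malg G K) : W :=
  \sum_(t <- msupp p) mcoeff t p *: F t.

Arguments cls {K G} S p.
Arguments rep {K G S} x.
Arguments lext {K G W} F p.

Section Presented.
Context {K : comNzRingType} {G : choiceType}.
Local Notation free := (malg G K).
Implicit Type S : set free.

Section Lmod.
Variable S : set free.

Local Notation cls := (cls S).

Lemma repK x : cls (rep x) = x.
Proof. by rewrite rep.unlock cls.unlock; exact: reprK. Qed.

Lemma cls_eq p q : (cls p = cls q) <-> (p - q \in lspan S).
Proof. by rewrite !cls.unlock (Quotient.idealrBE (lspan S)); split=> [h|/eqP //]; apply/eqP. Qed.

Lemma clsB p q : cls (p - q) = cls p - cls q.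
Proof.
rewrite !cls.unlock; exact: (raddfB (\pi_(Quotient.quot (lspan S)))%qT).
Qed.

Lemma clsD p q : cls (p + q) = cls p + cls q.
Proof.
rewrite !cls.unlock; exact: (raddfD (\pi_(Quotient.quot (lspan S)))%qT).
Qed.

Definition presented_scale (a : K) (x : presented S) := cls (a *: rep x).

Lemma presented_scaleE a p : presented_scale a (cls p) = cls (a *: p).
Proof.
by apply/cls_eq; rewrite -scalerBr rpredZ//; apply/cls_eq; rewrite repK.
Qed.

Fact presented_scaleA a b x :
  presented_scale a (presented_scale b x) = presented_scale (a * b) x.
Proof. by rewrite -(repK x) !presented_scaleE scalerA. Qed.

Fact presented_scale1 : left_id 1 presented_scale.
Proof. by move=> x; rewrite -(repK x) !presented_scaleE scale1r. Qed.

Fact presented_scaleDr : right_distributive presented_scale +%R.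
Proof.
move=> a x y; rewrite -(repK x) -(repK y) -clsD !presented_scaleE.
by rewrite scalerDr clsD.
Qed.

Fact presented_scaleDl x : {morph presented_scale^~ x : a b / a + b}.
Proof.
by move=> a b; rewrite -(repK x) !presented_scaleE scalerDl clsD.
Qed.

HB.instance Definition _ := GRing.Zmodule_isLmodule.Build K (presented S)
  presented_scaleA presented_scale1 presented_scaleDr presented_scaleDl.

Lemma cls_linear : linear cls.
Proof. by move=> a p q; rewrite clsD -presented_scaleE. Qed.

Definition gen (t : G) : presented S := cls (mkmalgU t 1).

End Lmod.

(* The map induced by F on the quotient. It is computed on a representative and
   is meaningful when F respects the relations; see lift_gen and lift_linear. *)
Definition lift S (W : lmodType K) (F : G -> W) (x : presented S) : W :=
  lext F (rep x).

Definition respects S (W : lmodType K) (F : G -> W) :=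
  forall p, S p -> lext F p = 0.

Section LextTheory.
Variable W : lmodType K.
Implicit Type F : G -> W.

Lemma lextEw F (d : {fset G}) p : (msupp p `<=` d)%fset ->
  lext F p = \sum_(t <- d) mcoeff t p *: F t.
Proof.
move=> le; rewrite lext.unlock [LHS](big_fset_incl _ le) => //= x xd /mcoeff_outdom ->.
by rewrite scale0r.
Qed.

Lemma lext_linear F : linear (lext F).
Proof.
move=> a p q; pose d := (msupp p `|` msupp q `|` msupp (a *: p + q))%fset.
have sp : (msupp p `<=` d)%fset by rewrite /d -fsetUA fsubsetUl.
have sq : (msupp q `<=` d)%fset.
  by rewrite /d [(msupp p `|` _)%fset]fsetUC -fsetUA fsubsetUl.
rewrite (lextEw F sp) (lextEw F sq) (@lextEw F d) ?fsubsetUr//.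
rewrite scaler_sumr -big_split; apply: eq_bigr => t _ /=.
by rewrite mcoeffD mcoeffZ scalerDl scalerA.
Qed.

Lemma lextU F t a : lext F (mkmalgU t a) = a *: F t.
Proof.
by rewrite (lextEw F msuppU_le) big_seq_fset1 mcoeffUU.
Qed.

Lemma lextB F p q : lext F (p - q) = lext F p - lext F q.
Proof.
by rewrite addrC -[- q]scaleN1r lext_linear scaleN1r addrC.
Qed.

Lemma lextZ F a p : lext F (a *: p) = a *: lext F p.
Proof.
have e0 : lext F 0 = 0 by rewrite lext.unlock msupp0 big_seq_fset0.
by have := lext_linear F a p 0; rewrite e0 !addr0.
Qed.

Lemma lextFlin a F1 F2 p :
  lext (fun t => a *: F1 t + F2 t) p = a *: lext F1 p + lext F2 p.
Proof.
rewrite !lext.unlock scaler_sumr -big_split; apply: eq_bigr => t _ /=.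
by rewrite scalerDr !scalerA mulrC.
Qed.

Lemma lext0 (p : free) : lext (fun _ : G => 0 : W) p = 0.
Proof. by rewrite lext.unlock big1// => t _; rewrite scaler0. Qed.

End LextTheory.

Section LiftTheory.
Variables (S : set free) (W : lmodType K) (F : G -> W).
Hypothesis rF : respects S F.

Lemma lift_cls p : lift F (cls S p) = lext F p.
Proof.
apply/subr0_eq; rewrite /lift -lextB.
apply: (lspan_ker (@lext_linear _ F) rF).
by apply/cls_eq; rewrite repK.
Qed.

Lemma lift_gen t : lift F (gen S t) = F t.
Proof. by rewrite lift_cls lextU scale1r. Qed.

Lemma lift_linear : linear (@lift S W F).
Proof.
move=> a x y; rewrite -(repK x) -(repK y) -cls_linear !lift_cls.
exact: lext_linear.
Qed.

End LiftTheory.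

Lemma gen_ind S (P : presented S -> Prop) : P 0 ->
  (forall a t x, P x -> P (a *: gen S t + x)) -> forall x, P x.
Proof.
move=> P0 PS x; rewrite -(repK x); move: (rep x) => p {x}.
rewrite (monalgE p); elim: (enum_fset (msupp p)) => [|t s IH].
  rewrite big_nil; suff -> : cls S 0 = 0 by [].
  by have := clsB S 0 0; rewrite !subrr.
rewrite big_cons; have -> : mkmalgU t (mcoeff t p) = mcoeff t p *: mkmalgU t 1.
  by apply/malgP => u; rewrite mcoeffZ !mcoeffU mulrnAr mulr1.
by rewrite cls_linear; apply: PS.
Qed.

End Presented.

Section Sesquilinear.
Context {R : realType} {G : choiceType}.
Local Notation C := R[i].
Local Notation free := (malg G C).

(* The form, linear in x and conjugate-linear in y, with the values B on the
   generators; see sesq_gen. *)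
Definition sesq (S : set free) (B : G -> G -> C) (x y : presented S) : C :=
  lift (fun s => ((lift (fun t => (B s t)^* : C^o) y)^* : C^o)) x.

Variables (S : set free) (B : G -> G -> C).
Hypothesis rBl : forall t, respects S (B^~ t : G -> C^o).
Hypothesis Bherm : forall s t, B s t = (B t s)^*.

Let rBr s : respects S (fun t => (B s t)^* : C^o).
Proof.
by move=> p Sp; rewrite -(rBl s Sp) !lext.unlock; apply: eq_bigr => t _; rewrite -Bherm.
Qed.

Let rB (y : presented S) :
  respects S (fun s => ((lift (fun t => (B s t)^* : C^o) y)^* : C^o)).
Proof.
move=> p Sp; elim/(@gen_ind _ G S): y => [|a t y IH].
  rewrite -[RHS](lext0 C^o p) !lext.unlock; apply: eq_bigr => s _; congr (_ *: _).
  have /(_ (-1) 0 0) := lift_linear (@rBr s).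
  by rewrite !scaleN1r oppr0 addr0 addNr => ->; rewrite rmorph0.
have := lextFlin (W := C^o) a^* (B^~ t)
  (fun s => ((lift (S := S) (fun t => (B s t)^* : C^o) y)^* : C^o)) p.
rewrite IH (rBl t Sp) scaler0 addr0 => <-.
rewrite !lext.unlock; apply: eq_bigr => s _; congr (_ *: _).
by rewrite (lift_linear (@rBr s)) (lift_gen (@rBr s)) rmorphD rmorphM /= conjCK.
Qed.

Lemma sesq_gen s t : sesq B (gen S s) (gen S t) = B s t.
Proof. by rewrite /sesq (lift_gen (rB _)) (lift_gen (@rBr s)) conjCK. Qed.

Lemma sesq_linearl y : scalar ((@sesq S B)^~ y).
Proof. exact: (lift_linear (rB y)). Qed.

Lemma sesq0l y : sesq B (0 : presented S) y = 0.
Proof.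
by have := sesq_linearl y (-1) 0 0; rewrite scaler0 addr0 mulN1r addNr.
Qed.

Lemma sesq_linearr x a y z :
  sesq B x (a *: y + z) = a^* * @sesq S B x y + sesq B x z.
Proof.
elim/(@gen_ind _ G S): x => [|b s x IH]; first by rewrite !sesq0l mulr0 addr0.
rewrite !sesq_linearl IH /sesq !(lift_gen (rB _)) (lift_linear (@rBr s)).
by rewrite rmorphD rmorphM /=; ring.
Qed.

Lemma sesqC x y : sesq B x y = (@sesq S B y x)^*.
Proof.
have s0r z : sesq B z (0 : presented S) = 0.
  by have := sesq_linearr z (-1) 0 0; rewrite scaler0 addr0 rmorphN1 mulN1r addNr.
elim/(@gen_ind _ G S): x => [|a s x IH]; first by rewrite sesq0l s0r rmorph0.
rewrite sesq_linearl sesq_linearr rmorphD rmorphM /= conjCK IH.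
congr (_ * _ + _); elim/(@gen_ind _ G S): y {IH} => [|b t y IH].
  by rewrite sesq0l s0r rmorph0.
by rewrite sesq_linearl sesq_linearr rmorphD rmorphM /= IH !sesq_gen -Bherm.
Qed.

End Sesquilinear.

Section Fock.
Context {R : realType} {H : realHilbertType R}.
Local Notation C := R[i].
Local Notation HC := (cplxn H).
Local Notation word := (seq HC).
Implicit Types (s t u : word) (f g h : HC).

(* The generator [:: f_1; ...; f_n] stands for the tensor f_1 (x) ... (x) f_n,
   and [::] for the vacuum; mlrel makes the generators multilinear in their
   letters, so that each degree of Flin is the algebraic tensor power. *)
Definition mlrel : set (malg word C) := [set p | exists s u (a : C) f g,
  p = mkmalgU (s ++ (a *: f + g) :: u) 1
      - (a *: mkmalgU (s ++ f :: u) 1 + mkmalgU (s ++ g :: u) 1)].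

Definition rotrel : set (malg word C) := [set p | exists s,
  p = mkmalgU (rot 1 s) 1 - mkmalgU s 1].

Definition Flin : Type := presented mlrel.
Definition Fcyc : Type := presented (mlrel `|` rotrel).

HB.instance Definition _ := GRing.Lmodule.on Flin.
HB.instance Definition _ := GRing.Lmodule.on Fcyc.

Definition tens s : Flin := gen mlrel s.
Definition vac : Flin := tens [::].
Definition ctens s : Fcyc := gen (mlrel `|` rotrel) s.

Lemma Flin_ind (P : Flin -> Prop) : P 0 ->
  (forall (a : C) s x, P x -> P (a *: tens s + x)) -> forall x, P x.
Proof. exact: gen_ind. Qed.

Lemma Fcyc_ind (P : Fcyc -> Prop) : P 0 ->
  (forall (a : C) s x, P x -> P (a *: ctens s + x)) -> forall x, P x.
Proof. exact: gen_ind. Qed.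

Definition multilinear (W : lmodType C) (F : word -> W) :=
  forall s u (a : C) f g,
    F (s ++ (a *: f + g) :: u) = a *: F (s ++ f :: u) + F (s ++ g :: u).

Lemma multilinear_respects (W : lmodType C) (F : word -> W) :
  multilinear F -> respects mlrel F.
Proof.
move=> mF p [s [u [a [f [g ->]]]]].
by rewrite lextB lext_linear !lextU !scale1r mF subrr.
Qed.

Lemma cyclic_respects (W : lmodType C) (F : word -> W) :
  multilinear F -> (forall s, F (rot 1 s) = F s) ->
  respects (mlrel `|` rotrel) F.
Proof.
move=> mF rF p [|[s ->]]; first exact: multilinear_respects.
by rewrite lextB !lextU !scale1r rF subrr.
Qed.

Lemma gen_multilinear S : mlrel `<=` S -> multilinear (gen S).
Proof.
move=> sub s u a f g; rewrite /gen -cls_linear; apply/cls_eq/mem_lspan/sub.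
by exists s, u, a, f, g.
Qed.

Lemma tens_multilinear : multilinear tens.
Proof. exact: gen_multilinear. Qed.

Lemma ctens_multilinear : multilinear ctens.
Proof. exact: gen_multilinear (@subsetUl _ _ _). Qed.

Lemma ctens_rot s : ctens (rot 1 s) = ctens s.
Proof. by apply/cls_eq/mem_lspan; right; exists s. Qed.

Fixpoint wip s t : C :=
  match s, t with
  | [::], [::] => 1
  | f :: s', g :: t' => cip f g * wip s' t'
  | _, _ => 0
  end.

(* The sum over k of the products of the <f_i, g_{i+k}>; it is empty for the
   empty word, but the range of cmap has no component of degree 0. *)
Definition cwip s t : C := \sum_(k < size t) wip s (rot k t).

Definition fock_ip : Flin -> Flin -> C := sesq wip.
Definition cyc_ip : Fcyc -> Fcyc -> C := sesq cwip.

Lemma wipC s t : wip s t = (wip t s)^*.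
Proof.
elim: s t => [|f s IH] [|g t] /=; rewrite ?rmorph0 ?rmorph1//.
by rewrite rmorphM /= -IH -cipC.
Qed.

Lemma wip_multilinear t : multilinear (wip^~ t : word -> C^o).
Proof.
move=> s u a f g; elim: s t => [|h s IH] [|k t] /=.
- by rewrite scaler0 addr0.
- by rewrite (cip_linearl k a f g) mulrDl -scalerAl.
- by rewrite scaler0 addr0.
- by rewrite IH mulrDr scalerAr.
Qed.

Lemma wip_size s t : size s != size t -> wip s t = 0.
Proof.
elim: s t => [|f s IH] [|g t] //=; rewrite eqSS => /IH ->.
by rewrite mulr0.
Qed.

Lemma wip_cat s1 s2 t1 t2 : size s1 = size t1 ->
  wip (s1 ++ s2) (t1 ++ t2) = wip s1 t1 * wip s2 t2.
Proof.
elim: s1 t1 => [|f s1 IH] [|g t1] //=; first by rewrite mul1r.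
by case=> /IH ->; rewrite mulrA.
Qed.

Lemma wip_rot k s t : size s = size t -> wip (rot k s) (rot k t) = wip s t.
Proof.
move=> e; rewrite /rot wip_cat ?size_drop ?e//.
by rewrite mulrC -wip_cat ?cat_take_drop// !size_take e.
Qed.

Lemma cwip_rotr s t : cwip s (rot 1 t) = cwip s t.
Proof.
rewrite /cwip size_rot.
have -> : \sum_(k < size t) wip s (rot k (rot 1 t)) =
          \sum_(k < size t) wip s (rot k.+1 t).
  by apply: eq_bigr => k _; rewrite -rotD ?addn1.
case e: (size t) => [|n]; first by rewrite !big_ord0.
by rewrite big_ord_recr [RHS]big_ord_recl /= addrC rot0 -e rot_size.
Qed.

Lemma cwipC s t : cwip s t = (cwip t s)^*.
Proof.
have [e|ne] := eqVneq (size s) (size t); last first.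
  by rewrite /cwip !big1 ?rmorph0// => k _; rewrite wip_size// size_rot// eq_sym.
rewrite /cwip rmorph_sum /=; under [RHS]eq_bigr do rewrite -wipC.
have -> : \sum_(k < size s) wip (rot k s) t =
          \sum_(k < size s) wip (rot k.+1 s) t.
  case e': (size s) => [|n]; first by rewrite !big_ord0.
  by rewrite big_ord_recl [RHS]big_ord_recr /= addrC rot0 -e' rot_size.
rewrite (reindex_inj rev_ord_inj) /= e; apply: eq_bigr => k _.
rewrite -(@wip_rot k.+1) ?size_rot//; congr wip.
by rewrite -rotD subnKC ?rot_size// leqnn.
Qed.

Lemma cwip_multilinear t : multilinear (cwip^~ t : word -> C^o).
Proof.
move=> s u a f g; rewrite /cwip scaler_sumr -big_split; apply: eq_bigr => k _.
exact: wip_multilinear.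
Qed.

Lemma cwip_rotl s t : cwip (rot 1 s) t = cwip s t.
Proof. by rewrite cwipC cwip_rotr -cwipC. Qed.

Lemma fock_ip_tens s t : fock_ip (tens s) (tens t) = wip s t.
Proof.
by apply: sesq_gen wipC _ _ => v; apply/multilinear_respects/wip_multilinear.
Qed.

Lemma fock_ip_linearl y : scalar (fock_ip^~ y).
Proof.
by apply: sesq_linearl wipC y => v; apply/multilinear_respects/wip_multilinear.
Qed.

Lemma fock_ipC x y : fock_ip x y = (fock_ip y x)^*.
Proof.
by apply: sesqC wipC x y => v; apply/multilinear_respects/wip_multilinear.
Qed.

Let cwip_respects t :
  respects (mlrel `|` rotrel) (cwip^~ t : word -> C^o).
Proof.
by apply: cyclic_respects => [|s]; [exact: cwip_multilinear|exact: cwip_rotl].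
Qed.

Lemma cyc_ip_ctens s t : cyc_ip (ctens s) (ctens t) = cwip s t.
Proof. exact: sesq_gen cwip_respects cwipC s t. Qed.

Lemma cyc_ip_linearl y : scalar (cyc_ip^~ y).
Proof. exact: sesq_linearl cwip_respects cwipC y. Qed.

Lemma cyc_ipC x y : cyc_ip x y = (cyc_ip y x)^*.
Proof. exact: sesqC cwip_respects cwipC x y. Qed.

(* Annihilation is conjugate-linear in f, cip being linear in its first
   argument. *)
Definition annihilate f s : Flin :=
  if s is g :: u then cip g f *: tens u else 0.

Definition lcre f : Flin -> Flin := lift (fun s => tens (f :: s)).
Definition lann f : Flin -> Flin := lift (annihilate f).

Definition omega0 (f : H) (x : Flin) : Flin :=
  lcre (ofreal f) x + lann (ofreal f) x.

Lemma annihilate_multilinear f : multilinear (annihilate f).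
Proof.
move=> [|k s] u a g h /=; first by rewrite cip_linearl scalerDl scalerA.
by rewrite tens_multilinear scalerDr !scalerA mulrC.
Qed.

Let lcre_respects f : respects mlrel (fun s => tens (f :: s)).
Proof.
apply: multilinear_respects => s u a g h.
exact: (tens_multilinear (f :: s)).
Qed.

Let lann_respects f : respects mlrel (annihilate f).
Proof. exact/multilinear_respects/annihilate_multilinear. Qed.

Lemma lcre_tens f s : lcre f (tens s) = tens (f :: s).
Proof. exact: lift_gen. Qed.

Lemma lcre_linear f : linear (lcre f).
Proof. exact: lift_linear. Qed.

Lemma lann_vac f : lann f vac = 0.
Proof. exact: (lift_gen (@lann_respects f)). Qed.

Lemma lann_tens f g s : lann f (tens (g :: s)) = cip g f *: tens s.
Proof. exact: (lift_gen (@lann_respects f)). Qed.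

Lemma lann_linear f : linear (lann f).
Proof. exact: lift_linear. Qed.

Lemma omega0_linear (f : H) : linear (omega0 f).
Proof.
move=> a x y; rewrite /omega0 lcre_linear lann_linear scalerDr.
by rewrite addrACA.
Qed.

Lemma fock_ip0l y : fock_ip 0 y = 0.
Proof.
by have := fock_ip_linearl y (-1) 0 0; rewrite scaler0 addr0 mulN1r addNr.
Qed.

Lemma fock_ip_linearr x a y z :
  fock_ip x (a *: y + z) = a^* * fock_ip x y + fock_ip x z.
Proof.
by rewrite fock_ipC fock_ip_linearl rmorphD rmorphM /= -!fock_ipC.
Qed.

Lemma fock_ip0r x : fock_ip x 0 = 0.
Proof. by rewrite fock_ipC fock_ip0l rmorph0. Qed.

Lemma lcre_adj f x y : fock_ip (lcre f x) y = fock_ip x (lann f y).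
Proof.
have l0 (F : Flin -> Flin) : linear F -> F 0 = 0.
  by move=> lF; have := lF (-1) 0 0; rewrite !scaleN1r oppr0 addr0 addNr.
have key s t : fock_ip (lcre f (tens s)) (tens t) =
               fock_ip (tens s) (lann f (tens t)).
  rewrite lcre_tens; case: t => [|g t].
    by rewrite fock_ip_tens lann_vac fock_ip0r.
  rewrite fock_ip_tens lann_tens fock_ipC -[_ *: _]addr0 fock_ip_linearl.
  by rewrite fock_ip0l addr0 fock_ip_tens rmorphM /= -wipC -cipC.
have key2 s : fock_ip (lcre f (tens s)) y = fock_ip (tens s) (lann f y).
  elim/Flin_ind: y => [|a t z IH].
    by rewrite (l0 _ (lann_linear f)) !fock_ip0r.
  rewrite lann_linear fock_ip_linearr [RHS]fock_ip_linearr key.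
  by rewrite IH.
elim/Flin_ind: x => [|a s x IH].
  by rewrite (l0 _ (lcre_linear f)) !fock_ip0l.
rewrite lcre_linear fock_ip_linearl [RHS]fock_ip_linearl key2.
by rewrite IH.
Qed.

Lemma omega0_adj (f : H) x y : fock_ip (omega0 f x) y = fock_ip x (omega0 f y).
Proof.
have DL (u v w : Flin) : fock_ip (u + v) w = fock_ip u w + fock_ip v w.
  by have := fock_ip_linearl w 1 u v; rewrite scale1r mul1r.
have DR (u v w : Flin) : fock_ip u (v + w) = fock_ip u v + fock_ip u w.
  by rewrite fock_ipC DL rmorphD /= -!fock_ipC.
rewrite /omega0 DL DR addrC (lcre_adj _ x); congr (_ + _).
by rewrite [LHS]fock_ipC -lcre_adj [RHS]fock_ipC.
Qed.

(* The first argument is only fuel, size s being enough; see cword_rcons. *)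
Fixpoint crec (n : nat) s : Fcyc :=
  match n, s with
  | n'.+1, [:: f] => ctens [:: f]
  | n'.+1, f :: g :: u =>
      ctens s + cip f (cplxn_conj (last g u)) *: crec n' (belast g u)
  | _, _ => 0
  end.

Definition cword s : Fcyc := crec (size s) s.

Definition cmap : Flin -> Fcyc := lift cword.

Lemma crec_fuel n m s : (size s <= n)%N -> (size s <= m)%N ->
  crec n s = crec m s.
Proof.
have c0 k : crec k [::] = 0 by case: k.
elim: n m s => [|n IH] m s.
  by rewrite leqn0 => /nilP-> _; rewrite !c0.
case: m => [|m hn]; first by rewrite leqn0 => _ /nilP->; rewrite !c0.
case: s hn => [|f [|g u]] hn hm; [by rewrite !c0|by []|].
rewrite /crec -/crec; have -> // : crec n (belast g u) = crec m (belast g u).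
by apply: IH; rewrite size_belast; [exact: ltnW hn|exact: ltnW hm].
Qed.

Lemma cword_rcons f u g : cword (f :: rcons u g) =
  ctens (f :: rcons u g) + cip f (cplxn_conj g) *: cword u.
Proof.
have E n h v : crec n.+1 (f :: h :: v) = ctens (f :: h :: v) +
    cip f (cplxn_conj (last h v)) *: crec n (belast h v) by [].
case: u => [|h u]; first by rewrite /cword [LHS]E.
rewrite /cword rcons_cons [LHS](E (size (rcons u g)).+1 h) last_rcons belast_rcons.
by rewrite (@crec_fuel _ (size (h :: u))) // ltnS size_rcons.
Qed.

Lemma cword_multilinear : multilinear cword.
Proof.
move=> s u a f g; have [n] := ubnP (size (s ++ f :: u)).
elim: n s u => // n IH s u.
have /= m0 v := ctens_multilinear [::] v.
have /= mS h s' v := ctens_multilinear (h :: s') v.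
case: s => [|h s]; case/lastP: u => [|u k] /=.
- by move=> _; exact: m0.
- move=> _; rewrite !cword_rcons m0 cip_linearl.
  by rewrite scalerDr scalerDl scalerA addrACA.
- move=> _; rewrite !cats1 !cword_rcons -!cats1 mS.
  rewrite cplxn_conj_is_conj cipC cip_linearl rmorphD rmorphM /= conjCK -!cipC.
  by rewrite scalerDr scalerDl scalerA addrACA.
rewrite -!rcons_cons -!rcons_cat !cword_rcons !rcons_cat !rcons_cons mS => hn.
rewrite IH; last by move: hn; rewrite ltnS -rcons_cons -rcons_cat size_rcons => /ltnW.
by rewrite !scalerDr !scalerA [cip _ _ * a]mulrC addrACA.
Qed.

Lemma cmap_tens s : cmap (tens s) = cword s.
Proof. exact: (lift_gen (multilinear_respects cword_multilinear)). Qed.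

Lemma cmap_linear : linear cmap.
Proof. exact: (lift_linear (multilinear_respects cword_multilinear)). Qed.

End Fock.

Arguments Flin {R} H.
Arguments Fcyc {R} H.
Arguments vac {R} H.

Section AdjOp.
Context {R : realType} {H : realHilbertType R}.
Local Notation C := R[i].
Local Notation F := (Flin H).

Definition adjpair_ok (p : (F -> F) * (F -> F)) : bool :=
  `[< [/\ linear p.1, linear p.2 &
      forall x y, fock_ip (p.1 x) y = fock_ip x (p.2 y)] >].

(* Linear operators on the algebraic Fock space that have an adjoint there.
   The adjoint is determined by the operator; it is a component of the record
   so that the involution needs no choice. *)
Record adjop : Type := AdjOp {
  adjpair :> (F -> F) * (F -> F) ;
  adjpairP : adjpair_ok adjpair
}.

HB.instance Definition _ := [isSub for adjpair].
HB.instance Definition _ := [Choice of adjop by <:].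

Definition op (a : adjop) : F -> F := a.1.
Definition adj (a : adjop) : F -> F := a.2.

Lemma op_linear a : linear (op a).
Proof. by have /asboolP[h _ _] := adjpairP a; exact: h. Qed.

Lemma adj_linear a : linear (adj a).
Proof. by have /asboolP[_ h _] := adjpairP a; exact: h. Qed.

Lemma adjE a x y : fock_ip (op a x) y = fock_ip x (adj a y).
Proof. by have /asboolP[_ _ h] := adjpairP a; exact: h. Qed.

Lemma adjop_eq a b : op a =1 op b -> adj a =1 adj b -> a = b.
Proof.
case: a b => [[a1 a2] ?] [[b1 b2] ?] /= e1 e2; apply: val_inj => /=.
by congr pair; apply/funext.
Qed.

Lemma mk_subproof (f g : F -> F) : linear f -> linear g ->
  (forall x y, fock_ip (f x) y = fock_ip x (g y)) -> adjpair_ok (f, g).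
Proof. by move=> lf lg fg; apply/asboolP. Qed.

Definition mk_adjop f g lf lg fg : adjop := AdjOp (@mk_subproof f g lf lg fg).

Fact fock_ipDl (x y z : F) : fock_ip (x + y) z = fock_ip x z + fock_ip y z.
Proof. by have := fock_ip_linearl z 1 x y; rewrite scale1r mul1r. Qed.

Fact fock_ipDr (x y z : F) : fock_ip z (x + y) = fock_ip z x + fock_ip z y.
Proof.
by have := fock_ip_linearr z 1 x y; rewrite scale1r rmorph1 mul1r.
Qed.

Fact fock_ipZl a (x z : F) : fock_ip (a *: x) z = a * fock_ip x z.
Proof. by have := fock_ip_linearl z a x 0; rewrite fock_ip0l !addr0. Qed.

Fact fock_ipZr a (x z : F) : fock_ip z (a *: x) = a^* * fock_ip z x.
Proof. by have := fock_ip_linearr z a x 0; rewrite fock_ip0r !addr0. Qed.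

Fact lin0 (f : F -> F) : linear f -> f 0 = 0.
Proof. by move=> lf; have := lf (-1) 0 0; rewrite !scaleN1r oppr0 addr0 addNr. Qed.

Fact linD (f : F -> F) : linear f -> {morph f : x y / x + y}.
Proof. by move=> lf x y; have := lf 1 x y; rewrite !scale1r. Qed.

Fact linZ (f : F -> F) : linear f -> forall a, {morph f : x / a *: x}.
Proof. by move=> lf a x; have := lf a x 0; rewrite (lin0 lf) !addr0. Qed.

Program Definition adjop0 := @mk_adjop (fun=> 0) (fun=> 0) _ _ _.
Next Obligation. by move=> a x y; rewrite scaler0 addr0. Qed.
Next Obligation. by move=> a x y; rewrite scaler0 addr0. Qed.
Next Obligation. by move=> x y; cbv beta; rewrite fock_ip0l fock_ip0r. Qed.

Program Definition adjop_add a b := @mk_adjop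
  (fun x => op a x + op b x) (fun x => adj a x + adj b x) _ _ _.
Next Obligation.
by move=> a b c x y; cbv beta; rewrite !op_linear scalerDr addrACA.
Qed.
Next Obligation.
by move=> a b c x y; cbv beta; rewrite !adj_linear scalerDr addrACA.
Qed.
Next Obligation.
by move=> a b x y; cbv beta; rewrite fock_ipDl fock_ipDr !adjE.
Qed.

Program Definition adjop_scale (c : C) a := @mk_adjop
  (fun x => c *: op a x) (fun x => c^* *: adj a x) _ _ _.
Next Obligation.
by move=> c a d x y; cbv beta; rewrite op_linear scalerDr !scalerA [d * _]mulrC.
Qed.
Next Obligation.
by move=> c a d x y; cbv beta; rewrite adj_linear scalerDr !scalerA [d * _]mulrC.
Qed.
Next Obligation.
by move=> c a x y; cbv beta; rewrite fock_ipZl fock_ipZr conjCK adjE.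
Qed.

Program Definition adjop1 := @mk_adjop id id _ _ _.
Next Obligation. by []. Qed.
Next Obligation. by []. Qed.
Next Obligation. by []. Qed.

Program Definition adjop_mul a b := @mk_adjop
  (fun x => op a (op b x)) (fun x => adj b (adj a x)) _ _ _.
Next Obligation. by move=> a b c x y; cbv beta; rewrite !op_linear. Qed.
Next Obligation. by move=> a b c x y; cbv beta; rewrite !adj_linear. Qed.
Next Obligation. by move=> a b x y; cbv beta; rewrite !adjE. Qed.

Program Definition star a := @mk_adjop (adj a) (op a) _ _ _.
Next Obligation. exact: adj_linear. Qed.
Next Obligation. exact: op_linear. Qed.
Next Obligation. by move=> a x y; rewrite fock_ipC -adjE -fock_ipC. Qed.

Definition adjop_opp a := adjop_scale (-1) a.

Fact adjop_addA : associative adjop_add.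
Proof. by move=> a b c; apply: adjop_eq => x /=; exact: addrA. Qed.

Fact adjop_addC : commutative adjop_add.
Proof. by move=> a b; apply: adjop_eq => x /=; exact: addrC. Qed.

Fact adjop_add0 : left_id adjop0 adjop_add.
Proof. by move=> a; apply: adjop_eq => x /=; exact: add0r. Qed.

Fact adjop_addN : left_inverse adjop0 adjop_opp adjop_add.
Proof.
move=> a; apply: adjop_eq => x.
  by rewrite -[LHS]/(-1 *: op a x + op a x) scaleN1r addNr.
by rewrite -[LHS]/((-1)^* *: adj a x + adj a x) rmorphN1 scaleN1r addNr.
Qed.

HB.instance Definition _ := GRing.isZmodule.Build adjop
  adjop_addA adjop_addC adjop_add0 adjop_addN.

Fact adjop_mulA : associative adjop_mul.
Proof. by move=> a b c; apply: adjop_eq. Qed.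

Fact adjop_mul1 : left_id adjop1 adjop_mul.
Proof. by move=> a; apply: adjop_eq. Qed.

Fact adjop_mulr1 : right_id adjop1 adjop_mul.
Proof. by move=> a; apply: adjop_eq. Qed.

Fact adjop_mulDl : left_distributive adjop_mul +%R.
Proof.
by move=> a b c; apply: adjop_eq => x //=; exact: (linD (adj_linear c)).
Qed.

Fact adjop_mulDr : right_distributive adjop_mul +%R.
Proof.
by move=> a b c; apply: adjop_eq => x //=; exact: (linD (op_linear a)).
Qed.

Fact adjop_nonzero : adjop1 != 0.
Proof.
apply/eqP => e; have : fock_ip (op adjop1 (vac H)) (vac H) = 1.
  by rewrite fock_ip_tens.
by rewrite e fock_ip0l => /esym/eqP; rewrite oner_eq0.
Qed.

HB.instance Definition _ := GRing.Zmodule_isNzRing.Build adjop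
  adjop_mulA adjop_mul1 adjop_mulr1 adjop_mulDl adjop_mulDr adjop_nonzero.

Fact adjop_scaleA c d a :
  adjop_scale c (adjop_scale d a) = adjop_scale (c * d) a.
Proof.
apply: adjop_eq => x; first exact: scalerA.
rewrite -[LHS]/(c^* *: (d^* *: adj a x)) -[RHS]/((c * d)^* *: adj a x).
by rewrite scalerA rmorphM.
Qed.

Fact adjop_scale1 : left_id 1 adjop_scale.
Proof.
move=> a; apply: adjop_eq => x; first exact: scale1r.
by rewrite -[LHS]/(1^* *: adj a x) rmorph1 scale1r.
Qed.

Fact adjop_scaleDr : right_distributive adjop_scale +%R.
Proof. by move=> c a b; apply: adjop_eq => x; exact: scalerDr. Qed.

Fact adjop_scaleDl a : {morph adjop_scale^~ a : c d / c + d}.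
Proof.
move=> c d; apply: adjop_eq => x; first exact: scalerDl.
by rewrite -[LHS]/((c + d)^* *: adj a x) rmorphD scalerDl.
Qed.

HB.instance Definition _ := GRing.Zmodule_isLmodule.Build C adjop
  adjop_scaleA adjop_scale1 adjop_scaleDr adjop_scaleDl.

Fact adjop_scaleAl c (a b : adjop) : c *: (a * b) = (c *: a) * b.
Proof.
apply: adjop_eq => x; first by [].
exact: esym (linZ (adj_linear b) _ _).
Qed.

HB.instance Definition _ := GRing.Lmodule_isLalgebra.Build C adjop
  adjop_scaleAl.

Fact adjop_scaleAr c (a b : adjop) : c *: (a * b) = a * (c *: b).
Proof.
apply: adjop_eq => x; last by [].
exact: esym (linZ (op_linear a) _ _).
Qed.

HB.instance Definition _ := GRing.Lalgebra_isAlgebra.Build C adjop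
  adjop_scaleAr.

Lemma op0 x : op 0 x = 0. Proof. by []. Qed.
Lemma op1 x : op 1 x = x. Proof. by []. Qed.
Lemma opD a b x : op (a + b) x = op a x + op b x. Proof. by []. Qed.
Lemma opZ c a x : op (c *: a) x = c *: op a x. Proof. by []. Qed.
Lemma opM a b x : op (a * b) x = op a (op b x). Proof. by []. Qed.
Lemma op_star a x : op (star a) x = adj a x. Proof. by []. Qed.

Lemma starK : involutive star.
Proof. by move=> a; apply: adjop_eq. Qed.

Lemma starM a b : star (a * b) = star b * star a.
Proof. by apply: adjop_eq. Qed.

Definition omega_op (f : H) : adjop :=
  mk_adjop (omega0_linear f) (omega0_linear f) (omega0_adj f).

Lemma star_omega f : star (omega_op f) = omega_op f.
Proof. by apply: adjop_eq. Qed.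

End AdjOp.
Arguments adjop {R} H.

Section OmegaAlgebra.
Context {R : realType} {H : realHilbertType R}.
Local Notation C := R[i].

Definition star_closed (B : {pred adjop H}) :=
  {in B, forall a, star a \in B}.

Definition in_omega_alg : {pred adjop H} := [pred a |
  `[< forall B : {pred adjop H}, subalg_closed B -> star_closed B ->
      (forall f, omega_op f \in B) -> a \in B >]].

Lemma omega_alg_subalg_closed : subalg_closed in_omega_alg.
Proof.
split=> [|c a b /asboolP ha /asboolP hb|a b /asboolP ha /asboolP hb];
  apply/asboolP => B Bc Bs Bo; case: (Bc) => B1 Bl Bm //.
- by apply: Bl; [exact: ha|exact: hb].
- by apply: Bm; [exact: ha|exact: hb].
Qed.

HB.instance Definition _ :=
  GRing.isSubalgClosed.Build C (adjop H) in_omega_alg omega_alg_subalg_closed.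

Record omega_alg : Type := OmegaAlg {
  omega_val :> adjop H ;
  omega_valP : omega_val \in in_omega_alg
}.

HB.instance Definition _ := [isSub for omega_val].
HB.instance Definition _ := [Choice of omega_alg by <:].
HB.instance Definition _ :=
  GRing.SubChoice_isSubAlgebra.Build C (adjop H) in_omega_alg omega_alg
    omega_alg_subalg_closed.

Lemma star_in_omega_alg a : a \in in_omega_alg -> star a \in in_omega_alg.
Proof.
move=> /asboolP ha; apply/asboolP => B Bc Bs Bo; apply/Bs; exact: ha.
Qed.

Lemma omega_in_omega_alg f : omega_op f \in in_omega_alg.
Proof. by apply/asboolP => B _ _; apply. Qed.

Definition omega (f : H) : omega_alg := OmegaAlg (omega_in_omega_alg f).

Definition omega_star (a : omega_alg) : omega_alg :=
  OmegaAlg (star_in_omega_alg (omega_valP a)).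

Definition phi (a : omega_alg) : C := fock_ip (op a (vac H)) (vac H).

Definition rho (a b : omega_alg) : C :=
  cyc_ip (cmap (op a (vac H))) (cmap (op (omega_star b) (vac H))).

End OmegaAlgebra.
Arguments omega_alg {R} H.

Section Probability.
Context {R : realType} {d : measure_display} {T : measurableType d}.
Variable P : probability T R.
Local Notation C := R[i].

Definition cexpect (Z : T -> C) : C :=
  ((fine 'E_P[fun w => complex.Re (Z w)]) +i*
   (fine 'E_P[fun w => complex.Im (Z w)]))%C.

Definition cintegrable (Z : T -> C) : Prop :=
  P.-integrable [set: T] (fun w => (complex.Re (Z w))%:E) /\
  P.-integrable [set: T] (fun w => (complex.Im (Z w))%:E).

(* k_r(Y_1, ..., Y_r): Moebius inversion of the moment-cumulant formula over
   the set partitions of {1, ..., r}. *)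
Definition cumulant (r : nat) (Y : 'I_r -> T -> C) : C :=
  \sum_(p : {set {set 'I_r}} | finset.partition p (finset.setT))
    (-1) ^+ #|p|.-1 * (#|p|.-1)`!%:R *
    \prod_(B in p) cexpect (fun w => \prod_(i in B) Y i w).

(* normal_prob 0 0 is not the degenerate law, hence the case distinction. *)
Definition centered_normal (sigma : R) (A : set R) : \bar R :=
  if sigma == 0 then \d_(0 : R) A else normal_prob 0 sigma A.

Definition gaussian_family (J : Type) (Y : J -> T -> R) : Prop :=
  (forall j, measurable_fun [set: T] (Y j)) /\
  forall (n : nat) (c : 'I_n -> R) (j : 'I_n -> J),
    exists sigma : R, forall A : set R, measurable A ->
      P ((fun w => \sum_(k < n) c k * Y (j k) w) @^-1` A)
        = centered_normal sigma A.

Definition cgaussian_family (J : Type) (Z : J -> T -> C) : Prop :=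
  gaussian_family (fun (jb : J * bool) w =>
    if jb.2 then complex.Re (Z jb.1 w) else complex.Im (Z jb.1 w)).

Record hermitian_gaussian (H : realHilbertType R) (n : nat)
    (X : H -> T -> 'M[C]_n) : Prop := HermitianGaussian {
  hg_hermitian : forall f w i j, X f w i j = (X f w j i)^* ;
  hg_gaussian : cgaussian_family
    (fun (u : H * ('I_n * 'I_n)) w => X u.1 w u.2.1 u.2.2) ;
  hg_cov0 : forall f g (i j k l : 'I_n), (i < j)%N -> (k < l)%N ->
    cexpect (fun w => X f w i j * X g w k l) = 0 ;
  hg_cov : forall f g (i j k l : 'I_n), (i <= j)%N -> (k <= l)%N ->
    cexpect (fun w => X f w i j * (X g w k l)^*)
      = (i == k)%:R * (j == l)%:R * (n%:R^-1 * (ip f g)%:C%C)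
}.

End Probability.

Section SecondOrder.
Context {R : realType}.
Local Notation C := R[i].

(* Polynomials in the non-commuting indeterminates x_i, i in I. *)
Definition ncpoly (I : choiceType) : Type := malg (fmonom I) C.

Definition nceval (I : choiceType) (A : lalgType C) (x : I -> A)
    (p : ncpoly I) : A :=
  mmap (@GRing.in_alg C A) (fun m : fmonom I => \prod_(i <- (m : seq I)) x i) p.

Record second_order_space (A : algType C) (ph : A -> C) (rh : A -> A -> C) :
    Prop := SecondOrderSpace {
  so_phi_linear : scalar ph ;
  so_phi1 : ph 1 = 1 ;
  so_phi_trace : forall a b, ph (a * b) = ph (b * a) ;
  so_rho_linearl : forall b, scalar (rh^~ b) ;
  so_rho_linearr : forall a, scalar (rh a) ;
  so_rho_tracel : forall a b c, rh (a * b) c = rh (b * a) c ;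
  so_rho_tracer : forall a b c, rh a (b * c) = rh a (c * b) ;
  so_rho1l : forall b, rh 1 b = 0 ;
  so_rho1r : forall a, rh a 1 = 0
}.

Definition unital_alg_gen (A : algType C) (G : set A) : {pred A} := [pred a |
  `[< forall B : {pred A}, subalg_closed B -> (forall x, G x -> x \in B) ->
      a \in B >]].

Section Freeness.
Context (A : algType C) (ph : A -> C) (rh : A -> A -> C).
Context (r : nat) (S : 'I_r -> {pred A}).

Definition centered (s : seq A) : Prop := forall k, (k < size s)%N -> ph s`_k = 0.

Definition alternating (s : seq A) : Prop := exists i : nat -> 'I_r,
  (forall k, (k < size s)%N -> s`_k \in S (i k)) /\
  (forall k, (k.+1 < size s)%N -> i k != i k.+1).

Definition cyclically_alternating (s : seq A) : Prop :=
  exists i : nat -> 'I_r,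
  (forall k, (k < size s)%N -> s`_k \in S (i k)) /\
  ((2 <= size s)%N ->
    forall k, (k < size s)%N -> i k != i (k.+1 %% size s)%N).

Definition free_first_order : Prop := forall s : seq A, (0 < size s)%N ->
  alternating s -> centered s -> ph (\prod_(a <- s) a) = 0.

(* The entries of s and t are numbered from 0, so that b_{(n - i) + k} in the
   product over 0 <= i < n is the entry of index (n - i.+1 + k) mod n. *)
Record free_second_order : Prop := FreeSecondOrder {
  fso_first : free_first_order ;
  fso_size : forall s t : seq A, (0 < size s)%N -> (0 < size t)%N ->
    cyclically_alternating s -> centered s ->
    cyclically_alternating t -> centered t -> size s != size t ->
    rh (\prod_(a <- s) a) (\prod_(b <- t) b) = 0 ;
  fso_one : forall i j a b, i != j -> a \in S i -> b \in S j -> rh a b = 0 ;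
  fso_cyc : forall s t : seq A, (2 <= size s)%N -> size t = size s ->
    cyclically_alternating s -> centered s ->
    cyclically_alternating t -> centered t ->
    rh (\prod_(a <- s) a) (\prod_(b <- t) b)
      = \sum_(k < size s) \prod_(i < size s)
          ph (s`_i * t`_((size s - i.+1 + k) %% size s))
}.

End Freeness.

Section Limit.
Context {d : nat -> measure_display} {T : forall N, measurableType (d N)}.
Variable P : forall N, probability (T N) R.

(* The N-th family consists of matrices of size N + 1. *)
Definition rmfamily (I : Type) : Type :=
  forall N : nat, I -> T N -> 'M[C]_N.+1.

Definition trp (I : choiceType) (X : rmfamily I) (N : nat) (p : ncpoly I)
    (w : T N) : C :=
  \tr (nceval (A := 'M[C]_N.+1) (fun i => X N i w) p).

Record second_order_limit (I : choiceType) (X : rmfamily I)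
    (A : algType C) (ph : A -> C) (rh : A -> A -> C) (a : I -> A) : Prop :=
  SecondOrderLimit {
  sol_space : second_order_space ph rh ;
  sol_moments : forall N (s : seq (ncpoly I)),
    cintegrable (P N) (fun w => \prod_(p <- s) trp X p w) ;
  sol_one : forall p : ncpoly I,
    (fun N => cumulant (P N) (fun _ : 'I_1 => fun w => N.+1%:R^-1 * trp X p w)
       : C^o) @ \oo --> (ph (nceval a p) : C^o) ;
  sol_two : forall p q : ncpoly I,
    (fun N => cumulant (P N) (fun j : 'I_2 => trp X (if j == 0 then p else q))
       : C^o) @ \oo --> (rh (nceval a p) (nceval a q) : C^o) ;
  sol_many : forall (r : nat) (p : 'I_r -> ncpoly I), (3 <= r)%N ->
    (fun N => cumulant (P N) (fun j => trp X (p j)) : C^o) @ \oo --> (0 : C^o)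
}.

(* The union of the families is indexed by the disjoint union. *)
Definition asymptotically_free_second_order (r : nat) (I : 'I_r -> choiceType)
    (X : forall k, rmfamily (I k)) : Prop :=
  exists (A : algType C) (ph : A -> C) (rh : A -> A -> C)
         (a : forall k, I k -> A),
    second_order_limit
      (fun N (u : {k : 'I_r & I k}) w => X (tag u) N (tagged u) w)
      ph rh (fun u => a (tag u) (tagged u)) /\
    free_second_order ph rh (fun k => unital_alg_gen (range (a k))).

End Limit.
End SecondOrder.

Arguments ncpoly R I : clear implicits.

(* Main.v *)
Require Import Defs.
From mathcomp Require Import all_boot all_order all_algebra.
From mathcomp Require Import all_classical all_reals all_analysis.
From mathcomp Require Import measurable_realfun.
From mathcomp Require Import complex ring lra zify.

Set Implicit Arguments.
Unset Strict Implicit.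
Unset Printing Implicit Defensive.

Import Order.TTheory GRing.Theory Num.Theory.

Local Open Scope classical_set_scope.
Local Open Scope ring_scope.

(** The joint moments of the traces of words in the matrices satisfy loop equations
    ([trmoment_loop]): integration by parts with respect to the entries of the first
    letter of a word ([wick_complex]) pairs this letter with each of the other letters.
    A letter of the same word cuts the trace in two, and a letter of another word
    merges two traces into one. Cumulants are the logarithmic derivatives of moments,
    for the convolution of functions of lists ([lcum]; the sum over set partitions is
    of this form by [cumulant_lcum]), and so the loop equations become a recursion for
    cumulants ([lcum_loop]), in which a cut trace gives one cumulant with one more
    argument and a convolution of two cumulants. By this recursion the cumulants of [r]
    traces are of the order of the power [2 - r] of the size ([scum_bdd]). So the
    cumulant with one more argument disappears in the limit, cumulants of three or more
    traces tend to zero ([cum_tendsto0]), and the limits for one and for two traces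
    satisfy the recursions without this term ([scum_phi], [scum_rho]).

    The functionals [phi] and [rho] on words satisfy the same two recursions
    ([phiw_cons], [rhow_cons]). There, a linear functional of the vector [omega(w) Omega]
    is computed letter by letter from its values on tensors ([ev]); the sum over the
    cuts of [w] is turned into a sum over the cuts of tensors by the free difference
    quotient ([ev_difference_quotient]), and the pairing with [c] of the vector of a word
    is a cyclic derivative ([cyc_ip_cword]). Since words span the algebra and
    cumulants are linear in each argument, the limits hold for all polynomials
    ([second_order_limit_gaussian]). The traciality of [rho] is inherited from the trace
    of matrices.

    For freeness, a centered element of the algebra of [K i] maps the vacuum to a
    combination of nonempty tensors with vectors in [K i], called a block. A product of
    elements from alternating algebras gives the tensor product of their blocks
    ([LS_prod]). If the product is cyclically alternating, the first and the last
    vectors are orthogonal, and [c] maps each tensor to its circular tensor ([supp_cword]).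
    The inner product of two circular tensors is a sum over rotations. A rotation that
    starts inside a block puts two blocks of the same color at the two ends and
    contributes zero ([pip_interior]); the others are the rotations by whole blocks, and
    each gives a product of inner products of blocks ([LS_rot]), that is, of values of
    [phi] ([bil_phi]). *)

(** * Cuts of a word *)

(** The sum of [B u g v] over the factorizations [w = u ++ g :: v]. *)
Fixpoint cutsum (A : Type) (W : nmodType) (B : seq A -> A -> seq A -> W)
    (w : seq A) : W :=
  if w is g :: w' then B [::] g w' + cutsum (fun u => B (g :: u)) w' else 0.

Section Cutsum.
Variables (A : Type).

Lemma eq_cutsum (W : nmodType) (B B' : seq A -> A -> seq A -> W) w :
  (forall u g v, w = u ++ g :: v -> B u g v = B' u g v) ->
  cutsum B w = cutsum B' w.
Proof.
elim: w B B' => //= g w IH B B' e; rewrite (e [::])//; congr (_ + _).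
by apply: IH => u h v wE; apply: e; rewrite wE.
Qed.

Lemma cutsumD (W : nmodType) (B B' : seq A -> A -> seq A -> W) w :
  cutsum (fun u g v => B u g v + B' u g v) w = cutsum B w + cutsum B' w.
Proof.
by elim: w B B' => [|g w IH] B B' /=; rewrite ?addr0// IH addrACA.
Qed.

Lemma cutsum_morph (W W' : nmodType) (f : W -> W') B (w : seq A) :
  f 0 = 0 -> {morph f : x y / x + y} ->
  f (cutsum B w) = cutsum (fun u g v => f (B u g v)) w.
Proof. by move=> f0 fD; elim: w B => //= g w IH B; rewrite fD IH. Qed.

Lemma cutsum_cat (W : nmodType) (B : seq A -> A -> seq A -> W) s t :
  cutsum B (s ++ t) =
  cutsum (fun u g v => B u g (v ++ t)) s + cutsum (fun u => B (s ++ u)) t.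
Proof. by elim: s B => [|g s IH] B /=; rewrite ?add0r// IH addrA. Qed.

Lemma cutsum0 (W : nmodType) (B : seq A -> A -> seq A -> W) w :
  (forall u g v, B u g v = 0) -> cutsum B w = 0.
Proof. by move=> B0; elim: w B B0 => //= g w IH B B0; rewrite B0 IH ?addr0. Qed.

End Cutsum.

(** * Convolution of functions of lists, and cumulants *)

Section Conv.
Variables (C : comNzRingType) (V : eqType).
Implicit Types (F G E : seq V -> C) (s a b : seq V).

(** The sum of [F a * G b] over the ways of distributing the entries of [s] over
    two sublists [a] and [b]. For this product, [F |-> F \o cons x] is a
    derivation for every [x], which is its definition. *)
Fixpoint conv F G s : C :=
  if s is x :: s' then
    conv (fun a => F (x :: a)) G s' + conv F (fun b => G (x :: b)) s'
  else F [::] * G [::].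

Definition one s : C := (nilp s)%:R.

Lemma eq_conv F F' G G' s :
  (forall a b, perm_eq (a ++ b) s -> F a * G b = F' a * G' b) ->
  conv F G s = conv F' G' s.
Proof.
elim: s F F' G G' => [|x s IH] F F' G G' e /=; first exact: e.
congr (_ + _); apply: IH => a b ab; apply: e; first by rewrite /= perm_cons.
by rewrite perm_catC /= perm_cons perm_catC.
Qed.

Lemma convC F G : conv F G = conv G F.
Proof.
apply/funext => s; elim: s F G => [|x s IH] F G /=; first exact: mulrC.
by rewrite addrC; congr (_ + _).
Qed.

Lemma convDl F F' G s :
  conv (fun a => F a + F' a) G s = conv F G s + conv F' G s.
Proof.
elim: s F F' G => [|x s IH] F F' G /=; first exact: mulrDl.
by rewrite !IH addrACA.
Qed.

Lemma convZl c F G s : conv (fun a => c * F a) G s = c * conv F G s.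
Proof.
by elim: s F G => [|x s IH] F G /=; rewrite ?mulrA// !IH mulrDr.
Qed.

Lemma conv0l G s : conv (fun=> 0) G s = 0.
Proof. by elim: s G => [|x s IH] G /=; rewrite ?mul0r// !IH addr0. Qed.

Lemma convDr F G G' s :
  conv F (fun a => G a + G' a) s = conv F G s + conv F G' s.
Proof. by rewrite convC convDl ![conv _ F]convC. Qed.

Lemma convNr F G s : conv F (fun a => - G a) s = - conv F G s.
Proof.
by elim: s F G => [|x s IH] F G /=; rewrite ?mulrN// !IH opprD.
Qed.

Lemma convA F G E : conv F (conv G E) = conv (conv F G) E.
Proof.
apply/funext => s; elim: s F G E => [|x s IH] F G E /=; first exact: mulrA.
rewrite convDr convDl -!IH.
by rewrite -!addrA.
Qed.

Lemma conv1r F : conv F one = F.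
Proof.
apply/funext => s; elim: s F => [|x s IH] F /=; first by rewrite mulr1.
by rewrite IH convC conv0l addr0.
Qed.

Lemma conv_scale q F G s :
  conv (fun a => q ^+ size a * F a) (fun b => q ^+ size b * G b) s =
  q ^+ size s * conv F G s.
Proof.
have -> : q ^+ size s * conv F G s = conv (fun a => q ^+ size s * F a) G s.
  by rewrite convZl.
apply: eq_conv => a b /perm_size; rewrite size_cat => <-.
by rewrite exprD; ring.
Qed.

Lemma conv_cutsum A (B : seq A -> A -> seq A -> seq V -> C) w G s :
  conv (fun a => cutsum (fun u g v => B u g v a) w) G s =
  cutsum (fun u g v => conv (B u g v) G s) w.
Proof.
elim: w B => [|g w IH] B /=; first exact: conv0l.
by rewrite convDl IH.
Qed.

Definition delsum (D : V -> seq V -> C) : seq V -> C :=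
  cutsum (fun a x b => D x (a ++ b)).

(** Removing an entry of the list commutes with the convolution by a fixed
    function. *)
Lemma conv_delsum (D : V -> seq V -> C) G :
  conv (delsum D) G = delsum (fun x => conv (D x) G).
Proof.
apply/funext => s; elim: s D G => [|x s IH] D G /=; first by rewrite mul0r.
have -> : (fun a => delsum D (x :: a)) =
          (fun a => D x a + delsum (fun y b => D y (x :: b)) a) by [].
by rewrite convDl !IH -addrA /delsum /= -cutsumD.
Qed.

Section Inverse.
Variable M : seq V -> C.
Hypothesis M1 : M [::] = 1.

Let P s := M s - one s.

Fixpoint inv_iter n s : C :=
  if n is n'.+1 then one s - conv (inv_iter n') P s else one s.

Let inv_stable n m s : (size s <= n)%N -> (size s <= m)%N ->
  inv_iter n s = inv_iter m s.
Proof.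
have P0 : P [::] = 0 by rewrite /P M1 subrr.
have inv0 k : inv_iter k [::] = 1 by case: k => //= k; rewrite P0 mulr0 subr0.
elim: n m s => [|n IH] [|m] s; rewrite ?leqn0.
- by [].
- by move=> /nilP-> _; rewrite !inv0.
- by move=> _ /nilP->; rewrite !inv0.
move=> sn sm /=; congr (_ - _); apply: eq_conv => a [|x b] /perm_size.
  by rewrite P0 !mulr0.
rewrite size_cat /= => e; rewrite (IH m)//.
  by rewrite -ltnS (leq_trans _ sn)// -e addnS ltnS leq_addr.
by rewrite -ltnS (leq_trans _ sm)// -e addnS ltnS leq_addr.
Qed.

(** The geometric series for the inverse of [M] stops at the length of the list,
    since [P] vanishes on the empty list. *)
Definition cinv s : C := inv_iter (size s) s.

Lemma cinvl : conv cinv M = one.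
Proof.
have e s : cinv s = one s - conv cinv P s.
  rewrite [LHS](@inv_stable _ (size s).+1)//=; congr (_ - _).
  apply: eq_conv => a b /perm_size; rewrite size_cat => sab.
  by rewrite /cinv (@inv_stable (size s) (size a))// -sab leq_addr.
apply/funext => s; have -> : M = (fun b => P b + one b).
  by apply/funext => b; rewrite /P subrK.
by rewrite convDr conv1r e addrC subrK.
Qed.

Lemma cinvr : conv M cinv = one. Proof. by rewrite convC cinvl. Qed.

(** The joint cumulant of [z] and of the entries of [s], [M] being the joint
    moments: the derivative of the logarithm of [M] in the direction [z]. *)
Definition lcum z s : C := conv (fun a => M (z :: a)) cinv s.

Lemma lcumM z : conv (lcum z) M = (fun s => M (z :: s)).
Proof. by rewrite /lcum -convA cinvl conv1r. Qed.

(** The derivation in the direction [y], applied to [cinvl]. *)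
Lemma cinv_cons y : (fun a => cinv (y :: a)) = (fun a => - conv (lcum y) cinv a).
Proof.
have e : conv (fun a => cinv (y :: a)) M = (fun a => - lcum y a).
  apply/funext => s; have := congr1 (fun F => F (y :: s)) cinvl.
  move=> /= /eqP; rewrite /one /= addr_eq0 => /eqP ->.
  by rewrite /lcum convC.
by rewrite -[LHS]conv1r -cinvr convA e; apply/funext => s; rewrite convC convNr convC.
Qed.

(** The formula of Leonov and Shiryaev for one product of two factors: the left side
    is the second derivative of [M] divided by [M], and the first derivatives are
    logarithmic derivatives times [M]. *)
Lemma lcum_mul z y s :
  conv (fun a => M (z :: y :: a)) cinv s =
  lcum z (y :: s) + conv (lcum z) (lcum y) s.
Proof.
rewrite {1}/lcum /= cinv_cons convNr.
suff -> : conv (fun a => M (z :: a)) (conv (lcum y) cinv) = conv (lcum z) (lcum y).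
  by rewrite addrNK.
by rewrite [conv (lcum y) _]convC convA.
Qed.

Lemma lcum_nil z : lcum z [::] = M [:: z].
Proof. by rewrite /lcum /cinv /= mulr1. Qed.

End Inverse.
End Conv.

(** * Loop equations *)

Section Loop.
Variables (C : comNzRingType) (A : eqType) (q n : C) (e : A -> A -> C).
Variable M : seq (seq A) -> C.
Hypothesis M1 : M [::] = 1.
Hypothesis M0 : forall S, M ([::] :: S) = n * M S.
Hypothesis Mloop : forall f w S, M ((f :: w) :: S) =
  q * (cutsum (fun u g v => e f g * M (u :: v :: S)) w +
       delsum (fun w' S' => cutsum (fun u g v => e f g * M ((w ++ v ++ u) :: S')) w') S).

Local Notation K := (lcum M).

(** The trace of the empty word is a constant, which has no joint cumulants. *)
Lemma lcum_empty S : K [::] S = n * one C S.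
Proof.
rewrite /lcum -(@cinvr C _ M M1) -convZl.
by congr (conv _ _ _); apply/funext => a; rewrite M0.
Qed.

(** A term of the first sum in the loop equation for moments is the moment of a
    product of two traces; the formula for one product of two factors splits it. *)
Lemma lcum_loop f w S : K (f :: w) S =
  q * (cutsum (fun u g v => e f g * (K u (v :: S) + conv (K u) (K v) S)) w +
       delsum (fun w' S' => cutsum (fun u g v => e f g * K (w ++ v ++ u) S') w') S).
Proof.
rewrite {1}/lcum.
have -> : (fun a => M ((f :: w) :: a)) = (fun a =>
  q * (cutsum (fun u g v => e f g * M (u :: v :: a)) w +
       delsum (fun w' S' => cutsum (fun u g v => e f g * M ((w ++ v ++ u) :: S')) w') a)).
  by apply/funext => a; rewrite Mloop.
rewrite convZl convDl conv_cutsum conv_delsum; congr (_ * (_ + _)).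
  by apply: eq_cutsum => u g v _; rewrite convZl lcum_mul.
congr delsum; apply/funext => w'; apply/funext => S'.
by rewrite conv_cutsum; apply: eq_cutsum => u g v _; rewrite convZl.
Qed.

End Loop.

(** * Moebius inversion over set partitions *)

Section Partitions.
Variables (C : comNzRingType) (I : finType).
Implicit Types (p : {set {set I}}) (A B D : {set I}).
Local Notation part := (@finset.partition I).
Local Notation set0 := (@finset.set0 I).

(** A partition with a marked block is a nonempty block together with a
    partition of its complement. *)
Lemma sum_marked_block (F : {set I} -> {set {set I}} -> C) D :
  \sum_(p | part p D) \sum_(B in p) F B (p :\ B) =
  \sum_(B : {set I} | (B \subset D) && (B != set0))
    \sum_(p | part p (D :\: B)) F B p.
Proof.
rewrite !pair_big_dep /=.
rewrite (reindex_onto (fun x : {set I} * {set {set I}} => (x.1 |: x.2, x.1))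
  (fun y => (y.2, y.1 :\ y.2))) /=; last first.
  by case=> p B /= /andP[_ Bp]; rewrite finset.setD1K.
apply: eq_big => [[B p]|[B p]] /=; last first.
  by case/andP => _ /eqP[->].
rewrite !inE eqxx /= andbT; apply/andP/andP.
  case=> pD /eqP[e]; split.
    rewrite (partitionS pD) ?finset.setU11//.
    by rewrite (partition_neq0 pD) ?finset.setU11.
  by have := partitionD1 pD (finset.setU11 B p); rewrite e.
case=> /andP[BD B0] pD; split.
  have := partitionU1 pD B0.
  have -> : B :|: (D :\: B) = D.
    apply/setP => x; rewrite !inE; have := fintype.subsetP BD x.
    by case: (x \in B) => //= /(_ isT)->.
  apply; rewrite disjoint_sym finset.disjoints_subset; apply/fintype.subsetP => x.
  by rewrite !inE => /andP[].
apply/eqP; congr pair; apply: finset.setU1K; apply/negP => Bp.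
move/negP: B0; apply; rewrite -finset.subset0; apply/fintype.subsetP => x xB.
by have /fintype.subsetP/(_ x xB) := partitionS pD Bp; rewrite !inE xB.
Qed.

Variable m : {set I} -> C.

Definition partsum (g : nat -> C) D : C :=
  \sum_(p | part p D) g #|p| * \prod_(B in p) m B.

(** Only the block of [x] is marked. *)
Lemma partsum_block g D x : x \in D ->
  partsum g D =
  \sum_(B : {set I} | (B \subset D) && (x \in B))
     m B * partsum (fun k => g k.+1) (D :\: B).
Proof.
move=> xD.
pose F B p := (x \in B)%:R * (g #|p|.+1 * (m B * \prod_(A in p) m A)).
have eL : partsum g D = \sum_(p | part p D) \sum_(B in p) F B (p :\ B).
  apply: eq_bigr => p pD.
  have xc : x \in finset.cover p by rewrite (cover_partition pD).
  rewrite [RHS](bigD1 (finset.pblock p x)) ?finset.pblock_mem//= [X in _ = _ + X]big1 ?addr0; last first.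
    move=> B /andP[Bp nB]; rewrite /F; case xB: (x \in B); last by rewrite mul0r.
    by rewrite (finset.def_pblock (partition_trivIset pD) Bp xB) eqxx in nB.
  rewrite /F finset.mem_pblock xc mul1r [#|p|](cardsD1 (finset.pblock p x)) finset.pblock_mem//.
  by rewrite (bigD1 (finset.pblock p x)) ?finset.pblock_mem//=; congr (_ * (_ * _));
    apply: eq_bigl => A; rewrite !inE andbC.
rewrite eL sum_marked_block [RHS](_ : _ = \sum_(B : {set I} | (B \subset D)
   && (B != set0)) (x \in B)%:R * (m B * partsum (fun k => g k.+1) (D :\: B))).
  apply: eq_bigr => B _; rewrite /partsum !mulr_sumr; apply: eq_bigr => p _.
  by rewrite /F; ring.
rewrite [RHS](bigID (fun B : {set I} => x \in B)) /= [X in _ + X]big1; last first.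
  by move=> B /andP[_ /negbTE ->]; rewrite mul0r.
rewrite addr0; apply: eq_big => [B|B /andP[_ ->]]; last by rewrite mul1r.
case xB: (x \in B); last by rewrite !andbF.
rewrite !andbT; have -> : B != set0; last by rewrite andbT.
by apply/finset.set0Pn; exists x.
Qed.

Definition altfact k : C := (-1) ^+ k * k`!%:R.

Lemma altfactS k : altfact k.+1 = - (k.+1%:R * altfact k).
Proof. by rewrite /altfact factS natrM exprS; ring. Qed.

Hypothesis m0 : m set0 = 1.

Lemma partsum0 g : partsum g set0 = g 0%N.
Proof.
rewrite /partsum (big_pred1 finset.set0); last first.
  by move=> p /=; rewrite partition_set0.
by rewrite finset.cards0 big1 ?mulr1// => B; rewrite inE.
Qed.

(** Marking a block of a partition with [k] blocks gives the factor [k] that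
    relates two consecutive values of [altfact]. *)
Lemma partsum_inv D :
  \sum_(A : {set I} | A \subset D) partsum altfact A * m (D :\: A)
    = (D == set0)%:R.
Proof.
have [->|D0] := eqVneq D set0.
  rewrite (big_pred1 set0) ; last by move=> A /=; rewrite finset.subset0.
  by rewrite partsum0 finset.setD0 m0 /altfact expr0 fact0 !mulr1.
rewrite (bigD1 D) //= finset.setDv m0 mulr1.
rewrite (reindex_onto (fun B => D :\: B) (fun A => D :\: A)) /=; last first.
  by move=> A /andP[AD _]; rewrite finset.setDDr finset.setDv finset.set0U; apply/finset.setIidPr.
rewrite (eq_big (fun B : {set I} => (B \subset D) && (B != set0))
  (fun B => \sum_(p | part p (D :\: B)) altfact #|p| * (m B * \prod_(A in p) m A)));
  first last.
- move=> B /andP[_ /eqP e]; rewrite e /partsum mulr_suml.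
  by apply: eq_bigr => p _; ring.
- move=> B; rewrite finset.subsetDl /=; apply/andP/andP => -[].
    move=> nD /eqP e; split; first by rewrite -e finset.subsetDl.
    by apply: contra nD => /eqP ->; rewrite finset.setD0.
  move=> BD B0; have e : D :\: (D :\: B) = B.
    by rewrite finset.setDDr finset.setDv finset.set0U; apply/finset.setIidPr.
  by split; [apply: contra B0 => /eqP DB; rewrite -e DB finset.setDv|rewrite e].
rewrite -(sum_marked_block (fun B p => altfact #|p| * (m B * \prod_(A in p) m A))).
rewrite /partsum -big_split big1//= => p pD.
have cp : #|p| != 0%N.
  apply: contra D0; rewrite cards_eq0 => /eqP p0.
  by rewrite -(cover_partition pD) p0 /finset.cover big_set0.
rewrite [X in _ + X](_ : _ = #|p|%:R * altfact #|p|.-1 * \prod_(A in p) m A).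
  by case: #|p| cp => // k _; rewrite altfactS /=; ring.
rewrite -mulrA mulr_natl -sumr_const.
apply: eq_bigr => B Bp.
rewrite [in RHS](bigD1 B)//= [in RHS](cardsD1 B p) Bp /=.
by congr (_ * (_ * _)); apply: eq_bigl => A; rewrite !inE andbC.
Qed.

End Partitions.

Section PartitionCumulant.
Variables (C : comNzRingType) (V : eqType).

Lemma sum_subsetU1 (I : finType) (E : {set I} -> C) x (D : {set I}) :
  x \notin D ->
  \sum_(A : {set I} | A \subset x |: D) E A =
  \sum_(A : {set I} | A \subset D) E (x |: A) + \sum_(A : {set I} | A \subset D) E A.
Proof.
move=> xD; rewrite (bigID (fun A : {set I} => x \in A)) /=; congr (_ + _).
  rewrite (reindex_onto (fun A => x |: A) (fun A => A :\ x)) /=; last first.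
    by move=> A /andP[_ xA]; rewrite finset.setD1K.
  apply: eq_bigl => A; rewrite finset.setU11 andbT; apply/andP/idP.
    move=> [AD /eqP <-]; apply/fintype.subsetP => y; rewrite !inE => /andP[yx].
    by rewrite (negbTE yx) => yA; have /fintype.subsetP/(_ y) := AD;
      rewrite !inE (negbTE yx) yA; apply.
  move=> AD; rewrite finset.setUS// setU1K//.
  by apply: contra xD; apply: (fintype.subsetP AD).
apply: eq_bigl => A; apply/andP/idP.
  move=> [AD xA]; apply/fintype.subsetP => y yA.
  have := fintype.subsetP AD y yA; rewrite !inE => /predU1P[yx|//].
  by rewrite -yx yA in xA.
move=> AD; split; first exact: fintype.subset_trans AD (finset.subsetU1 _ _).
by apply: contra xD; apply: (fintype.subsetP AD).
Qed.

(** The sublists of a list without repetitions are given by the subsets of its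
    entries. *)
Lemma conv_map (I : finType) (v : I -> V) (F G : seq V -> C) (t : seq I) :
  uniq t ->
  conv F G (map v t) =
  \sum_(A : {set I} | A \subset [set:: t])
     F [seq v i | i <- t & i \in A] * G [seq v i | i <- t & i \notin A].
Proof.
elim: t F G => [|x t IH] F G.
  move=> _; rewrite (big_pred1 finset.set0)//= => A.
  by rewrite finset.set_nil finset.subset0.
case/andP=> xt ut; rewrite finset.set_cons sum_subsetU1 ?inE//=.
rewrite !IH//; congr (_ + _); apply: eq_bigr => A AD; rewrite ?finset.setU11 /=.
  congr (F (_ :: map v _) * G (map v _)); apply: eq_in_filter => i it.
    by rewrite !inE; case: eqP it => // ->; rewrite (negbTE xt).
  by rewrite !inE; case: eqP it => // ->; rewrite (negbTE xt).
have -> : (x \in A) = false.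
  by apply/negP => /(fintype.subsetP AD); rewrite inE (negbTE xt).
by [].
Qed.

Lemma filter_enum (I : finType) (A D : {set I}) : A \subset D ->
  [seq i <- enum D | i \in A] = enum A.
Proof.
move=> AD; rewrite /enum_mem -filter_predI; apply: eq_filter => i /=.
by case iA: (i \in A) => //=; rewrite (fintype.subsetP AD).
Qed.

Section Sublists.
Variables (I : finType) (v : I -> V).
Local Notation l A := [seq v i | i <- enum (A : {set I})].

Lemma conv_enum (F G : seq V -> C) (D : {set I}) :
  conv F G (l D) = \sum_(A : {set I} | A \subset D) F (l A) * G (l (D :\: A)).
Proof.
rewrite conv_map ?enum_uniq// (_ : [set:: enum D] = D); last first.
  by apply/setP => i; rewrite inE mem_enum.
apply: eq_bigr => A AD; rewrite filter_enum//; congr (_ * G (map v _)).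
rewrite -[RHS](filter_enum (finset.subsetDl D A)); apply: eq_in_filter => i.
by rewrite mem_enum inE => ->; rewrite andbT.
Qed.

Variable M : seq V -> C.
Hypothesis M1 : M [::] = 1.

(** Both sides are inverse to [M] for the convolution. *)
Lemma partsum_cinv (D : {set I}) :
  partsum (fun B => M (l B)) (altfact C) D = cinv M (l D).
Proof.
have [n] := ubnP #|D|; elim: n D => // n IH D; rewrite ltnS => Dn.
have m0 : M (l (finset.set0 : {set I})) = 1 by rewrite enum_set0.
have := congr1 (fun F => F (l D)) (cinvl M1).
rewrite conv_enum (bigD1 D)//= finset.setDv m0 mulr1.
have := partsum_inv (m := fun B : {set I} => M (l B)) m0 D; rewrite (bigD1 D)//= finset.setDv m0 mulr1.
have -> : one C (l D) = (D == finset.set0)%:R.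
  by rewrite /one /nilp size_map -cardE cards_eq0.
move=> <- /esym; rewrite [X in _ + X = _](eq_bigr (fun A : {set I} =>
  cinv M (l A) * M (l (D :\: A)))); first by move/addIr.
move=> A AD; rewrite IH//; apply: leq_trans Dn; apply: proper_card.
by rewrite finset.properEneq andbC.
Qed.

End Sublists.

(** The block of the first entry gives the factor [M (z :: a)] in [lcum]; the other
    blocks give the inverse of [M], because the coefficient of a partition is
    [altfact] at the number of these blocks. *)
Lemma cumulant_lcum r (v : 'I_r.+1 -> V) (M : seq V -> C) : M [::] = 1 ->
  \sum_(p : {set {set 'I_r.+1}} | finset.partition p (finset.setT))
    (-1) ^+ #|p|.-1 * (#|p|.-1)`!%:R *
    \prod_(B in p) M [seq v i | i <- enum B] =
  lcum M (v ord0) [seq v (lift ord0 i) | i <- enum 'I_r].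
Proof.
move=> M1; pose D : {set 'I_r.+1} := finset.setT :\ ord0.
have eD : enum D = [seq lift ord0 i | i <- enum 'I_r].
  rewrite /enum_mem -(eq_filter (a1 := predC1 ord0)); last by move=> i; rewrite !inE andbT.
  rewrite -enumT enum_ordSl /=; apply/all_filterP/allP => i.
  by by case/mapP => j _ ->.
have /= := @partsum_block C _ (fun B => M [seq v i | i <- enum B])
  (fun k => (-1) ^+ k.-1 * (k.-1)`!%:R) finset.setT ord0 (finset.in_setT _).
rewrite {1}/partsum => ->; rewrite map_comp -eD /lcum conv_enum.
rewrite (reindex_onto (fun B => ord0 |: B) (fun B => B :\ ord0)) /=; last first.
  by move=> B /andP[_ xB]; rewrite finset.setD1K.
apply: eq_big => [B|B].
  rewrite finset.subsetT finset.setU11 /=; apply/eqP/idP => [<-|BD].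
    by rewrite /D finset.setSD// finset.subsetT.
  by rewrite finset.setU1K//; apply/negP => /(fintype.subsetP BD); rewrite !inE eqxx.
rewrite finset.subsetT finset.setU11 /= => /eqP e; have xB : ord0 \notin B.
  by rewrite -e !inE eqxx.
congr (_ * _).
  congr M; rewrite [in LHS]/enum_mem -enumT enum_ordSl /= finset.setU11 /=.
  rewrite [in RHS]/enum_mem -enumT enum_ordSl /= (negbTE xB) /=; congr (_ :: map v _).
  by apply: eq_in_filter => i /mapP[j _ ->]; rewrite !inE eq_sym (negbTE (neq_lift _ _)).
have -> : finset.setT :\: (ord0 |: B) = D :\: B.
  by apply/setP => i; rewrite !inE negb_or !andbT andbC.
exact: partsum_cinv.
Qed.

End PartitionCumulant.

(** * Moments of a centered Gaussian random variable *)

Section Density.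
Context d (T : measurableType d) (R : realType).
Variables (nu : {finite_measure set T -> \bar R})
          (mu : {sigma_finite_measure set T -> \bar R}) (g : T -> R).
Hypothesis g0 : forall x, 0 <= g x.
Hypothesis ig : mu.-integrable [set: T] (EFin \o g).
Hypothesis nuE : forall A, measurable A -> nu A = (\int[mu]_(x in A) (g x)%:E)%E.

(** The density is almost everywhere the Radon-Nikodym derivative. *)
Lemma ge0_integral_density (f : T -> R) :
  measurable_fun [set: T] f -> (forall x, 0 <= f x) ->
  (\int[nu]_x (f x)%:E = \int[mu]_x (f x * g x)%:E)%E.
Proof.
move=> mf f0; have mg : measurable_fun [set: T] g.
  by apply/measurable_EFinP; exact: measurable_int ig.
have numu : nu `<< mu.
  apply/null_content_dominatesP => A mA muA0; rewrite nuE//.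
  apply: null_set_integral => //; exact/measurable_funTS/measurable_EFinP.
rewrite -(Radon_Nikodym_SigmaFinite.change_of_variables numu) //=;
  last exact/measurable_EFinP.
apply: ae_eq_integral => //.
- apply: emeasurable_funM; first exact/measurable_EFinP.
  exact: measurable_int (Radon_Nikodym_SigmaFinite.f_integrable numu).
- by apply/measurable_EFinP; exact: measurable_funM.
have : ae_eq mu [set: T] (Radon_Nikodym_SigmaFinite.f nu mu) (EFin \o g).
  apply: integral_ae_eq => //.
  - exact: Radon_Nikodym_SigmaFinite.f_integrable.
  - exact/measurable_EFinP.
  - by move=> E _ mE; rewrite -Radon_Nikodym_SigmaFinite.f_integral// nuE.
by apply: filterS => x /= e /e ->; rewrite EFinM.
Qed.

Lemma integral_density (f : T -> R) : measurable_fun [set: T] f ->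
  mu.-integrable [set: T] (fun x => (f x * g x)%:E) ->
  nu.-integrable [set: T] (EFin \o f) /\
  (\int[nu]_x (f x)%:E = \int[mu]_x (f x * g x)%:E)%E.
Proof.
move=> mf ifg; split.
  apply/integrableP; split; first exact/measurable_EFinP.
  rewrite [ltLHS](_ : _ = \int[nu]_x (`|f x|)%:E)%E; last by [].
  rewrite ge0_integral_density//; last exact: measurableT_comp.
  move/integrableP: ifg => [_]; apply: le_lt_trans.
  rewrite le_eqVlt; apply/orP; left; apply/eqP; apply: eq_integral => x _ /=.
  by rewrite normrM (ger0_norm (g0 x)).
rewrite [LHS]integralE [RHS]integralE; congr (_ - _)%E.
  rewrite [LHS](_ : _ = \int[nu]_x (Num.max (f x) 0)%:E)%E; last first.
    by apply: eq_integral => x _; rewrite funeposE -EFin_max.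
  rewrite ge0_integral_density; last 2 first.
  - by apply: measurable_maxr.
  - by move=> x; rewrite le_max lexx orbT.
  apply: eq_integral => x _; rewrite funeposE -EFin_max; congr EFin.
  by rewrite maxr_pMl// mul0r.
rewrite [LHS](_ : _ = \int[nu]_x (Num.max (- f x) 0)%:E)%E; last first.
  by apply: eq_integral => x _; rewrite funenegE -EFinN -EFin_max.
rewrite ge0_integral_density; last 2 first.
- by apply: measurable_maxr => //; exact: measurableT_comp.
- by move=> x; rewrite le_max lexx orbT.
apply: eq_integral => x _; rewrite funenegE -EFinN -EFin_max; congr EFin.
by rewrite maxr_pMl// mul0r mulNr.
Qed.

End Density.

Section IntegralDerivative.
Context {R : realType}.
Local Notation mu := (@lebesgue_measure R).

(** The integrals over the symmetric intervals are given by the fundamental theorem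
    of calculus and converge by domination. *)
Lemma integral_derive0 (F f : R -> R) : continuous f ->
  (forall x : R, is_derive x 1 F (f x)) -> mu.-integrable [set: R] (EFin \o f) ->
  F n%:R @[n --> \oo] --> 0 -> F (- n%:R) @[n --> \oo] --> 0 ->
  (\int[mu]_x (f x)%:E = 0)%E.
Proof.
move=> cf dF intf Fp Fm.
have cF : continuous F.
  move=> x; apply: differentiable_continuous; apply/derivable1_diffP.
  by have [] := dF x.
pose fn (n : nat) : R -> \bar R := (EFin \o f) \_ `[- (n%:R : R), n%:R].
have mfn n : measurable_fun [set: R] (fn n).
  apply/(measurable_restrictT _ _).1 => //; apply: measurable_funTS.
  exact: measurable_int intf.
have [_ _ cvg1] : [/\ mu.-integrable [set: R] (EFin \o f),
  [sequence \int[mu]_(x in [set: R]) `|fn n x - (EFin \o f) x|]_n @ \oo --> 0 &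
  [sequence \int[mu]_(x in [set: R]) fn n x]_n @ \oo -->
    \int[mu]_(x in [set: R]) (EFin \o f) x]%E.
  apply: (@dominated_convergence _ _ _ mu _ _ fn (EFin \o f) (abse \o (EFin \o f))) => //.
  - exact: measurable_int intf.
  - apply: aeW => x _; apply: cvg_near_cst; near=> n.
    rewrite /fn patchE ifT// inE /= in_itv /= -ler_norml.
    near: n; exact: nbhs_infty_ger.
  - exact: integrable_abse.
  - apply: aeW => x n _; rewrite /fn patchE; case: ifP => //= _.
    by rewrite normr0 lee_fin.
have cvg2 : ([sequence \int[mu]_(x in [set: R]) fn n x]_n @ \oo --> 0)%E.
  have -> : 0%E = ((0 : R) - 0)%:E by rewrite subrr.
  apply: (@cvg_trans _ ((fun n : nat => (F n%:R - F (- n%:R))%:E) @ \oo)).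
    apply: near_eq_cvg; near=> n; rewrite /= /fn -integral_mkcond.
    have n0 : (0 < n)%N by near: n; exists 1%N.
    have nn : - (n%:R : R) < n%:R by rewrite gtrN// ltr0n.
    apply/esym; rewrite EFinB; apply: continuous_FTC2 => //.
    - by apply: continuous_subspaceT => x; exact: cf.
    - split.
      + by move=> x _; have [] := dF x.
      + by apply: cvg_at_right_filter; exact: cF.
      + by apply: cvg_at_left_filter; exact: cF.
    - by move=> x _; rewrite derive1E; apply: derive_val.
  by apply: cvg_EFin; [exact: nearW|exact: cvgB].
exact: cvg_unique cvg1 cvg2.
Unshelve. all: by end_near.
Qed.

End IntegralDerivative.

Section NormalMoments.
Context {R : realType}.
Local Notation mu := (@lebesgue_measure R).
Implicit Types s x : R.

Lemma normal_fun_sqr s x :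
  normal_fun 0 s x = normal_fun 0 (Num.sqrt 2 * s) x ^+ 2.
Proof.
rewrite /normal_fun -expRM_natl; congr expR; rewrite exprMn sqr_sqrtr// subr0.
have [->|s0] := eqVneq s 0; first by rewrite expr0n /= mulr0 mul0rn invr0 !mulr0.
by field.
Qed.

(** A power is dominated by the exponential series. *)
Lemma normal_fun_moment_bound s n : s != 0 ->
  exists2 C : R, 0 <= C & forall x, `|x| ^+ n * normal_fun 0 s x <= C.
Proof.
move=> s0; pose c := s ^+ 2 *+ 2.
have c0 : 0 < c by rewrite mulrn_wgt0// exprn_even_gt0.
exists (1 + n`!%:R * c ^+ n).
  by rewrite addr_ge0// mulr_ge0// exprn_ge0// ltW.
move=> x; pose y := x ^+ 2 / c.
have y0 : 0 <= y by rewrite mulr_ge0 ?sqr_ge0// invr_ge0 ltW.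
have gE : normal_fun 0 s x = expR (- y).
  by rewrite /normal_fun subr0 mulNr.
have ey : y ^+ n <= n`!%:R * expR y.
  case: n => [|n]; first by rewrite expr0 fact0 mul1r -expR0 ler_expR.
  rewrite mulrC -ler_pdivrMr ?ltr0n ?fact_gt0//.
  by apply: le_trans (expR_ge1Dxn n y0); rewrite lerDr.
have xy : (`|x| ^+ n) ^+ 2 = y ^+ n * c ^+ n.
  by rewrite -exprMn /y divfK ?gt_eqF// -(real_normK (num_real x)) -!exprM mulnC.
have e1 : expR (- y) <= 1 by rewrite -expR0 ler_expR oppr_le0.
have e0 : 0 <= expR (- y) by exact: expR_ge0.
have h : (`|x| ^+ n) ^+ 2 * expR (- y) <= n`!%:R * c ^+ n.
  rewrite xy mulrAC ler_pM2r ?exprn_gt0//.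
  by rewrite expRN ler_pdivrMr ?expR_gt0.
rewrite gE; apply: (@le_trans _ _ ((1 + (`|x| ^+ n) ^+ 2) * expR (- y))).
  by apply: ler_wpM2r => //; nra.
by rewrite mulrDl mul1r lerD.
Qed.

Section Fixed.
Variable s : R.
Hypothesis s0 : s != 0.
Local Notation pdf := (normal_pdf 0 s).

Let pdfE x : pdf x = normal_peak s * normal_fun 0 s x.
Proof. by rewrite normal_pdfE. Qed.

(** Half of the exponent bounds the power; the other half is a normal density of
    twice the variance. *)
Lemma integrable_normal_moment n :
  mu.-integrable [set: R] (fun x => (x ^+ n * pdf x)%:E).
Proof.
pose a := Num.sqrt 2 * s.
have a0 : a != 0 by rewrite mulf_neq0// gt_eqF// sqrtr_gt0.
have [C C0 hC] := normal_fun_moment_bound n a0.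
pose D := normal_peak s * C / normal_peak a.
apply: (@le_integrable _ _ _ mu _ _ _ (fun x => (D * normal_pdf 0 a x)%:E)) => //.
- apply/measurable_EFinP; apply: measurable_funM => //.
  exact: measurable_normal_pdf.
- move=> x _; rewrite /= lee_fin.
  rewrite normrM normrX (ger0_norm (normal_pdf_ge0 _ _ _)) [leRHS]ger0_norm; last first.
    by rewrite !mulr_ge0 ?normal_pdf_ge0 ?normal_peak_ge0 ?invr_ge0 ?normal_peak_ge0.
  rewrite pdfE (normal_pdfE _ a0) /D -!mulrA mulKf ?gt_eqF ?normal_peak_gt0//.
  rewrite mulrCA ler_wpM2l ?normal_peak_ge0//.
  rewrite normal_fun_sqr expr2 mulrA ler_wpM2r ?normal_fun_ge0//.
- rewrite (_ : (fun x => _) = (fun x => D%:E * (normal_pdf 0 a x)%:E)%E).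
    by apply: integrableZl => //; exact: integrable_normal_pdf.
  by apply/funext => x; rewrite EFinM.
Qed.

Lemma is_derive_normal_moment n x :
  is_derive x 1 (fun y : R => y ^+ n * pdf y)
    (n%:R * (x ^+ n.-1 * pdf x) - s ^- 2 * (x ^+ n.+1 * pdf x)).
Proof.
have dn : is_derive x 1 (normal_fun 0 s) (- x / s ^+ 2 * normal_fun 0 s x).
  have -> : normal_fun 0 s =
      expR \o (fun y : R => - (s ^+ 2 *+ 2)^-1 * y ^+ 2).
    apply/funext => y; rewrite /normal_fun /= subr0; congr expR.
    by rewrite mulNr mulNr mulrC.
  apply: is_derive_eq; rewrite /GRing.scale /= /comp; set E := expR _.
  by field.
have dX : is_derive x 1 (fun y : R => y ^+ n) (n%:R * x ^+ n.-1).
  have := is_deriveX n (is_derive_id x (1 : R)).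
  by rewrite exprfctE /GRing.scale /= mulr1.
have dM := is_deriveZ (normal_peak s) (is_deriveM dX dn).
have -> : (fun y : R => y ^+ n * pdf y) =
    normal_peak s *: ((fun y : R => y ^+ n) * normal_fun 0 s).
  by apply/funext => y; rewrite pdfE mulrCA.
apply: is_derive_eq; rewrite !pdfE /GRing.scale /= (exprS x n); set y := x ^+ n; set z := x ^+ n.-1.
by field.
Qed.

Lemma normal_moment_decay n :
  (forall u : nat -> R, (forall k, `|u k| = k%:R) ->
   (u k ^+ n * pdf (u k)) @[k --> \oo] --> 0).
Proof.
move=> u uE; have [C C0 hC] := normal_fun_moment_bound n.+1 s0.
apply/cvgr0Pnorm_le => e e0; near=> k.
have k0 : (0 : R) < k%:R by rewrite ltr0n; near: k; exists 1%N.
rewrite pdfE normrM normrX uE.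
rewrite (ger0_norm (mulr_ge0 (normal_peak_ge0 _) (normal_fun_ge0 _ _ _))).
rewrite -(ler_pM2l k0) (mulrA _ (_ ^+ _)) -exprS mulrCA.
have := hC (u k); rewrite uE => h.
apply: (@le_trans _ _ (normal_peak s * C)).
  by rewrite ler_wpM2l ?normal_peak_ge0.
rewrite -ler_pdivrMr//; near: k; exact: nbhs_infty_ger.
Unshelve. all: by end_near.
Qed.

(** The integral over the line of the derivative of [x ^+ n * pdf x] is zero. *)
Lemma normal_moment_rec n :
  (\int[mu]_x (x ^+ n.+1 * pdf x)%:E =
   (n%:R * s ^+ 2)%:E * \int[mu]_x (x ^+ n.-1 * pdf x)%:E)%E.
Proof.
pose f x := n%:R * (x ^+ n.-1 * pdf x) - s ^- 2 * (x ^+ n.+1 * pdf x).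
have cm k : continuous (fun x => x ^+ k * pdf x).
  move=> x; apply: cvgM; first exact: exprn_continuous.
  exact: continuous_normal_pdf.
have I0 : (\int[mu]_x (f x)%:E = 0)%E.
  apply: (integral_derive0 (F := fun y : R => y ^+ n * pdf y)).
  - by move=> x; apply: cvgB; apply: cvgM; (try exact: cvg_cst); exact: cm.
  - exact: is_derive_normal_moment.
  - rewrite (_ : _ \o _ = ((fun x => (n%:R%:E * (x ^+ n.-1 * pdf x)%:E)) \-
      (fun x => ((s ^- 2)%:E * (x ^+ n.+1 * pdf x)%:E)))%E).
      by apply: integrableB => //; apply: integrableZl => //;
        exact: integrable_normal_moment.
    by apply/funext => x; rewrite /f /= EFinB !EFinM.
  - by apply: normal_moment_decay => k; rewrite normr_nat.
  - by apply: normal_moment_decay => k; rewrite normrN normr_nat.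
have := I0; rewrite (_ : (fun x => (f x)%:E) =
  ((fun x => (n%:R%:E * (x ^+ n.-1 * pdf x)%:E)) \-
      (fun x => ((s ^- 2)%:E * (x ^+ n.+1 * pdf x)%:E)))%E); last first.
  by apply/funext => x; rewrite /f /= EFinB !EFinM.
rewrite integralB//; last 2 first.
- by apply: integrableZl => //; exact: integrable_normal_moment.
- by apply: integrableZl => //; exact: integrable_normal_moment.
rewrite !integralZl//; last 2 first.
- exact: integrable_normal_moment.
- exact: integrable_normal_moment.
have /fineK <- : (\int[mu]_x (x ^+ n.-1 * pdf x)%:E)%E \is a fin_num.
  exact: integrable_fin_num (integrable_normal_moment _).
have /fineK <- : (\int[mu]_x (x ^+ n.+1 * pdf x)%:E)%E \is a fin_num.
  exact: integrable_fin_num (integrable_normal_moment _).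
rewrite -!EFinM -EFinB => -[] /eqP; rewrite subr_eq0 => /eqP e.
by congr EFin; rewrite mulrAC e mulrAC mulVf ?mul1r// expf_neq0.
Qed.

End Fixed.
End NormalMoments.

(** * Gaussian random variables and the Wick formula *)

Section GaussianVariable.
Context {R : realType} d {T : measurableType d} (P : probability T R).
Local Notation mu := (@lebesgue_measure R).

Section Law.
Variables (Z : T -> R) (sigma : R).
Hypothesis mZ : measurable_fun [set: T] Z.
Hypothesis ZE : forall A : set R, measurable A ->
  P (Z @^-1` A) = centered_normal sigma A.

(* The law of [Z] has to live on the type that carries the Lebesgue measure. *)
Let Z' : T -> measurableTypeR R := Z.
Let mZ' : measurable_fun [set: T] Z' := mZ.
Let Y : {mfun T >-> measurableTypeR R} := mfun_Sub (mem_set mZ').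

Let transfer (f : R -> R) : measurable_fun [set: R] f ->
  (distribution P Y).-integrable [set: R] (EFin \o f) ->
  P.-integrable [set: T] (fun w => (f (Z w))%:E) /\
  (\int[P]_w (f (Z w))%:E = \int[distribution P Y]_x (f x)%:E)%E.
Proof.
move=> mf ifY.
have iP : P.-integrable [set: T] (fun w => (f (Z w))%:E).
  apply/integrableP; split.
    by apply/measurable_EFinP; exact: measurableT_comp.
  move/integrableP: ifY => [_]; apply: le_lt_trans.
  rewrite (@ge0_integral_distribution _ _ _ _ _ _ Y (fun x => `|(f x)%:E|%E))//.
  by apply: measurableT_comp => //; exact/measurable_EFinP.
split=> //; symmetry; rewrite (@integral_distribution _ _ _ _ _ _ Y)//.
exact/measurable_EFinP.
Qed.

Lemma normal_transfer (f : R -> R) : sigma != 0 -> measurable_fun [set: R] f ->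
  mu.-integrable [set: R] (fun x => (f x * normal_pdf 0 sigma x)%:E) ->
  P.-integrable [set: T] (fun w => (f (Z w))%:E) /\
  (\int[P]_w (f (Z w))%:E = \int[mu]_x (f x * normal_pdf 0 sigma x)%:E)%E.
Proof.
move=> s0 mf ifg.
have [i e] : (distribution P Y).-integrable [set: R] (EFin \o f) /\
    (\int[distribution P Y]_x (f x)%:E =
     \int[mu]_x (f x * normal_pdf 0 sigma x)%:E)%E.
  have := @integral_density _ (measurableTypeR R) R (distribution P Y) mu.
  apply => //; first exact: normal_pdf_ge0.
    exact: integrable_normal_pdf.
  move=> A mA; apply: etrans (ZE mA) _.
  by rewrite /centered_normal (negbTE s0).
by have [i' e'] := transfer mf i; split => //; rewrite e'.
Qed.

Lemma dirac_transfer (f : R -> R) : sigma = 0 -> measurable_fun [set: R] f ->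
  P.-integrable [set: T] (fun w => (f (Z w))%:E) /\
  (\int[P]_w (f (Z w))%:E = (f 0)%:E)%E.
Proof.
move=> s0 mf.
have eqm (g : measurableTypeR R -> \bar R) :
    (\int[distribution P Y]_x g x = \int[\d_(0%R : measurableTypeR R)]_x g x)%E.
  apply: eq_measure_integral => A mA _.
  by apply: etrans (ZE mA) _; rewrite /centered_normal s0 eqxx.
have i : (distribution P Y).-integrable [set: R] (EFin \o f).
  apply/integrableP; split; first exact/measurable_EFinP.
  rewrite eqm integral_dirac//; last first.
    by apply: measurableT_comp => //; exact/measurable_EFinP.
  by rewrite diracT mul1e ltry.
have [i' ->] := transfer mf i; split => //.
by rewrite eqm integral_dirac ?diracT ?mul1e//; exact/measurable_EFinP.
Qed.

(** A zero variance gives the Dirac measure, whose moments satisfy the recursion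
    trivially. *)
Lemma gaussian_moments :
  (forall n, P.-integrable [set: T] (fun w => (Z w ^+ n)%:E)) /\
  (\int[P]_w (Z w)%:E = 0)%E /\
  (forall n, \int[P]_w (Z w ^+ n.+2)%:E =
    (n.+1%:R * sigma ^+ 2)%:E * \int[P]_w (Z w ^+ n)%:E)%E.
Proof.
have mX n : measurable_fun [set: R] (fun x : R => x ^+ n) by exact: measurable_funX.
have [s0|s0] := eqVneq sigma 0.
  have h n := dirac_transfer s0 (mX n); split; first by move=> n; case: (h n).
  split=> [|n].
    have [_] := dirac_transfer s0 (@measurable_id _ R setT).
    by [].
  by have [_ ->] := h n.+2; rewrite s0 !expr0n /= mulr0 mul0e.
have h n := normal_transfer s0 (mX n) (integrable_normal_moment s0 n).
split; first by move=> n; case: (h n).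
split=> [|n].
  have := (h 1%N).2; rewrite normal_moment_rec// mul0r mul0e => <-.
  by [].
by rewrite (h n.+2).2 (h n).2 normal_moment_rec.
Qed.

End Law.
End GaussianVariable.

Section FiniteMoments.
Context {R : realType} d {T : measurableType d} (P : probability T R).
Implicit Types X Y Z U : T -> R.

Definition Ex Z : R := fine ('E_P[Z])%E.

Definition int1 Z : Prop := P.-integrable [set: T] (fun w => (Z w)%:E).

(** All the powers are integrable. Such random variables form an algebra, to
    which all the random variables below belong. *)
Definition finite_moments Z : Prop :=
  measurable_fun [set: T] Z /\ forall n, int1 (fun w => Z w ^+ n).

Lemma ExE Z : Ex Z = fine (\int[P]_w (Z w)%:E)%E.
Proof. by rewrite /Ex unlock. Qed.

Lemma ExD X Y : int1 X -> int1 Y -> Ex (fun w => X w + Y w) = Ex X + Ex Y.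
Proof.
move=> iX iY; rewrite !ExE -fineD.
- by rewrite -integralD_EFin.
- exact: integrable_fin_num iX.
- exact: integrable_fin_num iY.
Qed.

Lemma ExZ a X : int1 X -> Ex (fun w => a * X w) = a * Ex X.
Proof.
move=> iX; rewrite !ExE.
have -> : (\int[P]_w (a * X w)%:E = a%:E * \int[P]_w (X w)%:E)%E.
  by rewrite -integralZl//; apply: eq_integral => w _; rewrite EFinM.
by rewrite fineM//; exact: integrable_fin_num iX.
Qed.

Lemma Ex_cst a : Ex (fun=> a) = a.
Proof. by rewrite ExE integral_cst//= probability_setT mule1. Qed.

Lemma int1_cst a : int1 (fun=> a).
Proof. exact: finite_measure_integrable_cst. Qed.

Lemma int1D X Y : int1 X -> int1 Y -> int1 (fun w => X w + Y w).
Proof. by move=> iX iY; rewrite /int1; under eq_fun do rewrite EFinD; exact: integrableD. Qed.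

Lemma int1Z a X : int1 X -> int1 (fun w => a * X w).
Proof.
by move=> iX; rewrite /int1; under eq_fun do rewrite EFinM; exact: integrableZl.
Qed.

Lemma fm_int1 Z : finite_moments Z -> int1 Z.
Proof. by case=> _ /(_ 1%N). Qed.

Let int1_pow X Y m n : finite_moments X -> finite_moments Y ->
  int1 (fun w => X w ^+ m * Y w ^+ n).
Proof.
move=> [mX iX] [mY iY].
apply: (@le_integrable _ _ _ P _ _ _
  (fun w => (X w ^+ m.*2 + Y w ^+ n.*2)%:E)) => //.
- by apply/measurable_EFinP; apply: measurable_funM; exact: measurable_funX.
- move=> w _; rewrite /= lee_fin -!muln2 !exprM.
  set x := X w ^+ m; set y := Y w ^+ n.
  have xy0 : 0 <= x ^+ 2 + y ^+ 2 by rewrite addr_ge0// sqr_ge0.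
  rewrite (ger0_norm xy0) normrM -[x ^+ 2]real_normK ?num_real//.
  rewrite -[y ^+ 2]real_normK ?num_real//.
  have := normr_ge0 x; have := normr_ge0 y; nra.
- exact: int1D.
Qed.

Lemma fm_mul X Y : finite_moments X -> finite_moments Y ->
  finite_moments (fun w => X w * Y w).
Proof.
move=> hX hY; split; first by apply: measurable_funM; [case: hX|case: hY].
move=> n; have := int1_pow n n hX hY.
by under eq_fun do rewrite -exprMn.
Qed.

Lemma fm_cst a : finite_moments (fun=> a).
Proof. by split=> [|n]; [exact: measurable_cst|exact: int1_cst]. Qed.

Lemma fmZ a X : finite_moments X -> finite_moments (fun w => a * X w).
Proof. by move=> hX; apply: fm_mul => //; exact: fm_cst. Qed.

Lemma int1_sum I (r : seq I) (F : I -> T -> R) :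
  (forall i, int1 (F i)) -> int1 (fun w => \sum_(i <- r) F i w).
Proof.
move=> iF; elim: r => [|i r IH].
  by rewrite (_ : (fun _ => _) = fun=> 0);
    [exact: int1_cst|apply/funext => w; rewrite big_nil].
by rewrite (_ : (fun _ => _) = fun w => F i w + \sum_(j <- r) F j w);
  [exact: int1D|apply/funext => w; rewrite big_cons].
Qed.

Lemma Ex_sum I (r : seq I) (F : I -> T -> R) : (forall i, int1 (F i)) ->
  Ex (fun w => \sum_(i <- r) F i w) = \sum_(i <- r) Ex (F i).
Proof.
move=> iF; elim: r => [|i r IH].
  by rewrite big_nil -[RHS]Ex_cst; congr Ex; apply/funext => w; rewrite big_nil.
rewrite big_cons -IH -ExD//; last exact: int1_sum.
by congr Ex; apply/funext => w; rewrite big_cons.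
Qed.

Lemma fmD X Y : finite_moments X -> finite_moments Y ->
  finite_moments (fun w => X w + Y w).
Proof.
move=> hX hY; split; first by apply: measurable_funD; [case: hX|case: hY].
move=> n; under eq_fun do rewrite exprDn.
apply: int1_sum => i; under eq_fun do rewrite -mulr_natl.
by apply: int1Z; exact: int1_pow.
Qed.

Lemma fmX n X : finite_moments X -> finite_moments (fun w => X w ^+ n).
Proof.
move=> hX; elim: n => [|n IH]; first exact: fm_cst.
by under eq_fun do rewrite exprS; exact: fm_mul.
Qed.

End FiniteMoments.

Section FirstOrder.
Context {R : realType}.
Implicit Types (f : R -> R) (a b : R).

(** The function [f] is polynomial and [a + b t] is its expansion of first order; so
    [a] and [b] behave like the components of a dual number. *)
Definition poly1 f a b : Prop :=
  exists Q : {poly R}, [/\ forall t, Q.[t] = f t, Q`_0 = a & Q`_1 = b].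

Lemma poly1_cst c : poly1 (fun=> c) c 0.
Proof.
by exists c%:P; split => [t||]; rewrite ?hornerC ?coefC.
Qed.

Lemma poly1D f g a b c e : poly1 f a b -> poly1 g c e ->
  poly1 (fun t => f t + g t) (a + c) (b + e).
Proof.
move=> [p [pE <- <-]] [q [qE <- <-]]; exists (p + q).
by split => [t||]; rewrite ?hornerD ?pE ?qE ?coefD.
Qed.

Lemma poly1M f g a b c e : poly1 f a b -> poly1 g c e ->
  poly1 (fun t => f t * g t) (a * c) (a * e + b * c).
Proof.
move=> [p [pE <- <-]] [q [qE <- <-]]; exists (p * q).
split => [t||]; rewrite ?hornerM ?pE ?qE ?coefM//.
  by rewrite big_ord1.
by rewrite !big_ord_recr big_ord0 /= add0r.
Qed.

Lemma poly1_cutsum A (s : seq A) (f : seq A -> A -> seq A -> R -> R)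
    (a b : seq A -> A -> seq A -> R) :
  (forall u z v, s = u ++ z :: v -> poly1 (f u z v) (a u z v) (b u z v)) ->
  poly1 (fun t => cutsum (fun u z v => f u z v t) s) (cutsum a s) (cutsum b s).
Proof.
elim: s f a b => [|x s IH] f a b h /=; first exact: poly1_cst.
apply: poly1D; first exact: h.
by apply: IH => u z v sE; apply: h; rewrite sE.
Qed.

(** Polynomial functions on an infinite field determine their coefficients. *)
Lemma poly1_uniq f g a b c e : poly1 f a b -> poly1 g c e -> f =1 g -> b = e.
Proof.
move=> [p [pE _ <-]] [q [qE _ <-]] fg; suff -> : p = q by [].
apply/eqP; rewrite -subr_eq0; apply/negPn/negP => pq.
pose rs := [seq i%:R : R | i <- iota 0 (size (p - q))].
have rs_root : all (root (p - q)) rs.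
  by apply/allP => _ /mapP[i _ ->]; rewrite /root !hornerE pE qE fg subrr.
have rs_uniq : uniq rs.
  by rewrite map_inj_uniq ?iota_uniq// => i j /eqP; rewrite eqr_nat => /eqP.
by have := max_poly_roots pq rs_root rs_uniq; rewrite size_map size_iota ltnn.
Qed.

End FirstOrder.

Section Wick.
Context {R : realType} d {T : measurableType d} (P : probability T R).
Implicit Types (X Y Z U : T -> R) (s : seq (T -> R)).
Local Notation E := (Ex P).
Local Notation fm := (finite_moments P).

Definition fprod s (w : T) : R := \prod_(z <- s) z w.

Lemma fprod_cons z s w : fprod (z :: s) w = z w * fprod s w.
Proof. by rewrite /fprod big_cons. Qed.

(* A linear space of centered random variables with the moments of Gaussian ones. *)
Variable V : (T -> R) -> Prop.
Hypothesis Vlin : forall X Y t, V X -> V Y -> V (fun w => X w + t * Y w).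
Hypothesis Vfm : forall Z, V Z -> fm Z.
Hypothesis V0 : forall Z, V Z -> E Z = 0.
Hypothesis Vrec : forall Z n, V Z ->
  E (fun w => Z w ^+ n.+2) =
  n.+1%:R * E (fun w => Z w ^+ 2) * E (fun w => Z w ^+ n).

Fixpoint inV s : Prop := if s is z :: s' then V z /\ inV s' else True.

Lemma inV_cat s1 s2 : inV (s1 ++ s2) <-> inV s1 /\ inV s2.
Proof.
elim: s1 => [|z s1 IH] /=; first by split=> [|[]].
by rewrite IH; split=> [[? []]|[[]]].
Qed.

Lemma fm_fprod s : inV s -> fm (fprod s).
Proof.
elim: s => [|z s IH] hs.
  by rewrite (_ : fprod [::] = fun=> 1); [exact: fm_cst|
    apply/funext => w; rewrite /fprod big_nil].
rewrite (_ : fprod (z :: s) = fun w => z w * fprod s w); last first.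
  by apply/funext => w; rewrite fprod_cons.
by case: hs => Vz Vs; apply: fm_mul; [exact: Vfm|exact: IH].
Qed.

Lemma poly1_shift U Z Y n : fm U -> fm Z -> fm Y ->
  poly1 (fun t => E (fun w => U w * (Z w + t * Y w) ^+ n))
    (E (fun w => U w * Z w ^+ n))
    (n%:R * E (fun w => U w * (Y w * Z w ^+ n.-1))).
Proof.
move=> hU hZ hY.
pose F i w := U w * (Z w ^+ (n - i) * Y w ^+ i).
have iF i : int1 P (F i).
  by apply: fm_int1; apply: fm_mul => //; apply: fm_mul; exact: fmX.
exists (\poly_(i < n.+1) ('C(n, i)%:R * E (F i))); split.
- move=> t; rewrite horner_poly.
  transitivity (E (fun w => \sum_(i < n.+1) ('C(n, i)%:R * t ^+ i) * F i w)).
    rewrite Ex_sum; last by move=> i; exact: int1Z.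
    by apply: eq_bigr => i _; rewrite ExZ//; ring.
  congr Ex; apply/funext => w; rewrite exprDn mulr_sumr; apply: eq_bigr => i _.
  by rewrite /F exprMn -mulr_natr; ring.
- rewrite coef_poly /= bin0 mul1r; congr Ex; apply/funext => w.
  by rewrite /F subn0 expr0 mulr1.
- rewrite coef_poly; case: n @F iF => [|n] F iF /=; first by rewrite mul0r.
  rewrite bin1; congr (_ * Ex _ _); apply/funext => w.
  by rewrite /F subn1 expr1 [Y w * _]mulrC.
Qed.

(** The first-order coefficient of the recursion for the moments of [Z + t * Y]. *)
Lemma stein_pow Y Z p : V Y -> V Z ->
  E (fun w => Y w * Z w ^+ p) =
  p%:R * (E (fun w => Y w * Z w) * E (fun w => Z w ^+ p.-1)).
Proof.
move=> VY VZ; have fY := Vfm VY; have fZ := Vfm VZ.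
have [n] := ubnP p; elim: n p => // n IH [|[|[|p]]] pn.
- by rewrite mul0r -(V0 VY); congr Ex; apply/funext => w; rewrite expr0 mulr1.
- rewrite mul1r /= (_ : (fun w => Z w ^+ 0) = fun=> 1)// Ex_cst mulr1.
  by congr Ex; apply/funext => w; rewrite expr1.
(* The third moment of [Z + t * Y] is zero for every [t]. *)
- rewrite /= (_ : (fun w => Z w ^+ 1) = Z)// (V0 VZ) !mulr0.
  have h1 := poly1_shift 3 (fm_cst P 1) fZ fY.
  have fE t : E (fun w => 1 * (Z w + t * Y w) ^+ 3) = 0.
    have := Vrec 1 (Vlin t VZ VY); under eq_fun do rewrite -[_ ^+ 3]mul1r.
    by move=> ->; rewrite (_ : (fun w => _ ^+ 1) = fun w => Z w + t * Y w)//
      (V0 (Vlin t VZ VY)) mulr0.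
  have /eqP := poly1_uniq h1 (poly1_cst 0) fE.
  rewrite mulf_eq0 pnatr_eq0 /= => /eqP e.
  by rewrite -[RHS]e; congr Ex; apply/funext => w; rewrite mul1r.
have h1 := poly1_shift p.+4 (fm_cst P 1) fZ fY.
have h2 := poly1M (poly1M (poly1_cst p.+3%:R) (poly1_shift 2 (fm_cst P 1) fZ fY))
             (poly1_shift p.+2 (fm_cst P 1) fZ fY).
have fE t : E (fun w => 1 * (Z w + t * Y w) ^+ p.+4) =
    p.+3%:R * E (fun w => 1 * (Z w + t * Y w) ^+ 2) *
    E (fun w => 1 * (Z w + t * Y w) ^+ p.+2).
  have e n0 : E (fun w => 1 * (Z w + t * Y w) ^+ n0) =
              E (fun w => (Z w + t * Y w) ^+ n0).
    by congr Ex; apply/funext => w; rewrite mul1r.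
  by rewrite !e (Vrec p.+2 (Vlin t VZ VY)).
have /= := poly1_uniq h1 h2 fE.
have e1 U : E (fun w => 1 * U w) = E U.
  by congr Ex; apply/funext => w; rewrite mul1r.
rewrite !(e1 (fun w => Z w ^+ _)) !(e1 (fun w => Y w * Z w ^+ _)).
rewrite (_ : E (fun w => Y w * Z w ^+ 1) = E (fun w => Y w * Z w))//.
have -> : E (fun w => Y w * Z w ^+ p.+1) =
  p.+1%:R * (E (fun w => Y w * Z w) * E (fun w => Z w ^+ p)).
  by rewrite IH//; lia.
rewrite (Vrec p VZ) => e.
have p0 : p.+4%:R != 0 :> R by rewrite pnatr_eq0.
apply: (mulfI p0); rewrite e; ring.
Qed.

(** Polarization: the first-order coefficient in [t], [Z] being replaced by
    [Z + t * Y], turns one more power of [Z] into a factor [Y]. *)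
Lemma stein_list s : inV s -> forall Y Z p, V Y -> V Z ->
  E (fun w => Y w * (fprod s w * Z w ^+ p)) =
  cutsum (fun u z v => E (fun w => Y w * z w) *
            E (fun w => fprod (u ++ v) w * Z w ^+ p)) s +
  p%:R * (E (fun w => Y w * Z w) * E (fun w => fprod s w * Z w ^+ p.-1)).
Proof.
elim: s => [|x s IH] hs Y Z p VY VZ.
  rewrite /= add0r; under eq_fun do rewrite /fprod big_nil mul1r.
  rewrite stein_pow//; congr (_ * (_ * _)); congr Ex; apply/funext => w.
  by rewrite /fprod big_nil mul1r.
case: hs => Vx Vs.
have fY := Vfm VY; have fZ := Vfm VZ; have fx := Vfm Vx; have fs := fm_fprod Vs.
pose f t := E (fun w => (Y w * fprod s w) * (Z w + t * x w) ^+ p.+1).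
have h1 : poly1 f _ _ := poly1_shift p.+1 (fm_mul fY fs) fZ fx.
have hc : poly1 (fun t => cutsum (fun u z v => E (fun w => Y w * z w) *
     E (fun w => fprod (u ++ v) w * (Z w + t * x w) ^+ p.+1)) s)
   (cutsum (fun u z v => E (fun w => Y w * z w) *
     E (fun w => fprod (u ++ v) w * Z w ^+ p.+1)) s)
   (cutsum (fun u z v => E (fun w => Y w * z w) *
     (p.+1%:R * E (fun w => fprod (u ++ v) w * (x w * Z w ^+ p)))) s).
  apply: poly1_cutsum => u z v sE.
  have fuv : fm (fprod (u ++ v)).
    apply: fm_fprod; move: Vs; rewrite sE => /inV_cat[hu [_ hv]].
    exact/inV_cat.
  have := poly1M (poly1_cst (E (fun w => Y w * z w))) (poly1_shift p.+1 fuv fZ fx).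
  by rewrite mul0r addr0.
have hYZ : poly1 (fun t => E (fun w => Y w * (Z w + t * x w) ^+ 1)) _ _ :=
  poly1_shift 1 fY fZ fx.
have h2 := poly1D hc (poly1M (poly1_cst p.+1%:R)
   (poly1M hYZ (poly1_shift p fs fZ fx))).
have fE t : f t = cutsum (fun u z v => E (fun w => Y w * z w) *
     E (fun w => fprod (u ++ v) w * (Z w + t * x w) ^+ p.+1)) s +
   p.+1%:R * (E (fun w => Y w * (Z w + t * x w) ^+ 1) *
              E (fun w => fprod s w * (Z w + t * x w) ^+ p)).
  rewrite /f; have := IH Vs Y (fun w => Z w + t * x w) p.+1 VY (Vlin t VZ Vx).
  by under eq_fun do rewrite mulrA.
have p0 : p.+1%:R != 0 :> R by rewrite pnatr_eq0.
apply: (mulfI p0); have /= := poly1_uniq h1 h2 fE.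
rewrite (_ : E (fun w => Y w * fprod s w * (x w * Z w ^+ p)) =
             E (fun w => Y w * (fprod (x :: s) w * Z w ^+ p))); last first.
  by congr Ex; apply/funext => w; rewrite fprod_cons; ring.
move=> ->; rewrite mulrDr mulrDr; rewrite (_ : cutsum _ s = p.+1%:R *
  cutsum (fun u z v => E (fun w => Y w * z w) *
    E (fun w => fprod (x :: u ++ v) w * Z w ^+ p)) s); last first.
  rewrite (cutsum_morph (f := fun y => p.+1%:R * y)) ?mulr0//; last first.
    by move=> ? ?; rewrite mulrDr.
  apply: eq_cutsum => u z v _; rewrite mulrCA; congr (_ * (_ * _)).
  by congr Ex; apply/funext => w; rewrite fprod_cons; ring.
rewrite (_ : E (fun w => fprod s w * (x w * Z w ^+ p.-1)) =
             E (fun w => fprod (x :: s) w * Z w ^+ p.-1)); last first.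
  by congr Ex; apply/funext => w; rewrite fprod_cons; ring.
rewrite (_ : E (fun w => Y w * Z w ^+ 1) = E (fun w => Y w * Z w))//.
rewrite (_ : E (fun w => Y w * (x w * Z w ^+ 0)) = E (fun w => Y w * x w)); last first.
  by congr Ex; apply/funext => w; rewrite expr0 mulr1.
ring.
Qed.

(** Gaussian integration by parts. *)
Lemma wick_real Y s : V Y -> inV s ->
  E (fprod (Y :: s)) =
  cutsum (fun u z v => E (fun w => Y w * z w) * E (fprod (u ++ v))) s.
Proof.
move=> VY Vs; have := stein_list Vs 0 VY VY.
rewrite mul0r addr0 (_ : (fun w => _) = fprod (Y :: s)); last first.
  by apply/funext => w; rewrite fprod_cons expr0 mulr1.
move=> ->; apply: eq_cutsum => u z v _; congr (_ * _).
by congr Ex; apply/funext => w; rewrite expr0 mulr1.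
Qed.

End Wick.

(** * Complex random variables *)

Section ComplexExpectation.
Context {R : realType} d {T : measurableType d} (P : probability T R).
Local Notation C := R[i].
Local Notation E := (Ex P).
Local Notation fm := (finite_moments P).
Local Notation cE := (cexpect P).
Implicit Types (Z X Y : T -> C).

(** The random variables with finite moments of all orders form an algebra. *)
Definition cfm Z : Prop :=
  fm (fun w => complex.Re (Z w)) /\ fm (fun w => complex.Im (Z w)).

Lemma cexpectE Z :
  cE Z = (E (fun w => complex.Re (Z w)) +i* E (fun w => complex.Im (Z w)))%C.
Proof. by []. Qed.

Lemma ReD (x y : C) : complex.Re (x + y) = complex.Re x + complex.Re y.
Proof. by case: x y => [? ?] []. Qed.
Lemma ImD (x y : C) : complex.Im (x + y) = complex.Im x + complex.Im y.
Proof. by case: x y => [? ?] []. Qed.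
Lemma ReM (x y : C) : complex.Re (x * y) =
  complex.Re x * complex.Re y + -1 * (complex.Im x * complex.Im y).
Proof. by case: x y => [? ?] [? ?] /=; rewrite mulN1r. Qed.
Lemma ImM (x y : C) : complex.Im (x * y) =
  complex.Re x * complex.Im y + complex.Im x * complex.Re y.
Proof. by case: x y => [? ?] [? ?]. Qed.

Lemma cfm_int Z : cfm Z -> cintegrable P Z.
Proof. by case=> h1 h2; split; exact: fm_int1. Qed.

Lemma cfm_cst c : cfm (fun=> c).
Proof. by split; exact: fm_cst. Qed.

Lemma cfmD X Y : cfm X -> cfm Y -> cfm (fun w => X w + Y w).
Proof.
move=> [X1 X2] [Y1 Y2]; split.
  by under eq_fun do rewrite ReD; exact: fmD.
by under eq_fun do rewrite ImD; exact: fmD.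
Qed.

Lemma cfmM X Y : cfm X -> cfm Y -> cfm (fun w => X w * Y w).
Proof.
move=> [X1 X2] [Y1 Y2]; split.
  under eq_fun do rewrite ReM; apply: fmD; first exact: fm_mul.
  by apply: fmZ; exact: fm_mul.
by under eq_fun do rewrite ImM; apply: fmD; exact: fm_mul.
Qed.

Lemma cfmZ c X : cfm X -> cfm (fun w => c * X w).
Proof. by apply: cfmM; exact: cfm_cst. Qed.

Lemma cfm_sum I (r : seq I) (Q : pred I) (F : I -> T -> C) :
  (forall i, cfm (F i)) -> cfm (fun w => \sum_(i <- r | Q i) F i w).
Proof.
move=> hF; elim: r => [|i r IH].
  by under eq_fun do rewrite big_nil; exact: cfm_cst.
under eq_fun do rewrite big_cons; case: (Q i) => //; exact: cfmD.
Qed.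

Lemma cfm_prod I (r : seq I) (Q : pred I) (F : I -> T -> C) :
  (forall i, cfm (F i)) -> cfm (fun w => \prod_(i <- r | Q i) F i w).
Proof.
move=> hF; elim: r => [|i r IH].
  by under eq_fun do rewrite big_nil; exact: cfm_cst.
under eq_fun do rewrite big_cons; case: (Q i) => //; exact: cfmM.
Qed.

Lemma cexpect_cst c : cE (fun=> c) = c.
Proof. by rewrite cexpectE !Ex_cst; case: c. Qed.

Lemma cexpectD X Y : cfm X -> cfm Y -> cE (fun w => X w + Y w) = cE X + cE Y.
Proof.
move=> [X1 X2] [Y1 Y2]; rewrite !cexpectE.
under eq_fun do rewrite ReD; under [X in (_ +i* Ex _ X)%C]eq_fun do rewrite ImD.
by rewrite !ExD//; exact: fm_int1.
Qed.

Lemma cexpectZ c X : cfm X -> cE (fun w => c * X w) = c * cE X.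
Proof.
move=> [X1 X2]; have i1 := fm_int1 X1; have i2 := fm_int1 X2; rewrite !cexpectE.
have -> : E (fun w => complex.Re (c * X w)) =
    complex.Re c * E (fun w => complex.Re (X w)) +
    (- complex.Im c) * E (fun w => complex.Im (X w)).
  rewrite -!ExZ// -ExD; [|exact: int1Z|exact: int1Z].
  by congr Ex; apply/funext => w; rewrite ReM mulN1r mulNr.
have -> : E (fun w => complex.Im (c * X w)) =
    complex.Re c * E (fun w => complex.Im (X w)) +
    complex.Im c * E (fun w => complex.Re (X w)).
  rewrite -!ExZ// -ExD; [|exact: int1Z|exact: int1Z].
  by congr Ex; apply/funext => w; rewrite ImM.
case: c => c1 c2; apply/eqP; rewrite eq_complex /=.
by apply/andP; split; apply/eqP; ring.
Qed.

Lemma cexpect_sum I (r : seq I) (Q : pred I) (F : I -> T -> C) :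
  (forall i, cfm (F i)) ->
  cE (fun w => \sum_(i <- r | Q i) F i w) = \sum_(i <- r | Q i) cE (F i).
Proof.
move=> hF; elim: r => [|i r IH].
  by under eq_fun do rewrite big_nil; rewrite big_nil cexpect_cst.
under eq_fun do rewrite big_cons; rewrite big_cons; case: (Q i) => //.
by rewrite cexpectD ?IH//; exact: cfm_sum.
Qed.

Lemma cexpect_real (x : T -> R) : cE (fun w => (x w)%:C%C) = (E x)%:C%C.
Proof. by rewrite cexpectE /= Ex_cst. Qed.

Lemma cexpect_conj Z : cfm Z -> cE (fun w => (Z w)^*) = (cE Z)^*.
Proof.
move=> [h1 h2]; rewrite !cexpectE /=; apply/eqP; rewrite eq_complex /=.
apply/andP; split; apply/eqP.
  by congr Ex; apply/funext => w; case: (Z w).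
rewrite -mulN1r -ExZ; last exact: fm_int1.
by congr Ex; apply/funext => w; rewrite mulN1r; case: (Z w).
Qed.

Section ComplexWick.
Variable V : (T -> R) -> Prop.
Hypothesis Vlin : forall (x y : T -> R) t, V x -> V y -> V (fun w => x w + t * y w).
Hypothesis Vfm : forall x : T -> R, V x -> fm x.
Hypothesis V0 : forall x : T -> R, V x -> E x = 0.
Hypothesis Vrec : forall (x : T -> R) n, V x ->
  E (fun w => x w ^+ n.+2) =
  n.+1%:R * E (fun w => x w ^+ 2) * E (fun w => x w ^+ n).

Definition cV Z : Prop :=
  V (fun w => complex.Re (Z w)) /\ V (fun w => complex.Im (Z w)).

Definition cprod (s : seq (T -> C)) (w : T) : C := \prod_(z <- s) z w.

Fixpoint allcV (s : seq (T -> C)) : Prop :=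
  if s is z :: s' then cV z /\ allcV s' else True.

Lemma allcV_cat s1 s2 : allcV (s1 ++ s2) <-> allcV s1 /\ allcV s2.
Proof.
elim: s1 => [|z s1 IH] /=; first by split=> [|[]].
by rewrite IH; split=> [[? []]|[[]]].
Qed.

Lemma cprod_cons z s w : cprod (z :: s) w = z w * cprod s w.
Proof. by rewrite /cprod big_cons. Qed.

Lemma cprod_cat s1 s2 w : cprod (s1 ++ s2) w = cprod s1 w * cprod s2 w.
Proof. by rewrite /cprod big_cat. Qed.

Lemma cV_cfm Z : cV Z -> cfm Z.
Proof. by case=> h1 h2; split; exact: Vfm. Qed.

Lemma cfm_cprod s : allcV s -> cfm (cprod s).
Proof.
elim: s => [|z s IH] hs.
  by rewrite (_ : cprod [::] = fun=> 1); [exact: cfm_cst|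
    apply/funext => w; rewrite /cprod big_nil].
rewrite (_ : cprod (z :: s) = fun w => z w * cprod s w); last first.
  by apply/funext => w; rewrite cprod_cons.
by case: hs => Vz Vs; apply: cfmM; [exact: cV_cfm|exact: IH].
Qed.

Let pairing (Y : T -> C) s : C :=
  cutsum (fun u z v => cE (fun w => Y w * z w) * cE (cprod (u ++ v))) s.

Let emb (x : T -> R) : T -> C := fun w => (x w)%:C%C.

Let V_cst0 (Z : T -> R) : V Z -> V (fun=> 0).
Proof.
by move=> VZ; have := Vlin (-1) VZ VZ; under eq_fun do rewrite mulN1r subrr.
Qed.

Let cV_emb x : V x -> cV (emb x).
Proof. by move=> Vx; split => //; exact: V_cst0 Vx. Qed.

Let split_re_im Z : Z = (fun w => 'i%C * emb (fun w => complex.Im (Z w)) w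
                              + emb (fun w => complex.Re (Z w)) w).
Proof.
apply/funext => w; rewrite /emb; case: (Z w) => a b /=.
by apply/eqP; rewrite eq_complex /=; apply/andP; split; apply/eqP; ring.
Qed.

Let cprod_lin s1 s2 (x y : T -> C) a w :
  cprod (s1 ++ (fun w => a * x w + y w) :: s2) w =
  a * cprod (s1 ++ x :: s2) w + cprod (s1 ++ y :: s2) w.
Proof. by rewrite !cprod_cat !cprod_cons; ring. Qed.

Let cE_lin s1 s2 x y a : allcV s1 -> allcV s2 -> cV x -> cV y ->
  cE (cprod (s1 ++ (fun w => a * x w + y w) :: s2)) =
  a * cE (cprod (s1 ++ x :: s2)) + cE (cprod (s1 ++ y :: s2)).
Proof.
move=> h1 h2 hx hy; have hz z : cV z -> allcV (s1 ++ z :: s2).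
  by move=> cz; exact/allcV_cat.
have hx' := cfm_cprod (hz x hx); have hy' := cfm_cprod (hz y hy).
rewrite -cexpectZ// -cexpectD//; last exact: cfmZ.
by congr (cexpect P); apply/funext => w; rewrite cprod_lin.
Qed.

Let pairing_lin Y s1 s2 x y a : cV Y -> allcV s1 -> allcV s2 -> cV x -> cV y ->
  pairing Y (s1 ++ (fun w => a * x w + y w) :: s2) =
  a * pairing Y (s1 ++ x :: s2) + pairing Y (s1 ++ y :: s2).
Proof.
move=> hY h1 h2 hx hy; rewrite /pairing !cutsum_cat /=.
have aD (u v : C) : a * (u + v) = a * u + a * v by rewrite mulrDr.
have lin (f g h : seq (T -> C) -> (T -> C) -> seq (T -> C) -> C) s :
    (forall u z v, s = u ++ z :: v -> f u z v = a * g u z v + h u z v) ->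
    cutsum f s = a * cutsum g s + cutsum h s.
  move=> e; rewrite (cutsum_morph (f := *%R a)) ?mulr0// -cutsumD.
  exact: eq_cutsum.
rewrite (lin _ (fun u g v => cE (fun w => Y w * g w) * cE (cprod (u ++ v ++ x :: s2)))
  (fun u g v => cE (fun w => Y w * g w) * cE (cprod (u ++ v ++ y :: s2))) s1);
  last first.
  move=> u z v sE; rewrite !catA cE_lin//.
    by rewrite mulrDr mulrCA.
  by move: h1; rewrite sE => /allcV_cat[? [_ ?]]; exact/allcV_cat.
rewrite (lin _ (fun u g v => cE (fun w => Y w * g w) * cE (cprod ((s1 ++ x :: u) ++ v)))
  (fun u g v => cE (fun w => Y w * g w) * cE (cprod ((s1 ++ y :: u) ++ v))) s2);
  last first.
  move=> u z v sE; rewrite -!catA !cat_cons cE_lin//.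
    by rewrite mulrDr mulrCA.
  by move: h2; rewrite sE => /allcV_cat[? [_ ?]]; exact/allcV_cat.
have -> : cE (fun w => Y w * (a * x w + y w)) =
    a * cE (fun w => Y w * x w) + cE (fun w => Y w * y w).
  have fY := cV_cfm hY; have fx := cfmM fY (cV_cfm hx).
  have fy := cfmM fY (cV_cfm hy).
  rewrite -cexpectZ// -cexpectD//; last exact: cfmZ.
  by congr (cexpect P); apply/funext => w; ring.
rewrite !aD; ring.
Qed.

Let pairing_linl s x y a : allcV s -> cV x -> cV y ->
  pairing (fun w => a * x w + y w) s = a * pairing x s + pairing y s.
Proof.
move=> hs hx hy; rewrite /pairing (cutsum_morph (f := *%R a)) ?mulr0//; last first.
  by move=> ? ?; rewrite mulrDr.
rewrite -cutsumD; apply: eq_cutsum => u z v sE.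
have fz : cfm z by move: hs; rewrite sE => /allcV_cat[_ [/cV_cfm]].
have fx := cfmM (cV_cfm hx) fz; have fy := cfmM (cV_cfm hy) fz.
rewrite mulrA -mulrDl; congr (_ * _).
rewrite -cexpectZ// -cexpectD//; last exact: cfmZ.
by congr (cexpect P); apply/funext => w; ring.
Qed.

Let wick_emb x s : V x -> inV V s ->
  cE (cprod (emb x :: map emb s)) = pairing (emb x) (map emb s).
Proof.
move=> Vx Vs.
have cprodE t : cprod (map emb t) = (fun w => (fprod t w)%:C%C).
  apply/funext => w; rewrite /cprod /fprod big_map.
  by rewrite -(rmorph_prod (real_complex R)).
rewrite -map_cons cprodE cexpect_real (wick_real Vlin Vfm V0 Vrec Vx Vs).
rewrite (cutsum_morph (f := real_complex R)) ?rmorph0//; last exact: rmorphD.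
rewrite /pairing.
have cutmap (B : seq (T -> C) -> (T -> C) -> seq (T -> C) -> C) (t : seq (T -> R)) :
    cutsum B (map emb t) = cutsum (fun u z v => B (map emb u) (emb z) (map emb v)) t.
  by elim: t B => //= z t IH B; rewrite IH.
rewrite cutmap; apply: eq_cutsum => u z v _.
rewrite -map_cat cprodE cexpect_real rmorphM; congr (_ * _).
rewrite -[LHS]cexpect_real; congr (cexpect P); apply/funext => w.
by rewrite /emb rmorphM.
Qed.

(** Both sides are linear in each factor, so that the formula for real and
    imaginary parts gives the formula for complex combinations. *)
Lemma wick_complex Y s : cV Y -> allcV s ->
  cE (cprod (Y :: s)) =
  cutsum (fun u z v => cE (fun w => Y w * z w) * cE (cprod (u ++ v))) s.
Proof.
have allemb s1 : inV V s1 -> allcV (map emb s1).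
  by elim: s1 => //= z s1 IH [/cV_emb ? /IH].
have step x s2 : V x -> allcV s2 -> forall s1, inV V s1 ->
    cE (cprod (emb x :: map emb s1 ++ s2)) = pairing (emb x) (map emb s1 ++ s2).
  move=> Vx; elim: s2 => [|z s2 IH] h2 s1 h1; first by rewrite cats0 wick_emb.
  case: h2 => [[hr hi] h2].
  rewrite (split_re_im z) -cat_cons cE_lin/=; last 4 first.
  - by split; [exact: cV_emb|exact: allemb].
  - by [].
  - exact: cV_emb.
  - exact: cV_emb.
  rewrite pairing_lin//; try exact: cV_emb; last exact: allemb.
  rewrite -!cat_rcons -!map_rcons.
  by rewrite !IH// -cats1; apply/inV_cat.
move=> [hr hi] hs; rewrite (split_re_im Y) -/(pairing _ _).
rewrite (cE_lin (s1 := [::]))//; try exact: cV_emb.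
rewrite pairing_linl//; try exact: cV_emb.
by rewrite !(step _ s _ _ [::]).
Qed.

End ComplexWick.
End ComplexExpectation.

(** * Loop equations for Hermitian Gaussian matrices *)

Lemma sum_cutsum (W : nmodType) (A : Type) (I : finType)
    (B : I -> seq A -> A -> seq A -> W) w :
  \sum_(k : I) cutsum (B k) w = cutsum (fun u g v => \sum_(k : I) B k u g v) w.
Proof.
elim: w B => [|g w IH] B /=; first by rewrite big1.
by rewrite big_split /= IH.
Qed.

Section CexpectCutsum.
Context {R : realType} d {T : measurableType d} (P : probability T R).
Local Notation C := R[i].

Lemma cfm_cutsum A (w : seq A) (B : seq A -> A -> seq A -> T -> C) :
  (forall u g v, w = u ++ g :: v -> cfm P (B u g v)) ->
  cfm P (fun x => cutsum (fun u g v => B u g v x) w).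
Proof.
elim: w B => [|g w IH] B h /=; first exact: cfm_cst.
apply: cfmD; first exact: h.
by apply: IH => u k v wE; apply: h; rewrite wE.
Qed.

Lemma cexpect_cutsum A (w : seq A) (B : seq A -> A -> seq A -> T -> C) :
  (forall u g v, w = u ++ g :: v -> cfm P (B u g v)) ->
  cexpect P (fun x => cutsum (fun u g v => B u g v x) w) =
  cutsum (fun u g v => cexpect P (B u g v)) w.
Proof.
elim: w B => [|g w IH] B h /=; first exact: cexpect_cst.
have hB u k v : w = u ++ k :: v -> cfm P (B (g :: u) k v).
  by move=> wE; apply: h; rewrite wE.
rewrite cexpectD; [|exact: h|exact: (cfm_cutsum hB)].
by rewrite (IH _ hB).
Qed.

End CexpectCutsum.

Section HermitianGaussian.
Context {R : realType} {H : realHilbertType R} d {T : measurableType d}.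
Variables (P : probability T R) (N : nat) (X : H -> T -> 'M[R[i]]_N.+1).
Hypothesis hX : hermitian_gaussian P X.
Local Notation C := R[i].
Local Notation cE := (cexpect P).
Local Notation var := (H * ('I_N.+1 * 'I_N.+1))%type.
Implicit Types (f g : H) (w : seq H).

Let part (vb : var * bool) (x : T) : R :=
  if vb.2 then complex.Re (X vb.1.1 x vb.1.2.1 vb.1.2.2)
  else complex.Im (X vb.1.1 x vb.1.2.1 vb.1.2.2).

Let V (Z : T -> R) : Prop := exists n (c : 'I_n -> R) (j : 'I_n -> var * bool),
  Z = fun x => \sum_(k < n) c k * part (j k) x.

Let Vlin (Y Z : T -> R) t : V Y -> V Z -> V (fun x => Y x + t * Z x).
Proof.
move=> [m [b [i ->]]] [n [c [j ->]]]; exists (m + n)%N.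
exists (fun k => match fintype.split k with inl k => b k | inr k => t * c k end).
exists (fun k => match fintype.split k with inl k => i k | inr k => j k end).
apply/funext => x; rewrite big_split_ord /=; congr (_ + _).
  by apply: eq_bigr => k _; rewrite (unsplitK (inl k)).
rewrite mulr_sumr; apply: eq_bigr => k _.
by rewrite (unsplitK (inr k)) mulrA.
Qed.

Let Vgauss Z : V Z -> [/\ finite_moments P Z, Ex P Z = 0 &
  forall n, Ex P (fun x => Z x ^+ n.+2) =
  n.+1%:R * Ex P (fun x => Z x ^+ 2) * Ex P (fun x => Z x ^+ n)].
Proof.
move=> [n [c [j ZE]]]; have [mY gY] := hg_gaussian hX.
have mZ : measurable_fun [set: T] Z.
  by rewrite ZE; apply: measurable_sum => k; apply: measurable_funM => //; exact: mY.
have [sigma hs] := gY n c j.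
have ZP A : measurable A -> P (Z @^-1` A) = centered_normal sigma A.
  by move=> mA; rewrite ZE; exact: hs.
have [iZ [Z0 Zrec]] := gaussian_moments mZ ZP.
split; [by []|by rewrite ExE Z0|move=> k].
have var : (\int[P]_x (Z x ^+ 2)%:E)%E = (sigma ^+ 2)%:E.
  rewrite Zrec mul1r (_ : (fun x => (Z x ^+ 0)%:E) = fun=> 1%:E).
    by rewrite integral_cst//= probability_setT !mule1.
  by apply/funext => x; rewrite expr0.
rewrite !ExE var Zrec fineM//; exact: integrable_fin_num (iZ k).
Qed.

Let Vfm Z : V Z -> finite_moments P Z. Proof. by case/Vgauss. Qed.
Let V0 Z : V Z -> Ex P Z = 0. Proof. by case/Vgauss. Qed.
Let Vrec Z n : V Z -> Ex P (fun x => Z x ^+ n.+2) =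
  n.+1%:R * Ex P (fun x => Z x ^+ 2) * Ex P (fun x => Z x ^+ n).
Proof. by case/Vgauss. Qed.

Definition entry (v : var) (x : T) : C := X v.1 x v.2.1 v.2.2.

Let cV_entry v : cV V (entry v).
Proof.
have Vpart vb : V (part vb).
  by exists 1%N, (fun=> 1), (fun=> vb); apply/funext => x; rewrite big_ord1 mul1r.
by split; [exact: (Vpart (v, true))|exact: (Vpart (v, false))].
Qed.

Lemma cfm_entry v : cfm P (entry v).
Proof. exact: (@cV_cfm _ _ _ P V Vfm _ (cV_entry v)). Qed.

(** Below the diagonal, an entry is the conjugate of its mirror image, so that the
    covariances of the entries on and above it determine all the others. *)
Lemma entry_cov f g i j k l :
  cE (fun x => entry (f, (i, j)) x * entry (g, (k, l)) x) =
  ((i == l) && (j == k))%:R * (N.+1%:R^-1 * (ip f g)%:C%C).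
Proof.
have conjE h a b : entry (h, (a, b)) = fun x => (entry (h, (b, a)) x)^*.
  by apply/funext => x; rewrite /entry /= (hg_hermitian hX).
have cfmE a b c e : cfm P (fun x => entry (f, (a, b)) x * entry (g, (c, e)) x).
  by apply: cfmM; exact: cfm_entry.
have realc (c : bool) : (c%:R * (N.+1%:R^-1 * (ip f g)%:C%C))^* =
    c%:R * (N.+1%:R^-1 * (ip f g)%:C%C) :> C.
  rewrite !rmorphM fmorphV !rmorph_nat; congr (_ * (_ * _)).
  by apply/eqP; rewrite eq_complex /= oppr0 !eqxx.
have conjF a b c e :
    cE (fun x => (entry (f, (a, b)) x)^* * (entry (g, (c, e)) x)^*) =
    (cE (fun x => entry (f, (a, b)) x * entry (g, (c, e)) x))^*.
  rewrite -cexpect_conj//; congr (cexpect P); apply/funext => x.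
  by rewrite rmorphM.
have mulb (a b : bool) : (a && b)%:R = a%:R * b%:R :> C.
  by rewrite -natrM mulnb.
have [ij|ji] := leqP i j; have [lk|kl] := leqP l k.
- by rewrite (conjE g) (hg_cov hX)// mulb.
- move: ij; rewrite leq_eqVlt => /orP[/eqP/val_inj ij|ij].
    rewrite -{j}ij (conjE f).
    rewrite (_ : (fun x => _) = (fun x => (entry (f, (i, i)) x)^* *
      (entry (g, (l, k)) x)^*)); last first.
      by rewrite [entry (g, _)]conjE.
    rewrite conjF (conjE g) (hg_cov hX)//; last exact: ltnW.
    by rewrite -mulb realc andbC.
  rewrite (hg_cov0 hX)//; case: eqP => [il|] /=; last by rewrite mul0r.
  case: eqP => [jk|] /=; last by rewrite mul0r.
  by move: ij kl; rewrite il jk => h1 h2; have := ltn_trans h1 h2; rewrite ltnn.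
- move: lk; rewrite leq_eqVlt => /orP[/eqP/val_inj lk|lk].
    rewrite {l}lk (conjE f) (conjE g) conjF (conjE g) (hg_cov hX)//; last exact: ltnW.
    by rewrite -mulb realc andbC.
  rewrite (conjE f) (conjE g) conjF (hg_cov0 hX)// rmorph0.
  case: eqP => [il|] /=; last by rewrite mul0r.
  case: eqP => [jk|] /=; last by rewrite mul0r.
  by move: ji lk; rewrite il jk => h1 h2; have := ltn_trans h1 h2; rewrite ltnn.
- rewrite (conjE f) (_ : (fun x => _) = (fun x => (entry (f, (j, i)) x)^* *
      (entry (g, (l, k)) x)^*)); last by rewrite [entry (g, _)]conjE.
  rewrite conjF (conjE g) (hg_cov hX)//; try exact: ltnW.
  by rewrite -mulb realc andbC.
Qed.

(** The derivation, in the polynomials in the entries, that sends an entry to its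
    covariance with the entry [(a, b)] of [X f]; polynomials are given by lists of
    monomials. *)
Section Derivation.
Variables (f : H) (a b : 'I_N.+1).

Let cov (v : var) : C :=
  ((a == v.2.2) && (b == v.2.1))%:R * (N.+1%:R^-1 * (ip f v.1)%:C%C).

Let mon (s : seq var) (x : T) : C := \prod_(v <- s) entry v x.
Let dmon (s : seq var) (x : T) : C :=
  cutsum (fun u v t => cov v * mon (u ++ t) x) s.

Let mon_cat s t x : mon (s ++ t) x = mon s x * mon t x.
Proof. by rewrite /mon big_cat. Qed.

Let dmon_cat s t x : dmon (s ++ t) x = dmon s x * mon t x + mon s x * dmon t x.
Proof.
rewrite /dmon cutsum_cat; congr (_ + _).
  rewrite (cutsum_morph (f := fun y => y * mon t x)) ?mul0r//; last first.
    by move=> ? ?; rewrite mulrDl.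
  by apply: eq_cutsum => u v s' _; rewrite catA mon_cat mulrA.
rewrite (cutsum_morph (f := fun y => mon s x * y)) ?mulr0//; last first.
  by move=> ? ?; rewrite mulrDr.
by apply: eq_cutsum => u v s' _; rewrite -catA mon_cat mulrCA.
Qed.

(** [U'] is the value at [U] of the derivation. A function may have
    several expressions as a polynomial, hence the existential quantifier. *)
Definition derives (U U' : T -> C) : Prop := exists l : seq (C * seq var),
  (forall x, U x = \sum_(p <- l) p.1 * mon p.2 x) /\
  (forall x, U' x = \sum_(p <- l) p.1 * dmon p.2 x).

Let mon_map s : mon s = cprod (map entry s).
Proof. by apply/funext => x; rewrite /mon /cprod big_map. Qed.

Let allcV_map s : allcV V (map entry s).
Proof. by elim: s. Qed.

Let cfm_mon s : cfm P (mon s).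
Proof. by rewrite mon_map; exact: (@cfm_cprod _ _ _ P V Vfm _ (allcV_map s)). Qed.

(** Gaussian integration by parts, monomial by monomial. *)
Lemma derives_ibp U U' : derives U U' ->
  cE (fun x => entry (f, (a, b)) x * U x) = cE U'.
Proof.
move=> [l [UE U'E]].
have cfm_dmon s : cfm P (dmon s).
  by apply: cfm_cutsum => u v t _; exact: cfmZ.
have e s : cE (fun x => entry (f, (a, b)) x * mon s x) = cE (dmon s).
  rewrite (_ : (fun x => _) = cprod (entry (f, (a, b)) :: map entry s)); last first.
    by apply/funext => x; rewrite cprod_cons mon_map.
  rewrite (wick_complex Vlin Vfm V0 Vrec (cV_entry _) (allcV_map s)).
  rewrite cexpect_cutsum; last by move=> u v t _; exact: cfmZ.
  have cutmap (B : seq (T -> C) -> (T -> C) -> seq (T -> C) -> C) (t : seq var) :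
      cutsum B (map entry t) =
      cutsum (fun u z v => B (map entry u) (entry z) (map entry v)) t.
    by elim: t B => //= z t IH B; rewrite IH.
  rewrite cutmap; apply: eq_cutsum => u [g [i j]] t _.
  by rewrite entry_cov cexpectZ// -map_cat -mon_map.
rewrite (_ : (fun x => _) =
    fun x => \sum_(p <- l) p.1 * (entry (f, (a, b)) x * mon p.2 x)); last first.
  by apply/funext => x; rewrite UE mulr_sumr; apply: eq_bigr => p _; ring.
rewrite (_ : U' = fun x => \sum_(p <- l) p.1 * dmon p.2 x); last exact/funext.
have cfm1 (p : C * seq var) : cfm P (fun x => entry (f, (a, b)) x * mon p.2 x).
  by apply: cfmM => //; exact: cfm_entry.
rewrite !cexpect_sum; last 2 first.
- by move=> p; exact: cfmZ.
- by move=> p; exact: cfmZ.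
by apply: eq_bigr => p _; rewrite !cexpectZ// e.
Qed.

Lemma derives_cst c : derives (fun=> c) (fun=> 0).
Proof.
by exists [:: (c, [::])]; split => x; rewrite big_seq1 /=;
  rewrite ?/mon ?big_nil ?mulr1 ?mulr0.
Qed.

Lemma derives_entry g i j : derives (entry (g, (i, j)))
  (fun=> ((a == j) && (b == i))%:R * (N.+1%:R^-1 * (ip f g)%:C%C)).
Proof.
exists [:: (1, [:: (g, (i, j))])]; split => x; rewrite big_seq1 mul1r /=.
  by rewrite /mon big_seq1.
by rewrite /dmon /= addr0 /mon big_nil mulr1.
Qed.

Lemma derivesD U U' W W' : derives U U' -> derives W W' ->
  derives (fun x => U x + W x) (fun x => U' x + W' x).
Proof.
move=> [k [UE U'E]] [l [WE W'E]]; exists (k ++ l).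
by split => x; rewrite big_cat /= ?UE ?WE ?U'E ?W'E.
Qed.

Lemma derivesM U U' W W' : derives U U' -> derives W W' ->
  derives (fun x => U x * W x) (fun x => U' x * W x + U x * W' x).
Proof.
move=> [k [UE U'E]] [l [WE W'E]].
exists [seq (p.1 * q.1, p.2 ++ q.2) | p <- k, q <- l]; split => x.
  rewrite UE WE big_allpairs_dep mulr_suml; apply: eq_bigr => p _.
  by rewrite mulr_sumr; apply: eq_bigr => q _; rewrite mon_cat /=; ring.
rewrite UE WE U'E W'E big_allpairs_dep !mulr_suml -big_split; apply: eq_bigr => p _.
rewrite !mulr_sumr -big_split; apply: eq_bigr => q _ /=.
by rewrite dmon_cat; ring.
Qed.

Lemma derives_eq U U' W W' : derives U U' -> U =1 W -> U' =1 W' -> derives W W'.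
Proof. by move=> h /funext <- /funext <-. Qed.

Lemma derives_sum I (r : seq I) (U U' : I -> T -> C) :
  (forall i, derives (U i) (U' i)) ->
  derives (fun x => \sum_(i <- r) U i x) (fun x => \sum_(i <- r) U' i x).
Proof.
move=> h; elim: r => [|i r IH].
  by apply: (derives_eq (derives_cst 0)) => x; rewrite big_nil.
by apply: (derives_eq (derivesD (h i) IH)) => x; rewrite big_cons.
Qed.

Lemma derives_prod I (r : seq I) (U U' : I -> T -> C) :
  (forall i, derives (U i) (U' i)) ->
  derives (fun x => \prod_(i <- r) U i x)
    (fun x => cutsum (fun u i v => U' i x * \prod_(j <- u ++ v) U j x) r).
Proof.
move=> h; elim: r => [|i r IH].
  by apply: (derives_eq (derives_cst 1)) => x; rewrite ?big_nil.
apply: (derives_eq (derivesM (h i) IH)) => x; first by rewrite big_cons.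
rewrite /= (cutsum_morph (f := fun y => U i x * y)) ?mulr0//; last first.
  by move=> ? ?; rewrite mulrDr.
congr (_ + _); apply: eq_cutsum => u j v _.
by rewrite big_cons mulrCA.
Qed.

Local Notation XW w x := (\prod_(g <- w) X g x : 'M[C]_N.+1).

Lemma derives_word w i j : derives (fun x => XW w x i j)
  (fun x => cutsum (fun u g v => (N.+1%:R^-1 * (ip f g)%:C%C) *
      (XW u x i b * XW v x a j)) w).
Proof.
elim: w i j => [|g w IH] i j.
  by apply: (derives_eq (derives_cst ((i == j)%:R))) => x //; rewrite big_nil mxE.
have := derives_sum (index_enum 'I_N.+1) (fun k =>
  derivesM (derives_entry g i k) (IH k j)) => h.
apply: (derives_eq h) => x /=; first by rewrite big_cons mxE.
rewrite big_split /=; congr (_ + _).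
  rewrite (bigD1 a)//= [X in _ + X = _]big1 ?addr0; last first.
    by move=> k /negbTE ka; rewrite eq_sym ka /= !mul0r.
  by rewrite eqxx big_nil mxE eq_sym /=; case: eqP => _; ring.
rewrite (eq_bigr (fun k => cutsum (fun u h0 v => N.+1%:R^-1 * (ip f h0)%:C%C *
   (entry (g, (i, k)) x * XW u x k b * XW v x a j)) w)); last first.
  move=> k _; rewrite (cutsum_morph (f := fun y => entry (g, (i, k)) x * y)) ?mulr0//.
    by apply: eq_cutsum => u h0 v _; ring.
  by move=> ? ?; rewrite mulrDr.
rewrite sum_cutsum; apply: eq_cutsum => u h0 v _; rewrite -mulr_sumr; congr (_ * _).
by rewrite big_cons mxE mulr_suml.
Qed.

Lemma derives_trace w : derives (fun x => \tr (XW w x))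
  (fun x => cutsum (fun u g v => (N.+1%:R^-1 * (ip f g)%:C%C) * XW (v ++ u) x a b) w).
Proof.
apply: (derives_eq (derives_sum (index_enum 'I_N.+1) (fun i => derives_word w i i))) => x //=.
rewrite sum_cutsum; apply: eq_cutsum => u g v _; rewrite -mulr_sumr; congr (_ * _).
by rewrite big_cat /= mxE; apply: eq_bigr => k _; rewrite mulrC.
Qed.

End Derivation.

Local Notation XW w x := (\prod_(g <- w) X g x : 'M[C]_N.+1).

Definition trmoment (S : seq (seq H)) : C := cE (fun x => \prod_(w <- S) \tr (XW w x)).

Lemma cfm_word w i j : cfm P (fun x => XW w x i j).
Proof.
elim: w i j => [|g w IH] i j; first by under eq_fun do rewrite big_nil; exact: cfm_cst.
under eq_fun do rewrite big_cons mxE; apply: cfm_sum => k; apply: cfmM => //.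
exact: (cfm_entry (g, (i, k))).
Qed.

Lemma cfm_trace w : cfm P (fun x => \tr (XW w x)).
Proof. by apply: cfm_sum => i; exact: cfm_word. Qed.

Lemma trmoment_nil : trmoment [::] = 1.
Proof. by rewrite /trmoment; under eq_fun do rewrite big_nil; exact: cexpect_cst. Qed.

Lemma trmoment_empty S : trmoment ([::] :: S) = N.+1%:R * trmoment S.
Proof.
rewrite /trmoment -cexpectZ; last by apply: cfm_prod => w; exact: cfm_trace.
congr (cexpect P); apply/funext => x.
by rewrite big_cons big_nil mxtrace1.
Qed.

(** Integration by parts with respect to the entries of [X f]: contracting the first
    letter with a letter of its own word cuts the trace in two, and contracting it
    with a letter of another word merges the two traces. *)
Lemma trmoment_loop f w S : trmoment ((f :: w) :: S) =
  N.+1%:R^-1 *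
  (cutsum (fun u g v => (ip f g)%:C%C * trmoment (u :: v :: S)) w +
   delsum (fun w' S' => cutsum (fun u g v =>
      (ip f g)%:C%C * trmoment ((w ++ v ++ u) :: S')) w') S).
Proof.
pose c g : C := N.+1%:R^-1 * (ip f g)%:C%C.
have cfm_tr S' : cfm P (fun x => \prod_(w' <- S') \tr (XW w' x)).
  by apply: cfm_prod => w'; exact: cfm_trace.
pose U' a b x := cutsum (fun u g v => c g * (XW u x b b * XW v x a a)) w *
    \prod_(w' <- S) \tr (XW w' x) +
  XW w x b a * cutsum (fun S1 w' S2 =>
     cutsum (fun u g v => c g * XW (v ++ u) x a b) w' *
     \prod_(w0 <- S1 ++ S2) \tr (XW w0 x)) S.
have hU a b : derives f a b (fun x => XW w x b a * \prod_(w' <- S) \tr (XW w' x)) (U' a b).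
  apply: derivesM; first exact: derives_word.
  by apply: derives_prod => w'; exact: derives_trace.
have -> : trmoment ((f :: w) :: S) = \sum_a \sum_b cE (U' a b).
  rewrite /trmoment.
  rewrite (_ : (fun x => _) = fun x => \sum_a \sum_b entry (f, (a, b)) x *
      (XW w x b a * \prod_(w' <- S) \tr (XW w' x))); last first.
    apply/funext => x; rewrite big_cons big_cons mulr_suml; apply: eq_bigr => a _.
    by rewrite mxE mulr_suml; apply: eq_bigr => b _; rewrite mulrA.
  have cfm1 a b : cfm P (fun x => entry (f, (a, b)) x *
      (XW w x b a * \prod_(w' <- S) \tr (XW w' x))).
    apply: cfmM; first exact: cfm_entry.
    by apply: cfmM; [exact: cfm_word|exact: cfm_tr].
  rewrite cexpect_sum; last by move=> a; apply: cfm_sum.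
  apply: eq_bigr => a _; rewrite cexpect_sum//; apply: eq_bigr => b _.
  exact: derives_ibp (hU a b).
have cfmU a b : cfm P (U' a b).
  apply: cfmD.
    apply: cfmM; last exact: cfm_tr.
    by apply: cfm_cutsum => u g v _; apply: cfmZ; apply: cfmM; exact: cfm_word.
  apply: cfmM; first exact: cfm_word.
  apply: cfm_cutsum => S1 w' S2 _; apply: cfmM; last exact: cfm_tr.
  by apply: cfm_cutsum => u g v _; apply: cfmZ; exact: cfm_word.
transitivity (cE (fun x => \sum_a \sum_b U' a b x)).
  rewrite cexpect_sum; last by move=> a; exact: cfm_sum.
  by apply: eq_bigr => a _; rewrite cexpect_sum.
have cutMr A (B : seq A -> A -> seq A -> C) s y :
    cutsum B s * y = cutsum (fun p h q => B p h q * y) s.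
  rewrite (cutsum_morph (f := fun z => z * y)) ?mul0r//.
  by move=> ? ?; rewrite mulrDl.
have cutMl A (B : seq A -> A -> seq A -> C) s y :
    y * cutsum B s = cutsum (fun p h q => y * B p h q) s.
  rewrite (cutsum_morph (f := fun z => y * z)) ?mulr0//.
  by move=> ? ?; rewrite mulrDr.
rewrite (_ : (fun x => _) = fun x =>
    cutsum (fun u g v => c g * \prod_(w' <- u :: v :: S) \tr (XW w' x)) w +
    cutsum (fun S1 w' S2 => cutsum (fun u g v =>
      c g * \prod_(w0 <- (w ++ v ++ u) :: S1 ++ S2) \tr (XW w0 x)) w') S);
  last first.
  apply/funext => x; rewrite /U'.
  under [LHS]eq_bigr do rewrite big_split /=; rewrite big_split /=; congr (_ + _).
    under [LHS]eq_bigr do under eq_bigr do rewrite cutMr.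
    under [LHS]eq_bigr do rewrite sum_cutsum.
    rewrite sum_cutsum; apply: eq_cutsum => u g v _.
    rewrite !big_cons /mxtrace; set Q := \prod_(w' <- S) _.
    rewrite (eq_bigr (fun a => XW v x a a * (c g * (\sum_b XW u x b b) * Q))).
      by rewrite -mulr_suml; ring.
    move=> a _; rewrite mulr_sumr mulr_suml mulr_sumr; apply: eq_bigr => b _.
    by ring.
  under [LHS]eq_bigr do under eq_bigr do rewrite cutMl.
  under [LHS]eq_bigr do rewrite sum_cutsum.
  rewrite sum_cutsum; apply: eq_cutsum => S1 w' S2 _.
  set Q := \prod_(w0 <- S1 ++ S2) _.
  rewrite (eq_bigr (fun k => cutsum (fun u g v => \sum_k0
    XW w x k0 k * (c g * XW (v ++ u) x k k0 * Q)) w')); last first.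
    move=> k _; rewrite -sum_cutsum; apply: eq_bigr => k0 _.
    by rewrite cutMr cutMl.
  rewrite sum_cutsum; apply: eq_cutsum => u g v _.
  rewrite !big_cons -/Q (_ : \prod_(g0 <- w ++ v ++ u) X g0 x =
    XW w x *m XW (v ++ u) x); last by rewrite big_cat.
  rewrite /mxtrace mulr_suml mulr_sumr [LHS]exchange_big; apply: eq_bigr => b _.
  rewrite mxE mulr_suml mulr_sumr; apply: eq_bigr => a _ /=.
  by ring.
have cfmc g S' : cfm P (fun x => c g * \prod_(w' <- S') \tr (XW w' x)).
  exact: cfmZ.
rewrite cexpectD; last 2 first.
- by apply: cfm_cutsum => u g v _; exact: cfmc.
- by apply: cfm_cutsum => S1 w' S2 _; apply: cfm_cutsum => u g v _; exact: cfmc.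
rewrite mulrDr cexpect_cutsum; last by move=> u g v _; exact: cfmc.
congr (_ + _).
  by rewrite cutMl; apply: eq_cutsum => u g v _; rewrite cexpectZ// mulrA.
rewrite cexpect_cutsum; last first.
  by move=> S1 w' S2 _; apply: cfm_cutsum => u g v _; exact: cfmc.
rewrite /delsum cutMl; apply: eq_cutsum => S1 w' S2 _.
rewrite cexpect_cutsum; last by move=> u g v _; exact: cfmc.
by rewrite cutMl; apply: eq_cutsum => u g v _; rewrite cexpectZ// mulrA.
Qed.

End HermitianGaussian.

(** * Words applied to the vacuum *)

Section WordOnVacuum.
Context {R : realType} {H : realHilbertType R}.
Local Notation C := R[i].
Local Notation word := (seq H).
Implicit Types (f g h k : H) (s t u v w a b : word) (F G : word -> C).
Local Notation ipc f g := ((ip f g)%:C%C : C).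

(** Precomposition of a linear functional, given by its values [F] on tensors of
    real vectors, with [omega h]. *)
Definition step h F t : C :=
  F (h :: t) + (if t is k :: t' then ipc k h * F t' else 0).

(** The value at [omega(w) Omega] of the linear functional with the values [F] on
    tensors. Only these values enter, so that [F] can be any function. *)
Fixpoint ev F w : C := if w is h :: w' then ev (step h F) w' else F [::].

Lemma eq_ev F G w : F =1 G -> ev F w = ev G w.
Proof. by move=> /funext ->. Qed.

Lemma evD F G w : ev (fun t => F t + G t) w = ev F w + ev G w.
Proof.
elim: w F G => //= h w IH F G; rewrite -IH; apply: eq_ev => t.
by rewrite /step; case: t => [|k t]; rewrite ?addr0 // mulrDr addrACA.
Qed.

Lemma evZ c F w : ev (fun t => c * F t) w = c * ev F w.
Proof.
elim: w F => //= h w IH F; rewrite -IH; apply: eq_ev => t.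
by rewrite /step; case: t => [|k t]; ring.
Qed.

Lemma ev0 w : ev (fun=> 0) w = 0.
Proof. by rewrite (eq_ev (G := fun t => 0 * 0)) ?evZ ?mul0r// => t; rewrite mul0r. Qed.

Lemma evMr c F w : ev (fun t => F t * c) w = ev F w * c.
Proof. by rewrite mulrC -evZ; apply: eq_ev => t; rewrite mulrC. Qed.

Lemma ev_exchange (B : word -> word -> C) u v :
  ev (fun s => ev (B s) v) u = ev (fun t => ev (B^~ t) u) v.
Proof.
elim: u B => [|h u IH] B //=.
rewrite -(IH (fun s t => step h (B^~ t) s)); apply: eq_ev => s.
rewrite /step; case: s => [|k s]; first by rewrite addr0; apply: eq_ev => t; rewrite addr0.
by rewrite evD evZ.
Qed.

Lemma ev_cutsum A (B : seq A -> A -> seq A -> word -> C) (l : seq A) w :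
  ev (fun t => cutsum (fun p x q => B p x q t) l) w =
  cutsum (fun p x q => ev (B p x q) w) l.
Proof. by elim: l B => [|x l IH] B /=; rewrite ?ev0// evD IH. Qed.

(** The free difference quotient [\partial_f], on products of [omega]'s on the left
    and on tensors on the right. *)
Lemma ev_difference_quotient f (B : word -> word -> C) w :
  cutsum (fun u g v => ipc g f * ev (fun s => ev (B s) v) u) w =
  ev (fun t => cutsum (fun a g b => ipc g f * B a b) t) w.
Proof.
elim: w B => [|h w IH] B //=.
pose B' s t : C := B (h :: s) t + (if s is k :: s' then ipc k h * B s' t else 0).
rewrite (eq_cutsum (B' := fun u g v => ipc g f * ev (fun s => ev (B' s) v) u));
  last first.
  move=> u g v _; congr (_ * _); apply: eq_ev => s; rewrite /step /B'.
  case: s => [|k s]; first by rewrite addr0; apply: eq_ev => t; rewrite addr0.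
  by rewrite evD evZ.
rewrite IH -evZ -evD; apply: eq_ev => t; rewrite /step /= -addrA; congr (_ + _).
rewrite (eq_cutsum (B' := fun a g b => ipc g f * B (h :: a) b +
  ipc g f * (if a is k :: s' then ipc k h * B s' b else 0))); last first.
  by move=> a g b _; rewrite mulrDr.
rewrite cutsumD; congr (_ + _); case: t => [|k t] //=.
rewrite mulr0 add0r (cutsum_morph (f := *%R (ipc k h))) ?mulr0//; last first.
  by move=> ? ?; rewrite mulrDr.
by apply: eq_cutsum => a g b _; rewrite mulrCA.
Qed.

(** The product of the algebra, transported to tensors; the first factor is
    given in reverse, its last letter being contracted first. *)
Fixpoint tensmul F (rb a : word) : C :=
  F (catrev rb a) + (if rb is h :: rb' then
    (if a is k :: a' then ipc h k * tensmul F rb' a' else 0) else 0).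

Lemma tensmul_step h F a :
  tensmul (step h F) [::] a = tensmul F [:: h] a.
Proof.
by case: a => [|k a]; rewrite /= /step /= ?addr0 // (ipC k).
Qed.

Lemma tensmul_step_rcons h F r l a : tensmul (step h F) (rcons r l) a =
  tensmul F (rcons (rcons r l) h) a + ipc l h * tensmul F r a.
Proof.
elim: r a => [|x r IH] a.
  case: a => [|y a] /=; first by rewrite /step /= !addr0.
  rewrite !addr0 /step /=.
  case: a => [|z a]; rewrite /= ?addr0.
    by ring.
  by rewrite (ipC z); ring.
have -> : tensmul (step h F) (rcons (x :: r) l) a =
  step h F (catrev (rcons (x :: r) l) a) +
  (if a is k :: a' then ipc x k * tensmul (step h F) (rcons r l) a' else 0) by [].
have -> : tensmul F (rcons (rcons (x :: r) l) h) a =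
  F (catrev (rcons (rcons (x :: r) l) h) a) +
  (if a is k :: a' then ipc x k * tensmul F (rcons (rcons r l) h) a' else 0) by [].
have -> : tensmul F (x :: r) a = F (catrev (x :: r) a) +
  (if a is k :: a' then ipc x k * tensmul F r a' else 0) by [].
have cr s k c : catrev (rcons s k) c = k :: catrev s c.
  by rewrite !catrevE rev_rcons.
by rewrite !cr /step; case: a => [|y a]; rewrite ?IH; ring.
Qed.

Lemma ev_cat F v u :
  ev F (v ++ u) = ev (fun b => ev (fun a => tensmul F (rev b) a) u) v.
Proof.
elim: v F => [|h v IH] F /=.
  by apply: eq_ev => a; rewrite addr0.
rewrite IH; apply: eq_ev => b; rewrite {2}/step.
case: b => [|k b].
  by rewrite addr0; apply: eq_ev => a; exact: tensmul_step.
rewrite -evZ -evD; apply: eq_ev => a.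
by rewrite !rev_cons tensmul_step_rcons.
Qed.

Definition dvac t : C := (nilp t)%:R.

(** The vacuum expectation of a word. *)
Definition phiw w : C := ev dvac w.

(** Annihilation of the first vector of [omega(w) Omega] is the difference quotient
    followed by the vacuum expectation of the left factor. *)
Lemma ev_left f G w :
  ev (fun t => if t is k :: t' then ipc k f * G t' else 0) w =
  cutsum (fun u g v => ipc g f * (phiw u * ev G v)) w.
Proof.
rewrite (eq_cutsum (B' := fun u g v =>
   ipc g f * ev (fun s => ev (fun t => dvac s * G t) v) u)); last first.
  move=> u g v _; congr (_ * _); rewrite -evMr; apply: eq_ev => s.
  by rewrite evZ.
rewrite ev_difference_quotient; apply: eq_ev => -[|k t] //=.
by rewrite mul1r cutsum0 ?addr0// => a g b; rewrite mul0r mulr0.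
Qed.

(** The mirror image of [ev_left], for a functional that contracts the last vector. *)
Lemma ev_right f G E w : (forall t k, E (rcons t k) = ipc k f * G t) ->
  E [::] = 0 ->
  ev E w = cutsum (fun u g v => ipc g f * (ev G u * phiw v)) w.
Proof.
move=> Er E0.
rewrite (eq_cutsum (B' := fun u g v =>
   ipc g f * ev (fun s => ev (fun t => G s * dvac t) v) u)); last first.
  move=> u g v _; congr (_ * _); rewrite -evMr; apply: eq_ev => s.
  by rewrite evZ.
rewrite ev_difference_quotient; apply: eq_ev => t; case/lastP: t => [|t k] //=.
rewrite Er -cats1 cutsum_cat /= cats0 mulr1 addr0 cutsum0 ?add0r// => a g b.
by rewrite /dvac /nilp size_cat addn1 mulr0 mulr0.
Qed.

Lemma phiw_cons f w :
  phiw (f :: w) = cutsum (fun u g v => ipc f g * (phiw u * phiw v)) w.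
Proof.
rewrite (eq_cutsum (B' := fun u g v => ipc g f * (phiw u * phiw v))); last first.
  by move=> u g v _; rewrite ipC.
rewrite /phiw /= -(ev_left f dvac); apply: eq_ev => t.
by rewrite /step {1}/dvac /= add0r.
Qed.

Lemma phiw_rcons f w : phiw (rcons w f) = phiw (f :: w).
Proof.
rewrite phiw_cons /phiw -cats1 ev_cat /= (ev_right (f := f) (G := dvac)).
- by apply: eq_cutsum => u g v _; rewrite ipC.
- move=> t k; rewrite rev_rcons /= /step /= addr0.
  have -> : tensmul dvac (rev t) [::] = dvac t.
    by rewrite -{2}(revK t); case: (rev t) => [|? ?] /=; rewrite addr0.
  by rewrite {1}/dvac catrevE /nilp size_cat addnS add0r.
- by rewrite /= /step /= !addr0.
Qed.

Lemma phiw_catC v u : phiw (v ++ u) = phiw (u ++ v).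
Proof.
elim: v u => [|f v IH] u; first by rewrite cats0.
by rewrite cat_cons -phiw_rcons rcons_cat IH cat_rcons.
Qed.

(** * The kernel of the covariance *)

Local Notation ofreals := (map (@ofreal R H)).

Lemma cip_ofreal f g : cip (ofreal f) (ofreal g) = ipc f g.
Proof.
have ip0r (x : H) : ip x 0 = 0 by rewrite ipC ip0l.
by rewrite /cip /= !ip0l ip0r subrr !addr0.
Qed.

Lemma conj_ofreal f : cplxn_conj (ofreal f) = ofreal f.
Proof. by rewrite /cplxn_conj /= oppr0. Qed.

Definition wipw s t : C := wip (ofreals s) (ofreals t).

Lemma wipw_cons f g s t : wipw (f :: s) (g :: t) = ipc f g * wipw s t.
Proof. by rewrite /wipw /= cip_ofreal. Qed.

(** A rotation is given by the letter that it brings to the front. *)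
Lemma sum_rot (W : nmodType) (F : word -> W) t :
  \sum_(k < size t) F (rot k t) = cutsum (fun a g b => F (g :: b ++ a)) t.
Proof.
have gen c : \sum_(k < size t) F (rot k (t ++ c)) =
    cutsum (fun a g b => F (g :: b ++ c ++ a)) t.
  elim: t c => [|g t IH] c; first by rewrite big_ord0.
  rewrite big_ord_recl /= rot0 cats0; congr (_ + _).
  have := IH (rcons c g); rewrite [RHS](_ : _ =
      cutsum (fun a h b => F (h :: b ++ c ++ g :: a)) t); last first.
    by apply: eq_cutsum => a h b _; rewrite cat_rcons.
  move=> <-; apply: eq_bigr => k _; congr F; rewrite /bump leq0n add1n.
  rewrite -[k.+1]addn1 rotD ?rot1_cons ?rcons_cat//=.
  by rewrite addn1 ltnS size_cat (leq_trans (ltnW (ltn_ord k)))// leq_addr.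
by have := gen [::]; rewrite cats0.
Qed.

Lemma cwip_cons f s t : cwip (ofreals (f :: s)) (ofreals t) =
  cutsum (fun a g b => ipc f g * wipw s (b ++ a)) t.
Proof.
rewrite /cwip size_map (eq_bigr (fun k : 'I__ => wipw (f :: s) (rot k t))).
  by rewrite sum_rot; apply: eq_cutsum => a g b _; rewrite wipw_cons.
by move=> k _; rewrite /wipw map_rot.
Qed.

Lemma cyc_ip0r (x : Fcyc H) : cyc_ip x 0 = 0.
Proof.
have z : cyc_ip (0 : Fcyc H) x = 0.
  by have := cyc_ip_linearl x (-1) 0 0; rewrite scaler0 addr0 mulN1r addNr.
by rewrite cyc_ipC z rmorph0.
Qed.

Lemma cyc_ip_linearr (x : Fcyc H) c y z :
  cyc_ip x (c *: y + z) = c^* * cyc_ip x y + cyc_ip x z.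
Proof. by rewrite cyc_ipC cyc_ip_linearl rmorphD rmorphM /= -!cyc_ipC. Qed.

Lemma conj_real (r : R) : (r%:C%C : C)^* = r%:C%C.
Proof. by apply/eqP; rewrite eq_complex /= oppr0 !eqxx. Qed.

(** Pairing a circular tensor that starts with [f] with [cword t] is the cyclic
    derivative in the direction [f] of the element with the vector [t]. *)
Lemma cyc_ip_cword f s t : cyc_ip (ctens (ofreals (f :: s))) (cword (ofreals t)) =
  cutsum (fun a g b => ipc f g * tensmul (wipw s) (rev b) a) t.
Proof.
have [n] := ubnP (size t); elim: n t => // n IH t tn.
case: t tn => [|h t] tn; first by rewrite /cword /= cyc_ip0r.
case/lastP: t tn => [|u k] tn.
  rewrite /cword /= cyc_ip_ctens (cwip_cons f s [:: h]) /=.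
  by rewrite !addr0.
rewrite (map_cons _ h) map_rcons cword_rcons -map_rcons -(map_cons (@ofreal R H) h).
rewrite [ctens _ + _]addrC cyc_ip_linearr (IH u); last first.
  by move: tn; rewrite /= size_rcons; lia.
rewrite conj_ofreal cip_ofreal conj_real cyc_ip_ctens cwip_cons [LHS]addrC.
rewrite [RHS](eq_cutsum (B' := fun a g b => ipc f g * wipw s (b ++ a) +
  ipc f g * (if rev b is x :: rb' then
    (if a is y :: a' then ipc x y * tensmul (wipw s) rb' a' else 0) else 0)));
  last first.
  move=> a g b _; rewrite -mulrDr; congr (_ * _).
  have -> : b ++ a = catrev (rev b) a by rewrite catrevE revK.
  by case: (rev b).
rewrite cutsumD; congr (_ + _) => /=.
rewrite (_ : ipc f h * _ = 0) ?add0r; last first.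
  by rewrite rev_rcons mulr0.
rewrite -cats1 cutsum_cat /= mulr0 addr0.
rewrite addr0 (cutsum_morph (f := *%R (ipc h k))) ?mulr0//; last first.
  by move=> ? ?; rewrite mulrDr.
apply: eq_cutsum => a g b _.
by rewrite cats1 rev_rcons (ipC k) mulrCA.
Qed.

(** The covariance of two words; the adjoint of the second one is its reverse. *)
Definition rhow w1 w2 : C := ev (fun s => ev (fun t =>
  cyc_ip (cword (ofreals s)) (cword (ofreals t))) (rev w2)) w1.

Lemma rhow_nil w : rhow [::] w = 0.
Proof.
rewrite /rhow /= -[RHS](ev0 (rev w)); apply: eq_ev => t.
by rewrite /cword /= cyc_ipC cyc_ip0r rmorph0.
Qed.

Lemma cutsum_rev (W : nmodType) (B : word -> H -> word -> W) w :
  cutsum B (rev w) = cutsum (fun u g v => B (rev v) g (rev u)) w.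
Proof.
elim: w B => [|g w IH] B //=; rewrite rev_cons -cats1 cutsum_cat /= addr0 cats0.
rewrite IH addrC; congr (_ + _); apply: eq_cutsum => u h v _.
by rewrite rev_cons cats1.
Qed.

End WordOnVacuum.

Section WordAlgebra.
Context {R : realType} {H : realHilbertType R}.
Local Notation C := R[i].
Local Notation word := (seq H).
Implicit Types (f g h k : H) (s t u v w a b : word).
Local Notation ipc f g := ((ip f g)%:C%C : C).
Local Notation ofreals := (map (@ofreal R H)).

Lemma ev_wipw w1 w2 :
  ev (fun s => ev (fun t => wipw s t) w2) w1 = phiw (rev w2 ++ w1).
Proof.
elim: w2 w1 => [|h w2 IH] w1.
  by apply: eq_ev => -[|k s].
rewrite rev_cons cat_rcons -IH /=.
rewrite [RHS](_ : _ = ev (fun s => ev (fun t => step h (fun s => wipw s t) s) w2) w1);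
  last first.
  apply: eq_ev => s; rewrite /step; case: s => [|k s].
    by rewrite addr0; apply: eq_ev => t; rewrite addr0.
  by rewrite evD evZ.
apply: eq_ev => s; apply: eq_ev => t; rewrite /step.
case: s => [|k s]; case: t => [|l t]; rewrite ?wipw_cons /wipw /=;
  rewrite ?addr0 ?add0r ?mulr0 ?addr0 // ?cip_ofreal ?mulr1 ?mulr0 //.
- by rewrite (ipC l).
- by rewrite (ipC l) addrC.
Qed.

(** The vector [f (x) s] is mapped by [c] to a circular tensor, paired with the second
    word by the cyclic derivative ([cyc_ip_cword]), and to a contraction of [f] with the
    last letter of [s]; the annihilation part of [omega f] contracts the first letter.
    The two contractions are the mirror images [ev_right] and [ev_left]. *)
Lemma rhow_cons f w1 w2 : rhow (f :: w1) w2 =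
  cutsum (fun u g v => ipc f g * (rhow u w2 * phiw v + phiw u * rhow v w2)) w1 +
  cutsum (fun u g v => ipc f g * phiw (w1 ++ v ++ u)) w2.
Proof.
pose B s t : C := cyc_ip (cword (ofreals s)) (cword (ofreals t)).
pose G s := ev (B s) (rev w2).
pose E s t := cutsum (fun a g b => ipc f g * tensmul (wipw s) (rev b) a) t.
pose G2 s := if s is x :: s' then ipc f (last x s') * G (belast x s') else 0.
pose G1 s := if s is x :: s' then ipc x f * G s' else 0.
have Gcons s : G (f :: s) = ev (E s) (rev w2) + G2 s.
  have Bcons t : B (f :: s) t = E s t +
      (if s is x :: s' then ipc f (last x s') * B (belast x s') t else 0).
    rewrite /B /E -cyc_ip_cword; case/lastP: s => [|s x].
      by rewrite addr0.
    rewrite (map_cons _ f) map_rcons cword_rcons -map_rcons -(map_cons (@ofreal R H) f).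
    rewrite [ctens _ + _]addrC cyc_ip_linearl conj_ofreal cip_ofreal [LHS]addrC.
    congr (_ + _).
    by case: s => //= y s; rewrite last_rcons belast_rcons.
  rewrite /G /G2 (eq_ev _ Bcons).
  by rewrite evD; case: s {Bcons} => [|x s]; rewrite ?ev0// evZ.
rewrite /rhow /= -/B (eq_ev (G := fun s => ev (E s) (rev w2) + G2 s + G1 s));
  last by move=> s; rewrite {1}/step -Gcons.
rewrite !evD.
have -> : ev G2 w1 = cutsum (fun u g v => ipc f g * (rhow u w2 * phiw v)) w1.
  rewrite (@ev_right _ _ f G) => [|t k|//].
    by apply: eq_cutsum => u g v _; rewrite (ipC g).
  by case: t => [|x t]; rewrite /G2 /= ?last_rcons ?belast_rcons (ipC k).
have -> : ev G1 w1 = cutsum (fun u g v => ipc f g * (phiw u * rhow v w2)) w1.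
  by rewrite (@ev_left _ _ f G); apply: eq_cutsum => u g v _; rewrite (ipC g).
rewrite -addrA -cutsumD addrC; congr (_ + _).
  by apply: eq_cutsum => u g v _; rewrite mulrDr.
rewrite (eq_ev (G := fun s => cutsum (fun u g v => ipc f g * ev (wipw s) (v ++ u)) (rev w2)));
  last first.
  move=> s; rewrite /E.
  rewrite (eq_ev (G := fun t => cutsum (fun a g b => ipc g f *
     tensmul (wipw s) (rev b) a) t)); last first.
    by move=> t; apply: eq_cutsum => a g b _; rewrite ipC.
  rewrite -(ev_difference_quotient f (fun a b => tensmul (wipw s) (rev b) a)).
  apply: eq_cutsum => u g v _; rewrite (ipC g) ev_cat.
  by rewrite (ev_exchange (fun a b => tensmul (wipw s) (rev b) a)).
rewrite ev_cutsum cutsum_rev; apply: eq_cutsum => u g v _.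
by rewrite evZ (ev_wipw w1) rev_cat !revK phiw_catC.
Qed.

Definition vecw w : Flin H := foldr (@omega0 R H) (vac H) w.

Lemma omega0_tens h t : omega0 h (tens (ofreals t)) =
  tens (ofreals (h :: t)) +
  (if t is k :: t' then ipc k h *: tens (ofreals t') else 0).
Proof.
rewrite /omega0 lcre_tens; case: t => [|k t] /=; first by rewrite lann_vac.
by rewrite lann_tens cip_ofreal.
Qed.

Lemma ev_vecw (L : Flin H -> C) w : {morph L : x y / x + y} ->
  (forall (r : R) x, L (r%:C%C *: x) = r%:C%C * L x) ->
  L (vecw w) = ev (fun t => L (tens (ofreals t))) w.
Proof.
elim: w L => [|h w IH] L LD LZ //=.
rewrite (IH (fun x => L (omega0 h x))).
- apply: eq_ev => t; rewrite omega0_tens LD /step; congr (_ + _).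
  case: t => [|k t]; last exact: LZ.
  by have := LZ 0 0; rewrite scaler0 mul0r.
- by move=> x y; rewrite (linD (omega0_linear h)) LD.
- by move=> r x; rewrite (linZ (omega0_linear h)) LZ.
Qed.

Definition omegaw w : omega_alg H := \prod_(f <- w) omega f.

Lemma op_omegaw w x : op (omegaw w) x = foldr (@omega0 R H) x w.
Proof.
rewrite /omegaw; elim: w => [|f w IH]; first by rewrite big_nil.
by rewrite big_cons /= -IH.
Qed.

Lemma adj_omegaw w x : adj (omegaw w) x = foldr (@omega0 R H) x (rev w).
Proof.
rewrite /omegaw; elim: w x => [|f w IH] x; first by rewrite big_nil.
rewrite big_cons rev_cons -cats1 foldr_cat /= -IH.
by [].
Qed.

Lemma phi_omegaw w : phi (omegaw w) = phiw w.
Proof.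
rewrite /phi op_omegaw -/(vecw w) (ev_vecw (L := fun x => fock_ip x (vac H))).
- by apply: eq_ev => t; rewrite fock_ip_tens; case: t.
- by move=> x y; exact: fock_ipDl.
- by move=> r x; exact: fock_ipZl.
Qed.

Lemma rho_omegaw w1 w2 : rho (omegaw w1) (omegaw w2) = rhow w1 w2.
Proof.
rewrite /rho /= op_omegaw.
have -> : op (omega_star (omegaw w2)) (vac H) = vecw (rev w2).
  by rewrite -[LHS]/(adj (omegaw w2) (vac H)) adj_omegaw.
have cD : {morph @cmap R H : x y / x + y}.
  by move=> x y; have := cmap_linear 1 x y; rewrite !scale1r.
have c0 : cmap (0 : Flin H) = 0 by apply: (addrI (cmap 0)); rewrite -cD !addr0.
have cZ r x : cmap (r *: x : Flin H) = r *: cmap x.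
  by have := cmap_linear r x 0; rewrite c0 !addr0.
have ip0l z : cyc_ip 0 z = 0 :> C by rewrite cyc_ipC cyc_ip0r rmorph0.
rewrite -/(vecw w1) (ev_vecw (L := fun x => cyc_ip (cmap x) _)).
- rewrite /rhow; apply: eq_ev => s.
  rewrite (ev_vecw (L := fun x => cyc_ip _ (cmap x))).
  + by apply: eq_ev => t; rewrite !cmap_tens.
  + move=> x y; rewrite cD -[cmap x]scale1r cyc_ip_linearr rmorph1 mul1r.
    by rewrite scale1r.
  + move=> r x; rewrite cZ -[_ *: _]addr0 cyc_ip_linearr cyc_ip0r addr0.
    by rewrite conj_real.
- move=> x y; rewrite cD -[cmap x]scale1r cyc_ip_linearl mul1r.
  by rewrite scale1r.
- by move=> r x; rewrite cZ -[_ *: _]addr0 cyc_ip_linearl ip0l addr0.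
Qed.

End WordAlgebra.

(** * The large N limit *)

Section LargeN.
Context {R : realType} {H : realHilbertType R}.
Local Notation C := R[i].
Local Notation word := (seq H).
Local Notation ipc f g := ((ip f g)%:C%C : C).
Local Notation tendsto u l := (((u) : nat -> C^o) @ \oo --> ((l) : C^o)).
Implicit Types (u v w : word) (S : seq word).

Definition bdd (x : nat -> C) : Prop := exists B : C, forall n, `|x n| <= B.

Lemma bdd_cst c : bdd (fun=> c). Proof. by exists `|c|. Qed.

Lemma bddD x y : bdd x -> bdd y -> bdd (fun n => x n + y n).
Proof.
move=> [A hA] [B hB]; exists (A + B) => n.
by apply: le_trans (ler_normD _ _) _; exact: lerD.
Qed.

Lemma bddM x y : bdd x -> bdd y -> bdd (fun n => x n * y n).
Proof.
by move=> [A hA] [B hB]; exists (A * B) => n; rewrite normrM ler_pM.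
Qed.

Lemma bdd_cutsum A (B : nat -> seq A -> A -> seq A -> C) s :
  (forall p x q, s = p ++ x :: q -> bdd (fun n => B n p x q)) ->
  bdd (fun n => cutsum (B n) s).
Proof.
elim: s B => [|x s IH] B h /=; first exact: bdd_cst.
apply: bddD; first exact: h.
by apply: (IH (fun n p => B n (x :: p))) => p y q sE; apply: h; rewrite sE.
Qed.

Lemma bdd_conv (F G : nat -> seq word -> C) S :
  (forall a b, perm_eq (a ++ b) S -> bdd (fun n => F n a) /\ bdd (fun n => G n b)) ->
  bdd (fun n => conv (F n) (G n) S).
Proof.
elim: S F G => [|x S IH] F G h /=.
  by have [] := h [::] [::] isT; exact: bddM.
apply: bddD.
  apply: (IH (fun n a => F n (x :: a)) G) => a b ab.
  by apply: h; rewrite cat_cons perm_cons.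
apply: (IH F (fun n b => G n (x :: b))) => a b ab.
by apply: h; rewrite perm_catC cat_cons perm_cons perm_catC.
Qed.

Lemma tendsto_cutsum A (B : nat -> seq A -> A -> seq A -> C) L s :
  (forall p x q, s = p ++ x :: q -> tendsto (fun n => B n p x q) (L p x q)) ->
  tendsto (fun n => cutsum (B n) s) (cutsum L s).
Proof.
elim: s B L => [|x s IH] B L h /=; first exact: cvg_cst.
apply: (@cvgD _ _ _ _ _ (fun n => B n [::] x s : C^o)); first exact: h.
by apply: (IH (fun n p => B n (x :: p))) => p y q sE; apply: h; rewrite sE.
Qed.

Lemma tendsto_inv : tendsto (fun n => n.+1%:R^-1) 0.
Proof.
apply/cvgr0Pnorm_le => e e0.
have [k hk] : exists k : nat, e^-1 <= k%:R.
  case: e e0 => a b; rewrite ltcE /= => /andP[/eqP -> a0].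
  have [k hk] : exists k : nat, a^-1 <= k%:R.
    by exists (Num.bound a^-1); apply/ltW/archi_boundP; rewrite invr_ge0 ltW.
  exists k; rewrite (_ : (a +i* 0)%C^-1 = (a^-1)%:C%C); last first.
    by rewrite -[(a +i* 0)%C]/(a%:C%C) fmorphV.
  by rewrite -(rmorph_nat (real_complex R)) lecR.
exists k => // n /= kn; rewrite normfV normr_nat invf_ple ?posrE// ?ltr0n//.
by apply: le_trans hk _; rewrite ler_nat (leq_trans kn).
Qed.

Lemma tendsto_bdd0 x y : tendsto x 0 -> bdd y -> tendsto (fun n => x n * y n) 0.
Proof.
move=> x0 [B hB]; have B0 : 0 <= B by apply: le_trans (hB 0%N).
have B1 : 0 < B + 1 by rewrite ltr_wpDl.
apply/cvgr0Pnorm_le => e e0; move/cvgr0Pnorm_le: x0 => /(_ (e / (B + 1))) h.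
have := h (divr_gt0 e0 B1); apply: filterS => n xn.
rewrite normrM; apply: (le_trans (ler_pM _ _ xn (hB n))) => //.
have h1 : (B + 1)^-1 * B <= 1.
  by rewrite mulrC ler_pdivrMr// mul1r lerDl.
by rewrite -mulrA; apply: ler_piMr => //; exact: ltW.
Qed.

(* [K n w S] is the joint cumulant of the traces of [w] and of the words of [S], for
   matrices of size [n.+1]. *)
Variable K : nat -> word -> seq word -> C.
Hypothesis Knil : forall n S, K n [::] S = n.+1%:R * one C S.
Hypothesis Kcons : forall n f w S, K n (f :: w) S = n.+1%:R^-1 *
  (cutsum (fun u g v => ipc f g * (K n u (v :: S) + conv (K n u) (K n v) S)) w +
   delsum (fun w' S' => cutsum (fun u g v => ipc f g * K n (w ++ v ++ u) S') w') S).

(** The scaling under which a cumulant of [size S + 1] traces has a limit. *)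
Definition scum n w S : C := n.+1%:R ^+ size S * (n.+1%:R^-1 * K n w S).

Lemma scum_nil n S : scum n [::] S = one C S.
Proof.
rewrite /scum Knil mulKf ?pnatr_eq0// /one; case: S => [|x S] /=.
  by rewrite expr0 mul1r.
by rewrite mulr0.
Qed.

(** The powers of the size balance, except for the cumulant with one more trace. *)
Lemma scum_cons n f w S : scum n (f :: w) S =
  cutsum (fun u g v => ipc f g *
    (n.+1%:R^-1 * (n.+1%:R^-1 * scum n u (v :: S)) +
     conv (scum n u) (scum n v) S)) w +
  delsum (fun w' S' => cutsum (fun u g v => ipc f g * scum n (w ++ v ++ u) S') w') S.
Proof.
have n0 : n.+1%:R != 0 :> C by rewrite pnatr_eq0.
rewrite {1}/scum Kcons !mulrDr; congr (_ + _).
  rewrite !(cutsum_morph (f := *%R _)) ?mulr0//; last 3 first.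
  - by move=> ? ?; rewrite mulrDr.
  - by move=> ? ?; rewrite mulrDr.
  - by move=> ? ?; rewrite mulrDr.
  apply: eq_cutsum => u g v _; rewrite /scum.
  rewrite (conv_scale _ (fun s => n.+1%:R^-1 * K n u s) (fun s => n.+1%:R^-1 * K n v s)).
  have -> : conv (fun s => n.+1%:R^-1 * K n u s) (fun s => n.+1%:R^-1 * K n v s) S =
      n.+1%:R^-1 * (n.+1%:R^-1 * conv (K n u) (K n v) S).
    by rewrite (convZl _ (K n u)) convC (convZl _ (K n v)) convC.
  rewrite /= exprS.
  set x := conv _ _ _; set y := K _ _ _; set z := _ ^+ _.
  by field; rewrite addrC natr1.
rewrite /delsum !(cutsum_morph (f := *%R _)) ?mulr0//; last 3 first.
- by move=> ? ?; rewrite mulrDr.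
- by move=> ? ?; rewrite mulrDr.
- by move=> ? ?; rewrite mulrDr.
apply: eq_cutsum => S1 w' S2 ->; rewrite !(cutsum_morph (f := *%R _)) ?mulr0//; last 3 first.
- by move=> ? ?; rewrite mulrDr.
- by move=> ? ?; rewrite mulrDr.
- by move=> ? ?; rewrite mulrDr.
apply: eq_cutsum => u g v _; rewrite /scum !size_cat /= addnS exprS.
set y := K _ _ _; set z := _ ^+ _.
by field; rewrite addrC natr1.
Qed.

Let letters S := sumn (map size S).

Let letters_cat S1 S2 : letters (S1 ++ S2) = (letters S1 + letters S2)%N.
Proof. by rewrite /letters map_cat sumn_cat. Qed.

(** By induction on the number of letters; the factors on the right side of the
    recursion are all bounded. *)
Lemma scum_bdd w S : bdd (fun n => scum n w S).
Proof.
have [m] := ubnP (size w + letters S); elim: m w S => // m IH [|f w] S hm.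
  by under eq_fun do rewrite scum_nil; exact: bdd_cst.
have inv_bdd : bdd (fun n => n.+1%:R^-1).
  by exists 1 => n; rewrite normfV normr_nat invf_le1 ?ltr0n// ler1n.
under eq_fun do rewrite scum_cons; apply: bddD.
  apply: bdd_cutsum => u g v wE; move: hm; rewrite wE /= size_cat /= => hm.
  apply: bddM; first exact: bdd_cst.
  apply: bddD.
    do 2![apply: bddM => //]; apply: IH; rewrite /letters /= -/(letters S); lia.
  apply: bdd_conv => a b /(perm_map size)/perm_sumn; rewrite -/(letters _) letters_cat.
  by rewrite -/(letters S) => e; split; apply: IH; lia.
apply: bdd_cutsum => S1 w' S2 SE; apply: bdd_cutsum => u g v w'E.
apply: bddM; first exact: bdd_cst.
apply: IH; move: hm; rewrite SE w'E !letters_cat !size_cat /letters /= size_cat /=.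
by lia.
Qed.

(** The cumulant with one more trace carries the factor [n.+1%:R ^- 2]; without it, the
    recursion is that of [phiw]. *)
Lemma scum_phi w : tendsto (fun n => scum n w [::]) (phiw w).
Proof.
have [m] := ubnP (size w); elim: m w => // m IH [|f w] hm.
  under eq_fun do rewrite scum_nil; exact: cvg_cst.
under eq_fun do rewrite scum_cons /delsum /= addr0; rewrite phiw_cons.
apply: tendsto_cutsum => u g v wE; move: hm; rewrite wE /= size_cat /= => hm.
apply: (cvgM (cvg_cst _)); rewrite -[X in _ --> X]add0r; apply: cvgD.
  apply: tendsto_bdd0; first exact: tendsto_inv.
  apply: bddM; last exact: scum_bdd.
  by exists 1 => n; rewrite normfV normr_nat invf_le1 ?ltr0n// ler1n.
by apply: cvgM; apply: IH; lia.
Qed.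

(** The limit of the recursion is that of [rhow]; its last sum merges the two words. *)
Lemma scum_rho w w2 : tendsto (fun n => scum n w [:: w2]) (rhow w w2).
Proof.
have [m] := ubnP (size w); elim: m w => // m IH [|f w] hm.
  under eq_fun do rewrite scum_nil; rewrite rhow_nil; exact: cvg_cst.
under eq_fun do rewrite scum_cons /delsum /= addr0; rewrite rhow_cons; apply: cvgD; last first.
  apply: tendsto_cutsum => u g v _.
  by apply: (cvgM (cvg_cst _)); exact: scum_phi.
apply: tendsto_cutsum => u g v wE; move: hm; rewrite wE /= size_cat /= => hm.
apply: (cvgM (cvg_cst _)); rewrite -[X in _ --> X]add0r; apply: cvgD.
  apply: tendsto_bdd0; first exact: tendsto_inv.
  apply: bddM; last exact: scum_bdd.
  by exists 1 => n; rewrite normfV normr_nat invf_le1 ?ltr0n// ler1n.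
apply: cvgD; apply: cvgM; try exact: scum_phi; apply: IH; lia.
Qed.

(** A cumulant of at least three traces is bounded by a negative power of the size
    of the matrices. *)
Lemma cum_tendsto0 w S : (2 <= size S)%N -> tendsto (fun n => K n w S) 0.
Proof.
move=> S2; have [B hB] := scum_bdd w S.
have e n : K n w S = n.+1%:R^-1 * (n.+1%:R ^- (size S - 2) * scum n w S).
  have n0 : n.+1%:R != 0 :> C by rewrite pnatr_eq0.
  rewrite /scum -{2}(subnK S2) exprD expr2.
  have := expf_neq0 (size S - 2) n0; set z := _ ^+ (size S - 2) => z0.
  by move: n0; set m := _%:R => n0; field; apply/andP.
under eq_fun do rewrite e; apply: tendsto_bdd0; first exact: tendsto_inv.
apply: bddM; last exact: scum_bdd.
exists 1 => n; rewrite normfV normrX normr_nat invf_le1 ?exprn_gt0 ?ltr0n//.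
by rewrite exprn_ege1// ler1n.
Qed.

End LargeN.

(** * Words span the algebra *)

Section SpanWords.
Context {R : realType} {H : realHilbertType R}.
Local Notation C := R[i].
Local Notation A := (omega_alg H).
Implicit Types (a b : A) (l : seq (C * seq H)) (w : seq H).

Definition wsum l : A := \sum_(p <- l) p.1 *: omegaw p.2.

Lemma omegaw_cat w w' : omegaw (w ++ w') = omegaw w * omegaw w'.
Proof. by rewrite /omegaw big_cat. Qed.

Definition words_in (K : {pred H}) l : bool := all (fun p => all [in K] p.2) l.

Lemma wsum_subalg (K : {pred H}) :
  subalg_closed [pred a : A | `[< exists2 l, words_in K l & a = wsum l >]].
Proof.
split.
- apply/asboolP; exists [:: (1, [::])] => //.
  by rewrite /wsum big_seq1 scale1r /omegaw big_nil.
- move=> c a b /asboolP[l lK ->] /asboolP[l' lK' ->]; apply/asboolP.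
  exists ([seq (c * p.1, p.2) | p <- l] ++ l').
    rewrite /words_in all_cat all_map; apply/andP; split => //.
  rewrite /wsum big_cat big_map scaler_sumr; congr (_ + _).
  by apply: eq_bigr => p _; rewrite scalerA.
- move=> a b /asboolP[l lK ->] /asboolP[l' lK' ->]; apply/asboolP.
  exists [seq (p.1 * q.1, p.2 ++ q.2) | p <- l, q <- l'].
    apply/allP => _ /allpairsP[[p q] /= [pl ql ->]] /=.
    by rewrite all_cat (allP lK _ pl) (allP lK' _ ql).
  rewrite /wsum big_allpairs_dep mulr_suml; apply: eq_bigr => p _.
  rewrite mulr_sumr; apply: eq_bigr => q _ /=.
  by rewrite omegaw_cat -scalerAr -scalerAl scalerA mulrC.
Qed.

Lemma unital_alg_wsum (K : {pred H}) a :
  a \in unital_alg_gen [set omega f | f in [set f | f \in K]] ->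
  exists2 l, words_in K l & a = wsum l.
Proof.
move=> /asboolP/(_ _ (wsum_subalg K)) h; apply/asboolP/h => _ [f /= fK <-].
apply/asboolP; exists [:: (1, [:: f])]; first by rewrite /words_in /= fK.
by rewrite /wsum big_seq1 scale1r /omegaw big_seq1.
Qed.

Lemma omega_star_eq a b : op a =1 adj b -> adj a =1 op b -> a = omega_star b.
Proof. by move=> h1 h2; apply: val_inj; exact: adjop_eq. Qed.

Lemma star_wsum l : omega_star (wsum l) = wsum [seq (p.1^*, rev p.2) | p <- l].
Proof.
have sumD (F : C * seq H -> A) s x :
    op (\sum_(p <- s) F p : A) x = \sum_(p <- s) op (F p) x.
  elim: s => [|p s IH]; first by rewrite !big_nil.
  by rewrite !big_cons -IH.
have sumDa (F : C * seq H -> A) s x :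
    adj (\sum_(p <- s) F p : A) x = \sum_(p <- s) adj (F p) x.
  elim: s => [|p s IH]; first by rewrite !big_nil.
  by rewrite !big_cons -IH.
apply/esym/omega_star_eq => x; rewrite /wsum sumD sumDa big_map; apply: eq_bigr => p _.
  rewrite -[LHS]/(p.1^* *: op (omegaw (rev p.2)) x) -[RHS]/(p.1^* *: adj (omegaw p.2) x).
  by rewrite op_omegaw adj_omegaw.
rewrite -[LHS]/((p.1^*)^* *: adj (omegaw (rev p.2)) x) -[RHS]/(p.1 *: op (omegaw p.2) x).
by rewrite op_omegaw adj_omegaw revK conjCK.
Qed.

Lemma omega_alg_wsum a : exists l, a = wsum l.
Proof.
have /asboolP h := omega_valP a.
pose B : {pred adjop H} := [pred x | `[< exists l, x = omega_val (wsum l) >]].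
have : omega_val a \in B.
  have [w1 wl wm] := wsum_subalg predT.
  have all_in l : words_in predT l by apply/allP => p _; apply/allP.
  apply: h.
  - split.
    + by case/asboolP: w1 => l _ e; apply/asboolP; exists l; rewrite -e.
    + move=> c x y /asboolP[l ->] /asboolP[l' ->]; apply/asboolP.
      have : c *: wsum l + wsum l' \in
        [pred a : A | `[< exists2 l, words_in predT l & a = wsum l >]].
        by apply: wl; apply/asboolP; [exists l|exists l'].
      by case/asboolP => l2 _ e; exists l2; rewrite -e.
    + move=> x y /asboolP[l ->] /asboolP[l' ->]; apply/asboolP.
      have : wsum l * wsum l' \in
        [pred a : A | `[< exists2 l, words_in predT l & a = wsum l >]].
        by apply: wm; apply/asboolP; [exists l|exists l'].
      by case/asboolP => l2 _ e; exists l2; rewrite -e.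
  - move=> x /asboolP[l ->]; apply/asboolP.
    by exists [seq (p.1^*, rev p.2) | p <- l]; rewrite -star_wsum.
  - move=> f; apply/asboolP; exists [:: (1, [:: f])].
    by rewrite /wsum big_seq1 scale1r /omegaw big_seq1.
by case/asboolP => l e; exists l; exact: val_inj.
Qed.

(** The elements are linear combinations of words, so that identities between
    linear maps may be checked on words. *)
Lemma omega_alg_ind (Q : A -> Prop) : Q 0 ->
  (forall c w x, Q x -> Q (c *: omegaw w + x)) -> forall a, Q a.
Proof.
move=> Q0 QS a; have [l ->] := omega_alg_wsum a.
by elim: l => [|p l IH]; rewrite /wsum ?big_nil// big_cons; exact: QS.
Qed.

Lemma phi_linear : scalar (@phi R H).
Proof. by move=> c a b; rewrite /phi -[op _ _]/(c *: op a _ + op b _) fock_ip_linearl. Qed.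

Lemma phi_trace a b : phi (a * b) = phi (b * a).
Proof.
have phi0 : phi (0 : A) = 0 by have := phi_linear (-1) 0 0; rewrite scaler0 addr0 mulN1r addNr.
elim/omega_alg_ind: a => [|c w x IH]; first by rewrite mul0r mulr0.
rewrite mulrDl mulrDr -scalerAl -scalerAr !phi_linear IH; congr (_ * _ + _).
elim/omega_alg_ind: b {IH} => [|e w' y IH]; first by rewrite mul0r mulr0.
rewrite mulrDl mulrDr -scalerAl -scalerAr !phi_linear IH; congr (_ * _ + _).
by rewrite -!omegaw_cat !phi_omegaw phiw_catC.
Qed.

End SpanWords.

(** * Freeness of orthogonal subspaces *)

Section Blocks.
Context {R : realType} {H : realHilbertType R}.
Local Notation C := R[i].
Local Notation word := (seq H).
Local Notation ipc f g := ((ip f g)%:C%C : C).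
Local Notation ofreals := (map (@ofreal R H)).
Variables (r : nat) (K : 'I_r -> {pred H}).
Hypothesis orthK : forall k l, k != l ->
  forall f g, f \in K k -> g \in K l -> ip f g = 0.

(** A color and a formal linear combination of words; it stands for the vector
    of a centered element of the subalgebra of that color. *)
Definition block : Type := ('I_r * seq (C * word))%type.
Implicit Types (x y z : block) (xs ys zs : seq block) (s t u v w : word)
  (F G : word -> C).

Definition okb x : bool := all (fun p => (p.2 != [::]) && all [in K x.1] p.2) x.2.

(** The value on the tensor product of the blocks of the linear functional with
    the values [F] on words. *)
Fixpoint LS xs F : C :=
  if xs is x :: xs' then \sum_(p <- x.2) p.1 * LS xs' (fun t => F (p.2 ++ t))
  else F [::].

(** The words that occur in the tensor product. *)
Fixpoint supp xs t : Prop :=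
  if xs is x :: xs' then exists w t', [/\ t = w ++ t', w != [::],
    all [in K x.1] w & supp xs' t'] else t = [::].

Lemma eq_LS xs F G : all okb xs -> (forall t, supp xs t -> F t = G t) ->
  LS xs F = LS xs G.
Proof.
elim: xs F G => [|x xs IH] F G /=; first by move=> _; apply.
move=> /andP[/allP xok xsok] e; apply: eq_big_seq => p /xok /andP[p0 pK].
by congr (_ * _); apply: IH => // t ts; apply: e; exists p.2, t.
Qed.

Lemma eq_LSf xs F G : F =1 G -> LS xs F = LS xs G.
Proof. by move=> /funext ->. Qed.

Lemma LS_sum xs I (l : seq I) (c : I -> C) (F : I -> word -> C) :
  LS xs (fun t => \sum_(i <- l) c i * F i t) = \sum_(i <- l) c i * LS xs (F i).
Proof.
elim: xs F => //= x xs IH F.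
under eq_bigr do rewrite IH mulr_sumr; rewrite exchange_big /=.
by apply: eq_bigr => i _; rewrite mulr_sumr; apply: eq_bigr => p _; rewrite mulrCA.
Qed.

Lemma LSZ xs c F : LS xs (fun t => c * F t) = c * LS xs F.
Proof.
have := LS_sum xs [:: tt] (fun=> c) (fun _ => F); rewrite big_seq1 => <-.
by apply: eq_LSf => t; rewrite big_seq1.
Qed.

Lemma LSD xs F G : LS xs (fun t => F t + G t) = LS xs F + LS xs G.
Proof.
have := LS_sum xs [:: true; false] (fun=> 1) (fun b => if b then F else G).
rewrite !big_cons big_nil !mul1r addr0 => <-.
by apply: eq_LSf => t; rewrite !big_cons big_nil !mul1r addr0.
Qed.

Lemma LS0 xs F : all okb xs -> (forall t, supp xs t -> F t = 0) -> LS xs F = 0.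
Proof.
move=> xsok F0; rewrite (@eq_LS _ _ (fun t => 0 * F t))// ?LSZ ?mul0r//.
by move=> t /F0 ->; rewrite mulr0.
Qed.

Lemma LS_cat xs ys F : LS (xs ++ ys) F = LS xs (fun s => LS ys (fun t => F (s ++ t))).
Proof.
elim: xs F => [|x xs IH] F //=; apply: eq_bigr => p _; rewrite IH; congr (_ * _).
by apply: eq_LSf => s; apply: eq_LSf => t; rewrite catA.
Qed.

(** Bilinear rather than sesquilinear: the coefficients of the second block are to be
    conjugated beforehand. *)
Definition bil x y : C :=
  \sum_(p <- x.2) \sum_(q <- y.2) p.1 * q.1 * wipw p.2 q.2.

Fixpoint pip xs ys : C :=
  match xs, ys with
  | [::], [::] => 1
  | x :: xs', y :: ys' => bil x y * pip xs' ys'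
  | _, _ => 0
  end.

Lemma wipw_nil s : wipw [::] s = (nilp s)%:R :> C. Proof. by case: s. Qed.
Lemma wipw_nilr s : wipw s [::] = (nilp s)%:R :> C. Proof. by case: s. Qed.

Lemma wipw_orth k l w v s t : k != l -> w != [::] -> v != [::] ->
  all [in K k] w -> all [in K l] v -> wipw (w ++ s) (v ++ t) = 0.
Proof.
case: w v => [|f w] [|g v] //= kl _ _ /andP[fK _] /andP[gK _].
by rewrite wipw_cons (orthK kl fK gK) mul0r.
Qed.

Lemma bil_orth x y : okb x -> okb y -> x.1 != y.1 -> bil x y = 0.
Proof.
move=> /allP xok /allP yok xy; rewrite /bil big_seq big1// => p /xok /andP[p0 pK].
rewrite big_seq big1// => q /yok /andP[q0 qK].
by rewrite -[p.2]cats0 -[q.2]cats0 (wipw_orth _ _ xy)// mulr0.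
Qed.

(** The first letter of [t] is orthogonal to the subspace of color [k], because it has
    another color. *)
Definition headok k t : Prop :=
  if t is f :: _ then exists2 l, k != l & f \in K l else True.

(** Two words whose first letters are orthogonal to a subspace match only if
    words in that subspace in front of them match. *)
Lemma wipw_cat k w v s t : headok k s -> headok k t ->
  all [in K k] w -> all [in K k] v ->
  wipw (w ++ s) (v ++ t) = wipw w v * wipw s t :> C.
Proof.
move=> sh th; elim: w v => [|f w IH] [|g v] /=.
- by rewrite wipw_nil mul1r.
- move=> _ /andP[gK _]; rewrite wipw_nil /= mul0r; case: s sh => [|h s].
    by rewrite wipw_nil.
  by case=> l kl hK; rewrite wipw_cons ipC (orthK kl gK hK) mul0r.
- move=> /andP[fK _] _; rewrite wipw_nilr /= mul0r; clear IH.
  case: t th => [|h t]; first by rewrite wipw_nilr.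
  by case=> l kl hK; rewrite wipw_cons (orthK kl fK hK) mul0r.
- by move=> /andP[_ wK] /andP[_ vK]; rewrite !wipw_cons IH// mulrA.
Qed.

Definition alt : rel block := fun x y => x.1 != y.1.

Lemma supp_head x xs t : path alt x xs -> supp xs t -> headok x.1 t.
Proof.
case: xs => [|y xs] /=; first by move=> _ ->.
move=> /andP[xy _] [[|f w] [t' [-> // _ /= /andP[fK _] _]]].
by exists y.1.
Qed.

Lemma supp_nil xs : supp xs [::] -> xs = [::].
Proof. by case: xs => //= x xs [[|? ?] [? []]]. Qed.

(** Tensor products of blocks of alternating colors match block by block. *)
Lemma LS_pip xs ys : all okb xs -> all okb ys -> sorted alt xs -> sorted alt ys ->
  LS xs (fun s => LS ys (wipw s)) = pip xs ys.
Proof.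
elim: xs ys => [|x xs IH] [|y ys] xsok ysok xa ya.
- by [].
- apply: (@LS0 (y :: ys)) => // -[|f t] // st.
  by have := @supp_nil (y :: ys) st.
- apply: LS0 => // -[|f t] //= st.
  by have := @supp_nil (x :: xs) st.
have /andP[xok xsok'] := xsok; have /andP[yok ysok'] := ysok.
have IH' := IH ys xsok' ysok' (path_sorted xa) (path_sorted ya).
rewrite /= -IH' /bil mulr_suml; apply: eq_big_seq => p px.
have /andP[p0 pK] := allP xok _ px.
rewrite mulr_suml [LHS](_ : _ = p.1 * LS xs (fun s => \sum_(q <- y.2) q.1 *
   LS ys (fun t => wipw (p.2 ++ s) (q.2 ++ t)))) ; last by [].
rewrite LS_sum mulr_sumr; apply: eq_big_seq => q qy.
have /andP[q0 qK] := allP yok _ qy.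
suff -> : LS xs (fun s => LS ys (fun t => wipw (p.2 ++ s) (q.2 ++ t))) =
    wipw p.2 q.2 * LS xs (fun s => LS ys (wipw s)) by ring.
rewrite -LSZ; apply: eq_LS => // s ss; rewrite -LSZ; apply: eq_LS => // t st.
have [xy|xy] := eqVneq x.1 y.1.
  apply: (wipw_cat (k := x.1)); last by rewrite xy.
  - exact: supp_head xa ss.
  - by rewrite xy; exact: supp_head ya st.
  - exact: pK.
rewrite (wipw_orth _ _ xy)// -[p.2]cats0 -[q.2]cats0 (wipw_orth _ _ xy)//.
by rewrite mul0r.
Qed.

Lemma pip_size xs ys : size xs != size ys -> pip xs ys = 0.
Proof.
elim: xs ys => [|x xs IH] [|y ys] //=; rewrite eqSS => /IH ->.
by rewrite mulr0.
Qed.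

Lemma pip_rcons xs ys x y : size xs = size ys ->
  pip (rcons xs x) (rcons ys y) = pip xs ys * bil x y.
Proof.
elim: xs ys => [|z xs IH] [|z' ys] //= => [_|[/IH ->]]; last by rewrite mulrA.
by rewrite mulr1 mul1r.
Qed.

Lemma pipE xs ys x0 : size xs = size ys ->
  pip xs ys = \prod_(i < size xs) bil (nth x0 xs i) (nth x0 ys i).
Proof.
elim: xs ys => [|x xs IH] [|y ys] //=; first by rewrite big_ord0.
by case=> /IH ->; rewrite big_ord_recl.
Qed.

(** A rotation that starts inside a block has a first and a last block of the
    same color, unlike the tensor product of cyclically alternating blocks. *)
Lemma pip_interior xs ys y z x : all okb xs -> all okb ys -> okb y -> okb z ->
  cycle alt (x :: xs) -> okb x -> xs != [::] -> y.1 = z.1 ->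
  pip (x :: xs) (y :: rcons ys z) = 0.
Proof.
case/lastP: xs => // xs x'; rewrite all_rcons => /andP[x'ok xsok] ysok yok zok ca xok _ yz.
have [e|ne] := eqVneq (size xs) (size ys); last first.
  by rewrite pip_size//= !size_rcons !eqSS.
rewrite /= pip_rcons//.
have [xy|xy] := eqVneq x.1 y.1; last by rewrite (bil_orth xok yok xy) mul0r.
have x'x : x'.1 != x.1.
  by move: ca; rewrite /= rcons_path last_rcons => /andP[_].
by rewrite (bil_orth x'ok zok) ?mulr0// -yz -xy.
Qed.

Lemma LS_exchange xs ys (B : word -> word -> C) :
  LS xs (fun s => LS ys (B s)) = LS ys (fun t => LS xs (B^~ t)).
Proof.
elim: xs B => [|x xs IH] B //=.
by rewrite LS_sum; apply: eq_bigr => p _; rewrite IH.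
Qed.

(** The cyclic inner product of tensor products of cyclically alternating blocks:
    only the rotations by whole blocks contribute. *)
Lemma LS_rot xs ys : (2 <= size xs)%N -> (2 <= size ys)%N ->
  all okb xs -> all okb ys -> cycle alt xs -> cycle alt ys ->
  LS xs (fun s => LS ys (fun t => \sum_(k < size t) wipw s (rot k t))) =
  \sum_(j < size ys) pip xs (rot j ys).
Proof.
move=> xs2 ys2 xsok ysok xa ya.
have cycle_sorted zs : cycle alt zs -> sorted alt zs.
  by case: zs => //= z zs; rewrite rcons_path => /andP[].
pose G w := LS xs (fun s => wipw s w).
have GE zs : all okb zs -> sorted alt zs -> LS zs G = pip xs zs.
  move=> zsok za; rewrite -LS_pip//; last exact: cycle_sorted.
  exact: esym (LS_exchange xs zs (fun s t => wipw s t)).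
pose D rem don := LS rem (fun t => LS don (fun u => \sum_(k < size t) G (rot k (t ++ u)))).
(* The blocks of [rem] have not been reached by the starting point of the
   rotation; those of [don] have been moved to the end. *)
have key rem don : all okb (rem ++ don) -> cycle alt (rem ++ don) ->
    D rem don = \sum_(j < size rem) pip xs (rot j (rem ++ don)).
  elim: rem don => [|m rem IH] don.
    move=> donok _; rewrite big_ord0 /D /=; apply: LS0 => // u _.
    by rewrite big_ord0.
  rewrite cat_cons => /= /andP[mok rdok] ca.
  have rot_split v w : v != [::] -> forall n, (n <= size w)%N ->
      \sum_(k < size v + n) G (rot k (v ++ w)) =
      G (v ++ w) + \sum_(k < (size v).-1) G (drop k.+1 v ++ w ++ take k.+1 v) +
      \sum_(k < n) G (rot k (w ++ v)).
    move=> v0 n nw; rewrite big_split_ord /=; congr (_ + _).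
      case: v v0 => // f v _; rewrite big_ord_recl /= rot0; congr (_ + _).
      apply: eq_bigr => k _; rewrite /bump leq0n add1n /rot /= drop_cat take_cat.
      by rewrite ltn_ord -catA.
    apply: eq_bigr => k _; congr G; rewrite addnC rotD ?rot_size_cat//.
    by rewrite size_cat addnC leq_add2l (leq_trans (ltnW (ltn_ord k))).
  have -> : D (m :: rem) don = LS (m :: rem ++ don) G +
     \sum_(p <- m.2) p.1 * \sum_(k < (size p.2).-1)
        LS (rem ++ don) (fun w => G (drop k.+1 p.2 ++ w ++ take k.+1 p.2)) +
     D rem (rcons don m).
    rewrite [LS (m :: _) G]/= /D /= -big_split /=.
    under [in RHS]eq_LSf => t do rewrite -cats1 LS_cat /=.
    rewrite (@eq_LSf _ _ (fun t => \sum_(p <- m.2) p.1 * LS don (fun u =>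
       \sum_(k < size t) G (rot k (t ++ u ++ p.2))))); last first.
      by move=> t; rewrite LS_sum; apply: eq_bigr => p _; rewrite ?cats0.
    rewrite LS_sum -big_split /=; apply: eq_big_seq => p pm.
    have /andP[p0 pK] := allP mok _ pm.
    rewrite -!mulrDr; congr (_ * _).
    rewrite LS_cat.
    have := LS_sum (rem ++ don) (index_enum 'I_(size p.2).-1) (fun=> 1)
       (fun k w => G (drop k.+1 p.2 ++ w ++ take k.+1 p.2)).
    rewrite (eq_bigr (fun k : 'I_(size p.2).-1 => LS (rem ++ don) (fun w =>
       G (drop k.+1 p.2 ++ w ++ take k.+1 p.2)))) => [<-|k _]; last by rewrite mul1r.
    rewrite LS_cat -!LSD; apply: eq_LSf => t; rewrite -!LSD; apply: eq_LSf => u.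
    rewrite size_cat -catA (rot_split _ (t ++ u))//; last by rewrite size_cat leq_addr.
    congr (_ + _ + _); first by apply: eq_bigr => k _; rewrite mul1r.
    by apply: eq_bigr => k _; rewrite catA.
  rewrite GE; last 2 first.
  - by rewrite /= mok.
  - exact: (cycle_sorted (m :: rem ++ don) ca).
  rewrite [X in _ + X + _]big_seq big1 ?addr0; last first.
    move=> p pm; have /andP[p0 pK] := allP mok _ pm.
    rewrite big1 ?mulr0// => k _.
    pose y : block := (m.1, [:: (1, drop k.+1 p.2)]).
    pose z : block := (m.1, [:: (1, take k.+1 p.2)]).
    have kp : (k.+1 < size p.2)%N by rewrite -ltn_predRL.
    have allK w w' : p.2 = w ++ w' -> all [in K m.1] w && all [in K m.1] w'.
      by move=> pE; rewrite -all_cat -pE.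
    have /allK/andP[tK dK] := esym (cat_take_drop k.+1 p.2).
    have yok : okb y.
      by rewrite /okb /= dK andbT andbT -size_eq0 size_drop subn_eq0 -ltnNge.
    have zok : okb z.
      by rewrite /okb /= tK andbT andbT -size_eq0 size_take kp.
    transitivity (LS (y :: rcons (rem ++ don) z) G).
      rewrite /= big_seq1 mul1r -cats1 [RHS]LS_cat; apply: eq_LSf => w.
      by rewrite /= big_seq1 mul1r cats0.
    rewrite GE.
    - case: xs xs2 xsok xa {G GE D IH rot_split} => // x [|x' xs'] // _ xsok xa.
      have /andP[xok xsok'] := xsok; exact: pip_interior.
    - by rewrite /= yok all_rcons zok.
    - move: ca => /=; rewrite !rcons_path => /andP[h1 h2]; apply/andP; split.
        by case: (rem ++ don) h1.
      by case: (rem ++ don) h2.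
  rewrite IH.
  - rewrite big_ord_recl /= rot0; congr (_ + _); apply: eq_bigr => j _; congr pip.
    rewrite /bump leq0n add1n -[j.+1]addn1 rotD ?rot1_cons ?rcons_cat//=.
    by rewrite addn1 ltnS size_cat (leq_trans (ltnW (ltn_ord j)))// leq_addr.
  - by rewrite -rcons_cat all_rcons mok.
  - by rewrite -rcons_cat -rot1_cons rot_cycle.
have := key ys [::]; rewrite cats0 => <- //; rewrite /D /= LS_exchange.
apply: eq_LSf => t; rewrite cats0 /G.
rewrite (@eq_LSf _ _ (fun s => \sum_(k < size t) 1 * wipw s (rot k t))); last first.
  by move=> s; apply: eq_bigr => k _; rewrite mul1r.
by rewrite LS_sum; apply: eq_bigr => k _; rewrite mul1r.
Qed.

End Blocks.

Section SecondOrderFreeness.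
Context {R : realType} {H : realHilbertType R}.
Local Notation C := R[i].
Local Notation A := (omega_alg H).
Local Notation word := (seq H).
Local Notation ipc f g := ((ip f g)%:C%C : C).
Local Notation ofreals := (map (@ofreal R H)).
Variables (r : nat) (K : 'I_r -> {pred H}).
Hypothesis orthK : forall k l, k != l ->
  forall f g, f \in K k -> g \in K l -> ip f g = 0.
Local Notation okb := (okb K).
Local Notation alt := (@alt R H r).
Local Notation block := (@block R H r).
Implicit Types (a b : A) (t u v w : word) (l : seq (C * word)) (xs ys : seq block).

Definition tsum l t : Flin H := \sum_(p <- l) p.1 *: tens (ofreals (p.2 ++ t)).

(** On a tensor that starts with a vector orthogonal to [K c], the element acts by
    putting its vector in front. *)
Definition acts_by c l a : Prop := forall t, headok K c t ->
  op a (tens (ofreals t)) = tsum l t.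

(** Contractions take place within the word only, since its letters are orthogonal to
    the first vector of the tensor. *)
Lemma word_acts_by c w : all [in K c] w -> exists2 l, words_in (K c) l &
  acts_by c l (omegaw w).
Proof.
elim: w => [|h w IH].
  move=> _; exists [:: (1, [::])] => // t _.
  by rewrite op_omegaw /tsum big_seq1 scale1r.
move=> /andP[hK wK]; have [l lK la] := IH wK.
exists (flatten [seq (p.1, h :: p.2) ::
  (if p.2 is k :: t' then [:: (p.1 * ipc k h, t')] else [::]) | p <- l]).
  apply/allP => q /flatten_mapP[p pl]; have pK := allP lK _ pl.
  rewrite inE => /predU1P[->|]; first by rewrite /= hK.
  by case: (p.2) pK => //= k t' /andP[_ tK]; rewrite inE => /eqP ->.
move=> t ht; rewrite op_omegaw /= -op_omegaw la// /tsum big_flatten big_map.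
have omD (F : C * word -> Flin H) k :
    omega0 h (\sum_(p <- k) F p) = \sum_(p <- k) omega0 h (F p).
  elim: k => [|p k IH']; first by rewrite !big_nil (lin0 (omega0_linear h)).
  by rewrite !big_cons (linD (omega0_linear h)) IH'.
rewrite omD; apply: eq_bigr => p _.
rewrite (linZ (omega0_linear h)) omega0_tens scalerDr big_cons; congr (_ + _).
case: p => c0 [|k t'] /=; last by rewrite big_seq1 scalerA.
rewrite big_nil; case: t ht => [|k t]; first by rewrite scaler0.
by case=> d cd kK; rewrite ipC (orthK cd hK kK) scale0r scaler0.
Qed.

Lemma wsum_acts_by c a : (exists2 l, words_in (K c) l & a = wsum l) ->
  exists2 l, words_in (K c) l & acts_by c l a.
Proof.
case=> l + ->; elim: l => [|p l IH] /=.
  move=> _; exists [::] => // t _.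
  by rewrite /wsum /tsum !big_nil.
move=> /andP[pK /IH[l1 l1K a1]]; have [l2 l2K a2] := word_acts_by pK.
exists ([seq (p.1 * q.1, q.2) | q <- l2] ++ l1).
  by rewrite /words_in all_cat all_map; apply/andP; split.
move=> t ht; rewrite /tsum big_cat /= big_map -/(tsum l1 t) -a1// /wsum big_cons.
rewrite -[LHS]/(p.1 *: op (omegaw p.2) (tens (ofreals t)) + op (wsum l) _) a2//.
by congr (_ + _); rewrite /tsum scaler_sumr; apply: eq_bigr => q _; rewrite scalerA.
Qed.

Lemma sum_fock_ip (l : seq (C * word)) (F : word -> Flin H) y :
  fock_ip (\sum_(p <- l) p.1 *: F p.2) y = \sum_(p <- l) p.1 * fock_ip (F p.2) y.
Proof.
elim: l => [|p l IH]; first by rewrite !big_nil fock_ip0l.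
by rewrite !big_cons fock_ipDl fock_ipZl IH.
Qed.

(** Centering cancels the coefficients of the empty word. *)
Lemma wsum_block c a : (exists2 l, words_in (K c) l & a = wsum l) ->
  phi a = 0 -> exists x : block, [/\ x.1 = c, okb x & acts_by c x.2 a].
Proof.
move=> /wsum_acts_by[l lK la] a0; exists (c, [seq p <- l | p.2 != [::]]); split => //.
  apply/allP => p; rewrite /= mem_filter => /andP[-> pl] /=.
  exact: (allP lK).
move=> t ht; rewrite la// /tsum big_filter.
rewrite (bigID (fun p : C * word => p.2 == [::])) /=.
rewrite (eq_bigr (fun p : C * word => p.1 *: tens (ofreals t))); last first.
  by move=> p /eqP ->.
suff : \sum_(p <- l | p.2 == [::]) p.1 = 0.
  move=> e; rewrite [X in X + _](_ : _ = 0) ?add0r//.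
  transitivity ((\sum_(p <- l | p.2 == [::]) p.1) *: tens (ofreals t)).
    by rewrite scaler_suml.
  by rewrite e scale0r.
move: a0; rewrite /phi (la [::])// /tsum.
rewrite (sum_fock_ip l (fun w => tens (ofreals (w ++ [::])))) => e0.
rewrite -[RHS]e0 [RHS](bigID (fun p : C * word => p.2 == [::])) /= [X in _ = _ + X]big1 ?addr0.
  by apply: eq_bigr => p /eqP ->; rewrite fock_ip_tens mulr1.
by move=> [e [|f w]] //= _; rewrite fock_ip_tens mulr0.
Qed.

Fixpoint acts_by_blocks xs (s : seq A) : Prop :=
  match xs, s with
  | [::], [::] => True
  | x :: xs', a :: s' => acts_by x.1 x.2 a /\ acts_by_blocks xs' s'
  | _, _ => False
  end.

Lemma acts_by_size xs (s : seq A) : acts_by_blocks xs s -> size xs = size s.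
Proof. by elim: xs s => [|x xs IH] [|a s] //= [_ /IH ->]. Qed.

Lemma acts_by_rcons xs (s : seq A) x a : acts_by_blocks xs s -> acts_by x.1 x.2 a ->
  acts_by_blocks (rcons xs x) (rcons s a).
Proof.
elim: xs s => [|y xs IH] [|b s] //= [h1 h2] h3.
by split => //; exact: IH.
Qed.

(** On the vacuum, a product of centered elements of alternating colors gives the
    tensor product of their vectors. *)
Lemma LS_prod (L : Flin H -> C) xs (s : seq A) : {morph L : x y / x + y} ->
  (forall e x, L (e *: x) = e * L x) ->
  all okb xs -> sorted alt xs -> acts_by_blocks xs s ->
  L (op (\prod_(a <- s) a : A) (vac H)) = LS xs (fun t => L (tens (ofreals t))).
Proof.
elim: xs s L => [|x xs IH] [|a s] L LD LZ //= xsok xsa; first by rewrite big_nil.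
case=> ha hs; have /andP[xok xsok'] := xsok.
rewrite big_cons -[op _ _]/(op a (op (\prod_(b <- s) b : A) (vac H))).
rewrite (IH s (fun y => L (op a y))) ?(path_sorted xsa)//; last 2 first.
- by move=> y z; rewrite (linD (op_linear a)) LD.
- by move=> e y; rewrite (linZ (op_linear a)) LZ.
rewrite -LS_sum; apply: (eq_LS xsok') => t st.
rewrite ha; last exact: supp_head xsa st.
rewrite /tsum; elim: (x.2) => [|p l IH']; last by rewrite !big_cons LD LZ IH'.
by rewrite !big_nil; have := LZ 0 0; rewrite scaler0 mul0r.
Qed.

(** The cyclic inner product is conjugate-linear in its second argument. *)
Definition cblock (x : block) : block := (x.1, [seq (p.1^*, p.2) | p <- x.2]).

Lemma okb_cblock x : okb (cblock x) = okb x.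
Proof. by rewrite /okb /= all_map. Qed.

Lemma LS_cblock ys F : (LS ys F)^* = LS (map cblock ys) (fun t => (F t)^*).
Proof.
elim: ys F => [|y ys IH] F //=; rewrite big_map rmorph_sum; apply: eq_bigr => p _.
by rewrite rmorphM /= IH.
Qed.

Lemma alt_cblock ys : sorted alt (map cblock ys) = sorted alt ys.
Proof. by rewrite sorted_map. Qed.

Lemma cycle_cblock ys : cycle alt (map cblock ys) = cycle alt ys.
Proof. by case: ys => //= y ys; rewrite -map_rcons path_map. Qed.

Lemma star_prod (s : seq A) x :
  op (omega_star (\prod_(a <- s) a)) x = op (\prod_(a <- rev (map (@omega_star R H) s)) a : A) x.
Proof.
elim: s x => [|a s IH] x; first by rewrite !big_nil.
rewrite big_cons map_cons rev_cons -cats1 big_cat /= big_seq1.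
rewrite -[LHS]/(adj (\prod_(b <- s) b : A) (adj a x)).
rewrite -[RHS]/(op (\prod_(b <- rev (map (@omega_star R H) s)) b : A) (adj a x)).
by rewrite -IH.
Qed.

Lemma rho_prod xs ys (s t : seq A) : all okb xs -> all okb ys ->
  sorted alt xs -> sorted alt ys -> acts_by_blocks xs s ->
  acts_by_blocks ys (rev (map (@omega_star R H) t)) ->
  rho (\prod_(a <- s) a) (\prod_(b <- t) b) =
  LS xs (fun u => LS (map cblock ys) (fun v =>
    cyc_ip (cword (ofreals u)) (cword (ofreals v)))).
Proof.
move=> xsok ysok xsa ysa hs ht; rewrite /rho star_prod.
have cD : {morph @cmap R H : x y / x + y}.
  by move=> x y; have := cmap_linear 1 x y; rewrite !scale1r.
have c0 : cmap (0 : Flin H) = 0 by apply: (addrI (cmap 0)); rewrite -cD !addr0.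
have cZ e x : cmap (e *: x : Flin H) = e *: cmap x.
  by have := cmap_linear e x 0; rewrite c0 !addr0.
have ip0l z : cyc_ip 0 z = 0 :> C by rewrite cyc_ipC cyc_ip0r rmorph0.
have ipD x y z : cyc_ip (x + y) z = cyc_ip x z + cyc_ip y z :> C.
  by have := cyc_ip_linearl z 1 x y; rewrite scale1r mul1r.
have ipZ e x z : cyc_ip (e *: x) z = e * cyc_ip x z :> C.
  by have := cyc_ip_linearl z e x 0; rewrite ip0l !addr0.
rewrite (LS_prod (L := fun x => cyc_ip (cmap x) _) _ _ xsok xsa hs); last 2 first.
- by move=> x y; rewrite cD ipD.
- by move=> e x; rewrite cZ ipZ.
apply: eq_LSf => u; rewrite cyc_ipC.
rewrite (LS_prod (L := fun x => cyc_ip (cmap x) _) _ _ ysok ysa ht); last 2 first.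
- by move=> x y; rewrite cD ipD.
- by move=> e x; rewrite cZ ipZ.
by rewrite LS_cblock; apply: eq_LSf => v; rewrite -cyc_ipC !cmap_tens.
Qed.

Lemma cword_first_last u f g : ip f g = 0 ->
  cword (ofreals (f :: rcons u g)) = ctens (ofreals (f :: rcons u g)).
Proof.
move=> fg; rewrite map_cons map_rcons cword_rcons conj_ofreal cip_ofreal fg.
by rewrite scale0r addr0.
Qed.

Lemma supp_last xs x u : supp K (rcons xs x) u -> exists v f, u = rcons v f /\ f \in K x.1.
Proof.
elim: xs u => [|y xs IH] u /= [w [u' [-> w0 wK]]].
  move=> ->; rewrite cats0; case/lastP: w w0 wK => // w f _.
  by rewrite all_rcons => /andP[fK _]; exists w, f.
by move=> /IH[v [f [-> fK]]]; exists (w ++ v), f; rewrite rcons_cat.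
Qed.

(** The first and the last blocks have different colors, so that [c] contracts nothing. *)
Lemma supp_cword xs u : (2 <= size xs)%N -> cycle alt xs -> supp K xs u ->
  cword (ofreals u) = ctens (ofreals u).
Proof.
case: xs => // x xs; case/lastP: xs => // xs y _ /=.
rewrite rcons_path last_rcons => /andP[_ yx] [w [u' [-> w0 wK us]]].
have [v [f [-> fK]]] := supp_last us.
case: w w0 wK => // g w _ /andP[gK _]; rewrite cat_cons -rcons_cat.
apply: cword_first_last; apply: orthK gK fK.
by rewrite eq_sym.
Qed.

Lemma wipw_color c d u v f : c != d -> all [in K c] u -> f \in v -> f \in K d ->
  wipw u v = 0 :> C.
Proof.
move=> cd; elim: u v => [|g u IH] [|h v] //= /andP[gK uK].
rewrite wipw_cons inE => /predU1P[<-|fv] fK; first by rewrite (orthK cd gK fK) mul0r.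
by rewrite (IH v)// mulr0.
Qed.

(** The letters of all the circular tensors in [cword u] have the color [c], and the
    letter [f] of [v], of another color, is orthogonal to them. *)
Lemma cyc_ip_color c d u v f : c != d -> all [in K c] u -> f \in v -> f \in K d ->
  cyc_ip (cword (ofreals u)) (ctens (ofreals v)) = 0 :> C.
Proof.
move=> cd; have [n] := ubnP (size u); elim: n u => // n IH u un uK fv fK.
have cw w : all [in K c] w -> cyc_ip (ctens (ofreals w)) (ctens (ofreals v)) = 0 :> C.
  move=> wK; rewrite cyc_ip_ctens /cwip big1// => k _; rewrite -map_rot.
  by apply: (wipw_color cd wK) fK; rewrite mem_rot.
have ip0l z : cyc_ip 0 z = 0 :> C by rewrite cyc_ipC cyc_ip0r rmorph0.
case: u un uK => [|g u] un uK; first by rewrite /cword /= ip0l.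
case/lastP: u un uK => [|u h] un uK; first by rewrite /cword /= (cw [:: g]).
rewrite map_cons map_rcons cword_rcons -map_rcons -(map_cons (@ofreal R H)).
rewrite addrC cyc_ip_linearl cw// addr0 (IH u) ?mulr0//.
  by move: un; rewrite /= size_rcons ltnS; exact: ltnW.
by move: uK; rewrite /= all_rcons => /andP[_ /andP[_]].
Qed.

(** All the circular tensors in [cword v] start with a letter of the color [d]. *)
Lemma cyc_ip_colors c d u v : c != d -> all [in K c] u -> all [in K d] v ->
  cyc_ip (cword (ofreals u)) (cword (ofreals v)) = 0 :> C.
Proof.
move=> cd uK; have [n] := ubnP (size v); elim: n v => // n IH v vn vK.
case: v vn vK => [|g v] vn vK; first by rewrite /cword /= cyc_ip0r.
have gK : g \in K d by case/andP: vK.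
have cw w : cyc_ip (cword (ofreals u)) (ctens (ofreals (g :: w))) = 0 :> C.
  by apply: (cyc_ip_color (f := g) cd) => //; rewrite inE eqxx.
case/lastP: v vn vK => [|v h] vn vK; first by rewrite {2}/cword /= (cw [::]).
rewrite map_cons map_rcons cword_rcons -map_rcons -(map_cons (@ofreal R H)).
rewrite addrC cyc_ip_linearr cw addr0 (IH v) ?mulr0//.
  by move: vn; rewrite /= size_rcons ltnS; exact: ltnW.
by move: vK; rewrite /= all_rcons => /andP[_ /andP[_]].
Qed.

End SecondOrderFreeness.

Section FreeSecondOrder.
Context {R : realType} {H : realHilbertType R}.
Local Notation C := R[i].
Local Notation A := (omega_alg H).
Local Notation word := (seq H).
Local Notation ofreals := (map (@ofreal R H)).
Variables (r : nat) (K : 'I_r -> {pred H}).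
Hypothesis orthK : forall k l, k != l ->
  forall f g, f \in K k -> g \in K l -> ip f g = 0.
Local Notation S := (fun k => unital_alg_gen [set omega f | f in [set f | f \in K k]]).
Local Notation okb := (okb K).
Local Notation alt := (@alt R H r).
Local Notation block := (@block R H r).
Local Notation star := (@omega_star R H).
Implicit Types (a b : A) (u v w : word) (xs ys zs : seq block) (s t : seq A).

Lemma phi_star b : phi (star b) = (phi b)^*.
Proof. by rewrite /phi -[op (star b) _]/(adj b _) fock_ipC -adjE. Qed.

Lemma S_star c b : b \in S c -> exists2 l, words_in (K c) l & star b = wsum l.
Proof.
case/unital_alg_wsum => l lK ->; rewrite star_wsum.
exists [seq (p.1^*, rev p.2) | p <- l] => //.
by rewrite /words_in all_map; apply/allP => p pl /=; rewrite all_rev (allP lK).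
Qed.

(** The factors of a product, being centered, have blocks of the colors of their
    algebras. *)
Lemma blocks_exist (i : nat -> 'I_r) s :
  (forall k, (k < size s)%N ->
     phi s`_k = 0 /\ exists2 l, words_in (K (i k)) l & s`_k = wsum l) ->
  exists xs, [/\ all okb xs, acts_by_blocks K xs s &
    map fst xs = [seq i k | k <- iota 0 (size s)]].
Proof.
elim: s i => [|a s IH] i hs; first by exists [::].
have [xs [xsok hxs cxs]] := IH (fun k => i k.+1) (fun k ks => hs k.+1 ks).
have [a0 ha] := hs 0%N isT; have [x [xc xok hx]] := wsum_block orthK ha a0.
exists (x :: xs); split; first by rewrite /= xok.
  by rewrite /= xc.
by rewrite /= xc cxs (iotaDl 1 0) -map_comp.
Qed.

Lemma nth_colors (i : nat -> 'I_r) n c0 k : (k < n)%N ->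
  nth c0 [seq i k | k <- iota 0 n] k = i k.
Proof. by move=> kn; rewrite (nth_map 0%N) ?size_iota// nth_iota. Qed.

Lemma sorted_colors xs (i : nat -> 'I_r) n :
  map fst xs = [seq i k | k <- iota 0 n] ->
  (forall k, (k.+1 < n)%N -> i k != i k.+1) -> sorted alt xs.
Proof.
move=> xsE ia; have -> : sorted alt xs = sorted (fun c d => c != d) (map fst xs).
  by rewrite sorted_map.
rewrite xsE; apply/(sortedP (i 0%N)) => k; rewrite size_map size_iota => kn.
by rewrite !nth_colors ?ia// ltnW.
Qed.

Lemma cycle_colors xs (i : nat -> 'I_r) n :
  map fst xs = [seq i k | k <- iota 0 n] ->
  (forall k, (k < n)%N -> i k != i (k.+1 %% n)%N) -> cycle alt xs.
Proof.
move=> xsE ia.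
have -> : cycle alt xs = cycle (fun c d => c != d) (map fst xs).
  by case: (xs) => //= x xs'; rewrite -map_rcons path_map.
rewrite xsE; case: n ia {xsE} => // n ia /=.
apply/(pathP (i 0%N)) => k; rewrite size_rcons size_map size_iota => kn.
have /= e1 := @nth_colors i n.+1 (i 0%N) k kn.
rewrite -rcons_cons nth_rcons /= size_map size_iota kn e1.
rewrite nth_rcons size_map size_iota; have := ia k kn.
move: kn; rewrite ltnS leq_eqVlt => /predU1P[->|kn].
  by rewrite ltnn eqxx modnn.
rewrite kn modn_small// => h.
by have /= -> := @nth_colors i n.+1 (i 0%N) k.+1 kn.
Qed.

Lemma cyc_blocks s : (0 < size s)%N -> cyclically_alternating S s ->
  centered (@phi R H) s ->
  exists xs, [/\ all okb xs, acts_by_blocks K xs s, sorted alt xs &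
    (2 <= size s)%N -> cycle alt xs].
Proof.
move=> s0 [i [iS ia]] sc.
have [|xs [xsok hxs xsE]] := @blocks_exist i s.
  by move=> k ks; split; [exact: sc|exact/unital_alg_wsum/iS].
exists xs; split => // [|s2]; last by apply: (cycle_colors xsE) => k; exact: ia.
have [s2|s2] := leqP 2 (size s).
  have := cycle_colors xsE (ia s2).
  by case: (xs) => //= x xs'; rewrite rcons_path => /andP[].
apply: (sorted_colors xsE) => k ks.
by have := leq_ltn_trans (ltn0Sn k) ks; lia.
Qed.

Lemma rev_blocks xs s : acts_by_blocks K xs s -> acts_by_blocks K (rev xs) (rev s).
Proof.
elim: xs s => [|x xs IH] [|a s] //= [ha hs].
by rewrite !rev_cons; apply: acts_by_rcons => //; exact: IH.
Qed.

Lemma cyc_star_blocks t : (0 < size t)%N -> cyclically_alternating S t ->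
  centered (@phi R H) t ->
  exists zs, [/\ all okb zs, acts_by_blocks K zs (map star t), sorted alt (rev zs) &
    (2 <= size t)%N -> cycle alt (rev zs)].
Proof.
move=> t0 [i [iS ia]] tc.
have altC : (fun z y : block => alt y z) = alt.
  by apply/funext => y; apply/funext => z; congr (~~ _); exact: eq_sym.
have [|zs [zsok hzs zsE]] := @blocks_exist i (map star t).
  move=> k; rewrite size_map => kt; rewrite (nth_map 0)// phi_star tc// rmorph0.
  by split => //; apply/S_star/iS.
rewrite size_map in zsE.
have zc : (2 <= size t)%N -> cycle alt (rev zs).
  by move=> t2; rewrite rev_cycle altC; apply: (cycle_colors zsE); exact: ia.
exists zs; split => //; rewrite rev_sorted altC.
have [t2|t2] := leqP 2 (size t).
  have := cycle_colors zsE (ia t2).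
  by case: (zs) => //= z zs'; rewrite rcons_path => /andP[].
apply: (sorted_colors zsE) => k ks.
by have := leq_ltn_trans (ltn0Sn k) ks; lia.
Qed.

(** The adjoint reverses the order of the factors of the second product. *)
Lemma rho_cyc xs ys s t : (2 <= size xs)%N -> (2 <= size ys)%N ->
  all okb xs -> all okb ys -> cycle alt xs -> cycle alt ys ->
  acts_by_blocks K xs s -> acts_by_blocks K ys (rev (map star t)) ->
  rho (\prod_(a <- s) a) (\prod_(b <- t) b) =
  \sum_(j < size ys) pip xs (rot j (map (@cblock _ _ _) ys)).
Proof.
move=> xs2 ys2 xsok ysok xsc ysc hs ht.
have cs zs : cycle alt zs -> sorted alt zs.
  by case: zs => //= z zs; rewrite rcons_path => /andP[].
rewrite (rho_prod xsok ysok (cs _ xsc) (cs _ ysc) hs ht).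
have ysok' : all okb (map (@cblock _ _ _) ys).
  by rewrite all_map; apply: sub_all ysok => y; rewrite /= okb_cblock.
have ysc' : cycle alt (map (@cblock _ _ _) ys) by rewrite cycle_cblock.
rewrite -(size_map (@cblock R H r) ys) -(LS_rot orthK)//; last by rewrite size_map.
apply: (eq_LS xsok) => u us; apply: (eq_LS ysok') => v vs.
rewrite (supp_cword orthK xs2 xsc us) (supp_cword orthK _ ysc' vs) ?size_map//.
rewrite cyc_ip_ctens /cwip size_map; apply: eq_bigr => k _.
by rewrite /wipw map_rot.
Qed.

Lemma supp_single xs u : size xs = 1%N -> supp K xs u -> exists c, all [in K c] u.
Proof.
by case: xs => [|x [|? ?]]//= _ [w [u' [-> _ wK ->]]]; exists x.1; rewrite cats0.
Qed.

Lemma cyc_ip_tsum l z : cyc_ip (cmap (tsum l [::])) z =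
  \sum_(p <- l) p.1 * cyc_ip (cword (ofreals p.2)) z.
Proof.
have c0 : cmap (0 : Flin H) = 0.
  by have := cmap_linear (-1) 0 (0 : Flin H); rewrite !scaleN1r oppr0 addr0 addNr.
rewrite /tsum; elim: l => [|p l IH].
  by rewrite !big_nil c0 cyc_ipC cyc_ip0r rmorph0.
rewrite !big_cons -IH -[in RHS](cats0 p.2) -cmap_tens -cyc_ip_linearl.
by congr cyc_ip; exact: cmap_linear.
Qed.

Lemma supp_other c xs u : (2 <= size xs)%N -> sorted alt xs -> supp K xs u ->
  exists d f, [/\ c != d, f \in u & f \in K d].
Proof.
case: xs => [|x [|y xs]] // _ /= /andP[xy _].
move=> [[|f w] [u' [-> // _ /= /andP[fK _] [[|g w'] [u'' [-> // _ /= /andP[gK _] _]]]]]].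
have [cx|cx] := eqVneq c x.1.
  exists y.1, g; split => //; first by rewrite cx.
  by rewrite inE mem_cat inE eqxx !orbT.
by exists x.1, f; rewrite inE eqxx.
Qed.

(** By traciality, [phi (a * b)] is the inner product of the vectors of [a] and of
    [star b]. *)
Lemma bil_phi x z a b : acts_by K x.1 x.2 a -> acts_by K z.1 z.2 (star b) ->
  bil x (cblock z) = phi (a * b).
Proof.
move=> hx hz; rewrite phi_trace /phi -[op (b * a) _]/(op b (op a (vac H))) adjE.
rewrite -[adj b _]/(op (star b) (vac H)) (hx [::])// (hz [::])//.
rewrite /tsum (sum_fock_ip x.2 (fun w => tens (ofreals (w ++ [::])))).
apply: eq_bigr => p _; rewrite fock_ipC.
rewrite (sum_fock_ip z.2 (fun w => tens (ofreals (w ++ [::])))) rmorph_sum mulr_sumr.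
rewrite big_map; apply: eq_bigr => q _.
by rewrite rmorphM /= !cats0 fock_ip_tens /wipw (wipC (ofreals p.2)); ring.
Qed.

Lemma nth_acts_by xs s x0 k : acts_by_blocks K xs s -> (k < size s)%N ->
  acts_by K (nth x0 xs k).1 (nth x0 xs k).2 s`_k.
Proof.
elim: xs s k => [|x xs IH] [|a s] [|k] //= [ha hs]; first by [].
by move=> ks; exact: IH.
Qed.

Lemma nth_rot (T : Type) (x0 : T) (l : seq T) i j : (i < size l)%N -> (j < size l)%N ->
  nth x0 (rot j l) i = nth x0 l ((i + j) %% size l)%N.
Proof.
move=> il jl; rewrite /rot nth_cat size_drop nth_drop.
case: ltnP => h; first by rewrite modn_small addnC//; lia.
rewrite nth_take; last by lia.
have -> : (i + j = (i - (size l - j)) + size l)%N by lia.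
by rewrite modnDr modn_small//; lia.
Qed.

(** Two products of different lengths have no rotation that matches them block by
    block; if one of them is a single factor, it has one color, whereas the other
    product has at least two. *)
Lemma free_second_order_omega : free_second_order (@phi R H) (@rho R H) S.
Proof.
split.
- move=> s s0 [i [iS ia]] sc.
  have [|xs [xsok hxs xsE]] := @blocks_exist i s.
    by move=> k ks; split; [exact: sc|exact/unital_alg_wsum/iS].
  have xsa := sorted_colors xsE ia.
  rewrite /phi (LS_prod (L := fun x => fock_ip x (vac H)) _ _ xsok xsa hxs);
    [|by move=> x y; exact: fock_ipDl|by move=> e x; exact: fock_ipZl].
  apply: LS0 xsok _ => u us; rewrite fock_ip_tens.
  case: u us => // /supp_nil xs0; move: s0; rewrite -(acts_by_size hxs) xs0.
  by [].
- move=> s t s0 t0 sa sc ta tc st.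
  have [xs [xsok hxs xsa xsc]] := cyc_blocks s0 sa sc.
  have [zs [zsok hzs zsa zsc]] := cyc_star_blocks t0 ta tc.
  have hrz := rev_blocks hzs; have rzok : all okb (rev zs) by rewrite all_rev.
  have sxs := acts_by_size hxs; have szs := acts_by_size hzs; rewrite size_map in szs.
  have rzok' : all okb (map (@cblock _ _ _) (rev zs)).
    by rewrite all_map; apply: sub_all rzok => y; rewrite /= okb_cblock.
  have rza : sorted alt (map (@cblock _ _ _) (rev zs)) by rewrite alt_cblock.
  have rho0 : (forall u v, supp K xs u -> supp K (map (@cblock _ _ _) (rev zs)) v ->
      cyc_ip (cword (ofreals u)) (cword (ofreals v)) = 0 :> C) ->
      rho (\prod_(a <- s) a) (\prod_(b <- t) b) = 0.
    move=> h; rewrite (rho_prod xsok rzok xsa zsa hxs hrz).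
    by apply: (LS0 xsok) => u us; apply: (LS0 rzok') => v; exact: h.
  have size1 (l : seq A) : (0 < size l)%N -> (size l < 2)%N -> size l = 1%N.
    by case: l => [|? []].
  have [s2|s2] := leqP 2 (size s); have [t2|t2] := leqP 2 (size t).
  + rewrite (rho_cyc _ _ xsok rzok (xsc s2) (zsc t2) hxs hrz) ?sxs ?size_rev ?szs//.
    rewrite big1// => j _; apply: pip_size.
    by rewrite size_rot size_map size_rev sxs szs.
  + apply: rho0 => u v us vs; have [c vK] : exists c, all [in K c] v.
      by apply: supp_single vs; rewrite size_map size_rev szs; exact: size1.
    have x2 : (2 <= size xs)%N by rewrite sxs.
    have [d [f [cd fu fK]]] := supp_other c x2 xsa us.
    rewrite (supp_cword orthK x2 (xsc s2) us) cyc_ipC.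
    by rewrite (cyc_ip_color orthK cd vK fu fK) rmorph0.
  + apply: rho0 => u v us vs; have [c uK] : exists c, all [in K c] u.
      by apply: supp_single us; rewrite sxs; exact: size1.
    have z2 : (2 <= size (map (@cblock R H r) (rev zs)))%N.
      by rewrite size_map size_rev szs.
    have [d [f [cd fv fK]]] := supp_other c z2 rza vs.
    by rewrite (supp_cword orthK z2 _ vs) ?cycle_cblock ?zsc// (cyc_ip_color orthK cd uK fv fK).
  + by move: st; rewrite (size1 s s0 s2) (size1 t t0 t2).
- move=> i j a b ij aS bS.
  have [l lK la] := wsum_acts_by orthK (unital_alg_wsum aS).
  have [m mK lb] := wsum_acts_by orthK (S_star bS).
  rewrite /rho /vac (la [::])// (lb [::])// cyc_ip_tsum big_seq big1// => p pl.
  rewrite cyc_ipC cyc_ip_tsum big_seq big1 ?rmorph0 ?mulr0// => q qm.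
  rewrite cyc_ipC (cyc_ip_colors orthK ij) ?rmorph0 ?mulr0//.
    exact: (allP lK).
  exact: (allP mK).
- move=> s t s2 ts sa sc ta tc.
  have t2 : (2 <= size t)%N by rewrite ts.
  have [xs [xsok hxs xsa xsc]] := cyc_blocks (ltnW s2) sa sc.
  have [zs [zsok hzs zsa zsc]] := cyc_star_blocks (ltnW t2) ta tc.
  have hrz := rev_blocks hzs; have rzok : all okb (rev zs) by rewrite all_rev.
  have sxs := acts_by_size hxs; have := acts_by_size hzs; rewrite size_map ts => szs.
  rewrite (rho_cyc _ _ xsok rzok (xsc s2) (zsc t2) hxs hrz) ?sxs ?size_rev ?szs//.
  pose G j := \prod_(i < size s) phi (s`_i * t`_(size s - ((i + j) %% size s).+1)).
  transitivity (\sum_(j < size s) G j).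
    apply: eq_bigr => j _; case: xs sxs {xsok xsa xsc} hxs => [|x0 xs] sxs hxs.
      by exfalso; move: s2; rewrite -sxs.
    rewrite (pipE x0) ?size_rot ?size_map ?size_rev ?szs// sxs.
    apply: eq_bigr => i _; have n0 : (0 < size s)%N := ltnW s2.
    have zsize : size (map (@cblock R H r) (rev zs)) = size s by rewrite size_map size_rev.
    have ijn : ((i + j) %% size s < size s)%N by rewrite ltn_mod.
    rewrite nth_rot ?zsize ?ltn_ord// (nth_map x0) ?size_rev ?szs// nth_rev ?szs//.
    apply: bil_phi; first exact: nth_acts_by hxs (ltn_ord i).
    rewrite -(nth_map 0 0) ?ts; last by lia.
    by apply: (nth_acts_by hzs); rewrite size_map ts; lia.
  rewrite {}/G; case: (size s) s2 => // m _.
  rewrite big_ord_recl [RHS]big_ord_recl; congr (_ + _).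
    by apply: eq_bigr => i _; rewrite /= !addn0 !modn_small ?ltn_ord ?subSS ?ltnS ?leq_subr.
  (* The rotation by [j] blocks of the reversed product is the rotation by [n - j], modulo
     [n], of the product itself; [j = 0] has been split off. *)
  rewrite [RHS](reindex_inj rev_ord_inj); apply: eq_bigr => j _.
  apply: eq_bigr => i _; congr (phi (_ * t`_ _)); rewrite /= /bump !leq0n !add1n.
  have := ltn_ord i; have := ltn_ord j; move: (nat_of_ord i) (nat_of_ord j) => a b bm am.
  have [h|h] := ltnP (a + b.+1) m.+1.
    rewrite (modn_small h) (_ : (m.+1 - a.+1 + (m - b.+1).+1 = m.+1 - (a + b.+1).+1 + m.+1)%N); last by lia.
    by rewrite modnDr modn_small//; lia.
  rewrite -{1}(subnK h) modnDr !modn_small//; lia.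
Qed.

End FreeSecondOrder.

(** * From words to polynomials *)

Section CumulantLinear.
Context {R : realType} d {T : measurableType d} (P : probability T R) (r : nat).
Local Notation C := R[i].
Local Notation cfm := (cfm P).
Implicit Types (U V : T -> C).

Definition upd (A : Type) (Y : 'I_r -> A) k y : 'I_r -> A :=
  fun j => if j == k then y else Y j.

(** Each partition has exactly one block that contains [k]. *)
Lemma cumulantDZ (Y : 'I_r -> T -> C) k c U V :
  (forall i, cfm (Y i)) -> cfm U -> cfm V ->
  cumulant P (upd Y k (fun w => c * U w + V w)) =
  c * cumulant P (upd Y k U) + cumulant P (upd Y k V).
Proof.
move=> Yfm Ufm Vfm; rewrite /cumulant mulr_sumr -big_split /=.
apply: eq_bigr => p /and3P[/eqP cov /finset.trivIsetP tr _]; rewrite mulrCA -mulrDr; congr (_ * _).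
have kp : k \in finset.cover p by rewrite cov finset.in_setT.
have Bp := finset.pblock_mem kp; have kB : k \in finset.pblock p k by rewrite finset.mem_pblock.
have rest Z Z' : \prod_(B in p | B != finset.pblock p k) cexpect P (fun w => \prod_(i in B) upd Y k Z i w)
    = \prod_(B in p | B != finset.pblock p k) cexpect P (fun w => \prod_(i in B) upd Y k Z' i w).
  apply: eq_bigr => B /andP[pB BB]; congr cexpect; apply/funext => w.
  apply: eq_bigr => i iB; rewrite /upd; case: eqVneq => // ik.
  by have /pred0P/(_ i)/= := tr _ _ pB Bp BB; rewrite iB ik kB.
have block Z : cexpect P (fun w => \prod_(i in finset.pblock p k) upd Y k Z i w) =
    cexpect P (fun w => Z w * \prod_(i in finset.pblock p k | i != k) Y i w).
  congr cexpect; apply/funext => w; rewrite (bigD1 k) //= /upd eqxx; congr (_ * _).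
  by apply: eq_bigr => i /andP[_ /negPf ->].
pose W w := \prod_(i in finset.pblock p k | i != k) Y i w.
have Wfm : cfm W by exact: cfm_prod.
rewrite (bigD1 _ Bp) [in X in c * X](bigD1 _ Bp) [in X in _ + X](bigD1 _ Bp) /=.
rewrite (rest _ U) (rest V U) !block mulrA -mulrDl; congr (_ * _).
have UW := cfmM Ufm Wfm; have VW := cfmM Vfm Wfm.
rewrite -(cexpectZ c UW) -(cexpectD (cfmZ c UW) VW).
by congr cexpect; apply/funext => w; rewrite mulrDl mulrA.
Qed.

Lemma cumulantZ (Y : 'I_r -> T -> C) k c U : (forall i, cfm (Y i)) -> cfm U ->
  cumulant P (upd Y k (fun w => c * U w)) = c * cumulant P (upd Y k U).
Proof.
move=> Yfm Ufm; have c0 : cfm (fun=> 0) by exact: cfm_cst.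
have z0 : cumulant P (upd Y k (fun=> 0)) = 0.
  rewrite -[RHS](addNr (cumulant P (upd Y k (fun=> 0)))) -mulN1r.
  rewrite -(cumulantDZ k (-1) Yfm c0 c0).
  by congr (cumulant _ (upd _ _ _)); apply/funext => w; rewrite mulr0 addr0.
have := cumulantDZ k c Yfm Ufm c0; rewrite z0 addr0 => <-.
by congr (cumulant _ (upd _ _ _)); apply/funext => w; rewrite addr0.
Qed.

End CumulantLinear.

Section PolynomialWords.
Context {R : realType} {I : choiceType}.
Local Notation C := R[i].
Local Notation poly := (ncpoly R I).

Definition monom (m : fmonom I) : poly := mkmalgU m 1.

Lemma ncpoly_ind (Q : poly -> Prop) : Q 0 ->
  (forall c m p, Q p -> Q (c *: monom m + p)) -> forall p, Q p.
Proof.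
move=> Q0 QS p; rewrite (monalgE p); elim: (finmap.enum_fset (msupp p)) => [|m s IH].
  by rewrite big_nil.
rewrite big_cons; have -> : mkmalgU m (mcoeff m p) = mcoeff m p *: monom m.
  by apply/malgP => u; rewrite mcoeffZ !mcoeffU mulrnAr mulr1.
exact: QS.
Qed.

Lemma nceval_lext (A : lalgType C) (x : I -> A) (p : poly) :
  nceval x p = lext (fun m : fmonom I => \prod_(i <- (m : seq I)) x i) p.
Proof. by rewrite lext.unlock; apply: eq_bigr => m _; rewrite mulr_algl. Qed.

Lemma nceval_linear (A : lalgType C) (x : I -> A) c (p q : poly) :
  nceval x (c *: p + q) = c *: nceval x p + nceval x q.
Proof. by rewrite !nceval_lext lext_linear. Qed.

Lemma nceval_monom (A : lalgType C) (x : I -> A) m :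
  nceval x (monom m) = \prod_(i <- (m : seq I)) x i.
Proof. by rewrite nceval_lext lextU scale1r. Qed.

End PolynomialWords.

(** * The second order limit of the Gaussian matrices *)

Section SecondOrderLimit.
Context {R : realType} {H : realHilbertType R} {d : nat -> measure_display}
  {T : forall N, measurableType (d N)}.
Variables (P : forall N, probability (T N) R)
  (X : forall N, H -> T N -> 'M[R[i]]_N.+1).
Hypothesis hX : forall N, hermitian_gaussian (P N) (@X N).
Local Notation C := R[i].
Local Notation A := (omega_alg H).
Local Notation word := (seq H).
Local Notation tendsto u l := (((u) : nat -> C^o) @ \oo --> ((l) : C^o)).
Local Notation M N := (trmoment (P N) (@X N)).
Local Notation K N := (lcum (M N)).
Implicit Types (a b : A) (u v w : word).

Let Mnil N : M N [::] = 1. Proof. exact: trmoment_nil. Qed.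

Lemma K_nil N S : K N [::] S = N.+1%:R * one C S.
Proof. by exact: (lcum_empty (Mnil N) (trmoment_empty (@hX N))). Qed.

Lemma K_cons N f w S : K N (f :: w) S = N.+1%:R^-1 *
  (cutsum (fun u g v => (ip f g)%:C%C * (K N u (v :: S) + conv (K N u) (K N v) S)) w +
   delsum (fun w' S' => cutsum (fun u g v => (ip f g)%:C%C * K N (w ++ v ++ u) S') w') S).
Proof. by exact: (lcum_loop (Mnil N) (trmoment_loop (@hX N))). Qed.

Lemma cumulant_words N r (v : 'I_r.+1 -> word) :
  cumulant (P N) (fun j x => \tr (\prod_(f <- v j) X f x : 'M[C]_N.+1)) =
  K N (v ord0) [seq v (lift ord0 i) | i <- enum 'I_r].
Proof.
rewrite -(cumulant_lcum v (Mnil N)) /cumulant; apply: eq_bigr => p _.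
congr (_ * _); apply: eq_bigr => B _; congr cexpect; apply/funext => x.
by rewrite big_map big_enum.
Qed.

(** The cumulant of two variables is their covariance. *)
Lemma rhow_lim w1 w2 :
  tendsto (fun N => M N [:: w1; w2] - M N [:: w1] * M N [:: w2]) (rhow w1 w2).
Proof.
rewrite (_ : (fun N => _) = fun N => scum (fun N => K N) N w1 [:: w2]).
  exact: scum_rho K_nil K_cons _ _.
apply/funext => N; rewrite /scum expr1 mulVKf ?pnatr_eq0//.
have := congr1 (fun F => F [:: w2]) (lcumM (Mnil N) w1); rewrite /= lcum_nil Mnil mulr1.
by move=> <-; rewrite addrK.
Qed.

(** Identities between covariances for every size of the matrices pass to the limit. *)
Lemma rhow_uniq w1 w2 w3 w4 :
  (forall N, M N [:: w1; w2] - M N [:: w1] * M N [:: w2] =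
             M N [:: w3; w4] - M N [:: w3] * M N [:: w4]) ->
  rhow w1 w2 = rhow w3 w4.
Proof.
move=> e; have h := @rhow_lim w1 w2; rewrite (_ : (fun N => _) = fun N =>
  M N [:: w3; w4] - M N [:: w3] * M N [:: w4]) in h; last by apply/funext.
exact: (cvg_unique (@norm_hausdorff _ C^o) h (@rhow_lim w3 w4)).
Qed.

Lemma trmoment_catC N u v S : M N ((u ++ v) :: S) = M N ((v ++ u) :: S).
Proof.
congr cexpect; apply/funext => x; rewrite !big_cons; congr (_ * _).
by rewrite !big_cat mxtrace_mulC.
Qed.

Lemma trmoment_swap N w1 w2 : M N [:: w1; w2] = M N [:: w2; w1].
Proof. by congr cexpect; apply/funext => x; rewrite !big_cons !big_nil !mulr1 mulrC. Qed.

Lemma rhow_catCl u v w : rhow (u ++ v) w = rhow (v ++ u) w.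
Proof. by apply: rhow_uniq => N; rewrite !(trmoment_catC N u v). Qed.

Lemma rhow_catCr u v w : rhow w (u ++ v) = rhow w (v ++ u).
Proof.
apply: rhow_uniq => N; rewrite !(trmoment_swap N w).
by rewrite !(trmoment_catC N u v).
Qed.

Lemma rho_linearl b : scalar (rho (H := H) ^~ b).
Proof.
move=> c a a'; rewrite /rho -[op (_ + _) _]/(c *: op a (vac H) + op a' (vac H)).
by rewrite (cmap_linear c (op a (vac H))); exact: cyc_ip_linearl.
Qed.

Lemma rho_linearr a : scalar (rho (H := H) a).
Proof.
move=> c b b'; rewrite /rho.
rewrite -[op (omega_star (_ + _)) _]/(c^* *: op (omega_star b) (vac H) + op (omega_star b') _).
by rewrite (cmap_linear _ (op (omega_star b) (vac H))) cyc_ip_linearr conjCK.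
Qed.

Lemma rho_tracel a b c : rho (a * b) c = rho (b * a) c :> C.
Proof.
have rho0 x : rho (0 : A) x = 0.
  by have := rho_linearl x (-1) 0 0; rewrite scaler0 addr0 mulN1r addNr.
have rho0r x : rho x (0 : A) = 0.
  by have := rho_linearr x (-1) 0 0; rewrite scaler0 addr0 mulN1r addNr.
elim/(@omega_alg_ind R H): a => [|e w x IH]; first by rewrite mul0r mulr0.
rewrite mulrDl mulrDr -scalerAl -scalerAr !rho_linearl IH; congr (_ * _ + _).
elim/(@omega_alg_ind R H): b {IH} => [|e' w' y IH]; first by rewrite mul0r mulr0.
rewrite mulrDl mulrDr -scalerAl -scalerAr !rho_linearl IH; congr (_ * _ + _).
elim/(@omega_alg_ind R H): c {IH} => [|e'' w'' z IH]; first by rewrite !rho0r.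
by rewrite !rho_linearr IH -!omegaw_cat !rho_omegaw rhow_catCl.
Qed.

Lemma rho_tracer a b c : rho a (b * c) = rho a (c * b) :> C.
Proof.
have rho0 x : rho (0 : A) x = 0.
  by have := rho_linearl x (-1) 0 0; rewrite scaler0 addr0 mulN1r addNr.
elim/(@omega_alg_ind R H): a => [|e w x IH]; first by rewrite !rho0.
rewrite !rho_linearl IH; congr (_ * _ + _).
elim/(@omega_alg_ind R H): b {IH} => [|e' w' y IH]; first by rewrite mul0r mulr0.
rewrite mulrDl mulrDr -scalerAl -scalerAr !rho_linearr IH; congr (_ * _ + _).
elim/(@omega_alg_ind R H): c {IH} => [|e'' w'' z IH]; first by rewrite mul0r mulr0.
rewrite mulrDl mulrDr -scalerAl -scalerAr !rho_linearr IH; congr (_ * _ + _).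
by rewrite -!omegaw_cat !rho_omegaw rhow_catCr.
Qed.

Lemma second_order_space_omega : second_order_space (@phi R H) (@rho R H).
Proof.
have cyc0 z : cyc_ip (cmap (vac H)) z = 0 :> C.
  by rewrite cmap_tens cyc_ipC cyc_ip0r rmorph0.
split.
- exact: phi_linear.
- by have <- : omegaw [::] = 1 :> A; [rewrite /omegaw big_nil|rewrite phi_omegaw].
- exact: phi_trace.
- exact: rho_linearl.
- exact: rho_linearr.
- exact: rho_tracel.
- exact: rho_tracer.
- by move=> b; exact: cyc0.
- by move=> a; rewrite /rho cyc_ipC cyc0 rmorph0.
Qed.

End SecondOrderLimit.

Section PolynomialLimit.
Context {R : realType} {H : realHilbertType R} {d : nat -> measure_display}
  {T : forall N, measurableType (d N)}.
Variables (P : forall N, probability (T N) R)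
  (X : forall N, H -> T N -> 'M[R[i]]_N.+1).
Hypothesis hX : forall N, hermitian_gaussian (P N) (@X N).
Variables (I : choiceType) (h : I -> H).
Local Notation C := R[i].
Local Notation tendsto u l := (((u) : nat -> C^o) @ \oo --> ((l) : C^o)).
Local Notation K N := (lcum (trmoment (P N) (@X N))).
Local Notation poly := (ncpoly R I).
Local Notation XI := (fun N (i : I) (x : T N) => X (h i) x).
Local Notation word m := (map h (m : seq I)).
Implicit Types (p q : poly) (m : fmonom I).

Lemma trp_linear N c p q (x : T N) :
  trp XI (c *: p + q) x = c * trp XI p x + trp XI q x.
Proof. by rewrite /trp nceval_linear mxtraceD mxtraceZ. Qed.

Lemma trp_monom N m (x : T N) :
  trp XI (monom m) x = \tr (\prod_(f <- word m) X f x : 'M[C]_N.+1).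
Proof. by rewrite /trp nceval_monom big_map. Qed.

Lemma omega_monom m : nceval (fun i => omega (h i)) (monom m) = omegaw (word m).
Proof. by rewrite nceval_monom /omegaw big_map. Qed.

(** Thus what is linear and holds for monomials holds for zero. *)
Lemma ncpoly0E : (0 : poly) = (-1) *: monom (fmone I) + monom (fmone I).
Proof. by rewrite scaleN1r addNr. Qed.

Lemma cfm_trp N p : cfm (P N) (trp XI p).
Proof.
have mfm m : cfm (P N) (trp XI (monom m)).
  by rewrite (funext (@trp_monom N m)); exact: (cfm_trace (@hX N)).
have lin c q q' : cfm (P N) (trp XI q) -> cfm (P N) (trp XI q') ->
    cfm (P N) (trp XI (c *: q + q')).
  move=> hq hq'; rewrite (funext (@trp_linear N c q q')).
  by apply: cfmD => //; exact: cfmZ.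
elim/(@ncpoly_ind R I): p => [|c m p IH]; last exact: lin (mfm m) IH.
by rewrite ncpoly0E; exact: lin (mfm _) (mfm _).
Qed.

Lemma cumulant_trpD N r (p : 'I_r -> poly) k c q q' :
  cumulant (P N) (fun j => trp XI (upd p k (c *: q + q') j)) =
  c * cumulant (P N) (fun j => trp XI (upd p k q j)) +
  cumulant (P N) (fun j => trp XI (upd p k q' j)).
Proof.
have e q0 : cumulant (P N) (fun j => trp XI (upd p k q0 j)) =
    cumulant (P N) (upd (fun j => @trp R d T I XI N (p j)) k (trp XI q0)).
  by congr cumulant; apply/funext => j; rewrite /upd; case: (j == k).
apply: etrans (e _) _; apply: etrans _ (esym (congr2 (fun u v => c * u + v) (e q) (e q'))).
have hp i : cfm (P N) (@trp R d T I XI N (p i)) by exact: cfm_trp.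
apply: etrans _ (cumulantDZ k c hp (@cfm_trp N q) (@cfm_trp N q')).
by congr cumulant; congr upd; apply/funext => x; exact: trp_linear.
Qed.

Lemma tendsto_lin (x y : nat -> C) lx ly c : tendsto x lx -> tendsto y ly ->
  tendsto (fun N => c * x N + y N) (c * lx + ly).
Proof. by move=> hx hy; apply: cvgD hy; apply: cvgM hx; exact: cvg_cst. Qed.

(** Both sides are linear in each polynomial, so the limit is needed for monomials
    only. *)
Lemma tendsto_poly r (s : nat -> C) (L : ('I_r -> poly) -> C) :
  (forall (p : 'I_r -> poly) k c q q', L (upd p k (c *: q + q')) = c * L (upd p k q) + L (upd p k q')) ->
  (forall m : 'I_r -> fmonom I,
    tendsto (fun N => s N * cumulant (P N) (fun j => trp XI (monom (m j))))
      (L (fun j => monom (m j)))) ->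
  forall p : 'I_r -> poly, tendsto (fun N => s N * cumulant (P N) (fun j => trp XI (p j))) (L p).
Proof.
move=> Llin Lmon.
suff key k (p : 'I_r -> poly) : (k <= r)%N -> (forall i : 'I_r, (k <= i)%N -> exists m, p i = monom m) ->
    tendsto (fun N => s N * cumulant (P N) (fun j => trp XI (p j))) (L p).
  by move=> p; apply: (key r) => // i; rewrite leqNgt ltn_ord.
elim: k p => [|k IH] p kr pm.
  have /choice[m mE] : forall i, exists m, p i = monom m by move=> i; exact: pm.
  have -> : p = fun j => monom (m j) by apply/funext.
  exact: Lmon.
pose k0 := Ordinal kr.
pose F q N : C := s N * cumulant (P N) (fun j => trp XI (upd p k0 q j)).
have lin c q q' : tendsto (F q) (L (upd p k0 q)) -> tendsto (F q') (L (upd p k0 q')) ->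
    tendsto (F (c *: q + q')) (L (upd p k0 (c *: q + q'))).
  move=> hq hq'; have -> : F (c *: q + q') = fun N => c * F q N + F q' N.
    apply/funext => N; apply: etrans (congr1 (fun u => s N * u) (cumulant_trpD N p k0 c q q')) _.
    by rewrite mulrDr mulrCA.
  by rewrite Llin; exact: tendsto_lin hq hq'.
have mon m : tendsto (F (monom m)) (L (upd p k0 (monom m))).
  apply: IH; first exact: ltnW.
  move=> i ki; rewrite /upd; case: eqVneq => [_|ik]; first by exists m.
  by apply: pm; rewrite ltn_neqAle ki andbT; apply: contraNneq ik => e; apply/eqP/val_inj.
suff hF q : tendsto (F q) (L (upd p k0 q)).
  have pE : upd p k0 (p k0) = p by apply/funext => i; rewrite /upd; case: eqP => // ->.
  have e : (fun N => s N * cumulant (P N) (fun j => trp XI (p j))) = F (p k0).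
    by apply/funext => N; rewrite /F pE.
  by have := hF (p k0); rewrite pE -e.
elim/(@ncpoly_ind R I): q => [|c m q hq]; last exact: lin (mon m) hq.
by rewrite ncpoly0E; exact: lin (mon _) (mon _).
Qed.

Theorem second_order_limit_gaussian :
  second_order_limit P XI (@phi R H) (@rho R H) (fun i => omega (h i)).
Proof.
have Knil := K_nil hX; have Kcons := K_cons hX.
have cumE N r (m : 'I_r.+1 -> fmonom I) :
    cumulant (P N) (fun j => trp XI (monom (m j))) =
    K N (word (m ord0)) [seq word (m (lift ord0 i)) | i <- enum 'I_r].
  apply: etrans _ (@cumulant_words _ _ _ _ P X N r (fun j => word (m j))).
  by congr cumulant; apply/funext => j; apply/funext => x; exact: trp_monom.
have so := second_order_space_omega hX.
have enum0 : enum 'I_0 = [::] by apply: size0nil; rewrite size_enum_ord.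
have enum1 : enum 'I_1 = [:: ord0] by rewrite enum_ordSl enum0.
split => //.
- by move=> N s; apply/cfm_int/cfm_prod => p; exact: cfm_trp.
- move=> p; pose L (p : 'I_1 -> poly) := phi (nceval (fun i => omega (h i)) (p ord0)).
  rewrite (_ : (fun N => _) = fun N => N.+1%:R^-1 * cumulant (P N) (fun _ : 'I_1 => trp XI p)).
    apply: (@tendsto_poly 1 (fun N => N.+1%:R^-1) L _ _ (fun=> p)).
      move=> p' k c q q'; rewrite /L /upd (ord1 k) eqxx nceval_linear.
      exact: phi_linear.
    move=> m; rewrite /L omega_monom phi_omegaw.
    rewrite (_ : (fun N => _) = fun N => scum (fun N => K N) N (word (m ord0)) [::]).
      exact: scum_phi Knil Kcons _.
    by apply/funext => N; rewrite cumE enum0 /scum expr0 mul1r.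
  apply/funext => N; have pfm := @cfm_trp N p.
  have u U : (fun _ : 'I_1 => U) = upd (fun=> trp XI p) ord0 U :> ('I_1 -> T N -> C).
    by apply/funext => j; rewrite /upd (ord1 j) eqxx.
  rewrite (u (trp XI p)) -cumulantZ//; congr cumulant; exact: u.
- move=> p q.
  pose L (p : 'I_2 -> poly) := rho (nceval (fun i => omega (h i)) (p ord0))
    (nceval (fun i => omega (h i)) (p (lift ord0 ord0))).
  rewrite (_ : (fun N => _) = fun N => 1 * cumulant (P N)
    (fun j : 'I_2 => trp XI (if j == 0 then p else q))); last first.
    by apply/funext => N; rewrite mul1r.
  apply: (@tendsto_poly 2 (fun=> 1) L _ _ (fun j => if j == 0 then p else q)).
    move=> p' k c q1 q2; rewrite /L /upd; case: (unliftP ord0 k) => [j|] ->.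
      by rewrite (ord1 j) eqxx nceval_linear (so_rho_linearr so).
    by rewrite eqxx nceval_linear (so_rho_linearl so).
  move=> m; rewrite /L !omega_monom rho_omegaw.
  rewrite (_ : (fun N => _) = fun N =>
    scum (fun N => K N) N (word (m ord0)) [:: word (m (lift ord0 ord0))]).
    exact: scum_rho Knil Kcons _ _.
  by apply/funext => N; rewrite cumE enum1 /scum expr1 mulVKf ?pnatr_eq0// mul1r.
- move=> r p; case: r p => // r p r3.
  rewrite (_ : (fun N => _) = fun N => 1 * cumulant (P N) (fun j => trp XI (p j))); last first.
    by apply/funext => N; rewrite mul1r.
  apply: (@tendsto_poly r.+1 (fun=> 1) (fun=> 0)).
    by move=> p' k c q1 q2; rewrite mulr0 addr0.
  move=> m; rewrite (_ : (fun N => _) = fun N =>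
    K N (word (m ord0)) [seq word (m (lift ord0 i)) | i <- enum 'I_r]).
    by apply: (cum_tendsto0 Knil Kcons); rewrite size_map size_enum_ord.
  by apply/funext => N; rewrite cumE mul1r.
Qed.

End PolynomialLimit.

Theorem mainTheorem4 (R : realType) (H : realHilbertType R)
  (d : nat -> measure_display) (T : forall N, measurableType (d N))
  (P : forall N, probability (T N) R)
  (X : forall N, H -> T N -> 'M[R[i]]_N.+1)
  (hX : forall N, hermitian_gaussian (P N) (X N)) :
  second_order_limit P X (@phi R H) (@rho R H) (@omega R H) /\
  forall (n : nat) (K : 'I_n -> {pred H}),
    (forall k, submod_closed (K k)) ->
    (forall k l, k != l ->
       forall f g, f \in K k -> g \in K l -> ip f g = 0) ->
    free_second_order (@phi R H) (@rho R H)
      (fun k => unital_alg_gen [set omega f | f in [set f | f \in K k]]) /\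
    asymptotically_free_second_order P
      (fun k N (f : {f : H | f \in K k}) => X N (sval f)).
Proof.
Proof.
split; first exact: (second_order_limit_gaussian hX id).
move=> n K _ orthK; have free := free_second_order_omega orthK.
split => //; exists (omega_alg H), (@phi R H), (@rho R H), (fun k f => omega (sval f)).
split.
  exact: (second_order_limit_gaussian hX
    (fun u : {k : 'I_n & {f : H | f \in K k}} => sval (tagged u))).
congr free_second_order: free; apply/funext => k; congr unital_alg_gen.
apply/seteqP; split => [_ [f fK <-]|_ [[f fK] _ <-]]; last by exists f.
by exists (exist _ f fK).
Qed.
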